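(* Consider any of the six models (Gaussian, logistic, Poisson, probit, Gamma log-link, negative-binomial log-link) listed in the context under its stated restriction. Suppose $s_n^\star=o(p)$ and, for some fixed $0<c_F<C_F<\infty$, $c_F\le\rho_{\min}(n^{-1}F_S^0)\le\rho_{\max}(n^{-1}F_S^0)\le C_F$ for all $S\in\mathcal S_n^+$, and suppose $\max_{i,j}|X_{ij}|\le K_X$, $\max_{i,j}(w_i^0)^{1/2}|X_{ij}|\le K_V$ for fixed $K_X,K_V<\infty$. For a non-Gaussian model, also suppose that for a fixed $C$, uniformly over $S\in\mathcal S_n^+$ and unit $u\in\mathbb R^{|S|}$, $$\sum_iw_i^0|z_{i,S}^\top u|^3\le Cn^{-1/2},\qquad\sum_i(w_i^0)^2(z_{i,S}^\top u)^4\le Cn^{-1}.$$ Suppose $s_0^2\log p/n\to0$ and, in addition, $s_0^3/(n\log p)\to0$ for logistic, Poisson and probit regression, and $s_0^3/n\to0$ for Gamma and negative-binomial regression (no additional rate for Gaussian regression). Then: (a) there is a sequence $d_n\ge0$ with $d_n\sqrt{s_n^\star\log p}=o(1)$ such that $\log\mathbb E_{\beta^0}\exp\{\lambda u^\top(F_S^0)^{-1/2}\Delta_S\}\le\frac{\lambda^2}{2(1-|\lambda|d_n)}$ for every $S\in\mathcal S_n^+$, unit $u\in\mathbb R^{|S|}$ and $\lambda$ with $|\lambda|d_n<1$; (b) for every $S\in\mathcal S_n^+$, $\ell_{n,S}$ is concave on $\mathbb R^{|S|}$ for every sample, and there exist $r_n^0>0$, $\varepsilon_n\downarrow0$ with $r_n^0/\sqrt{s_n^\star\log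 p}\to\infty$, $\varepsilon_n(s_0+\log p)=o(\log p)$ such that, with $\mathbb P_{\beta^0}$-probability tending to one, $$\sup_{S\in\mathcal S_n^+}\sup_{h\in\mathcal B_S(r_n^0)}\big\|(F_S^0)^{-1/2}\{-\nabla_S^2\ell_{n,S}(\beta_S^0+h)-F_S^0\}(F_S^0)^{-1/2}\big\|_{\rm op}\le\varepsilon_n;$$ (c) there exist $r_n>0$ and deterministic $\bar\kappa_n^0\ge0$ with $r_n/\sqrt{s_0}\to\infty$, $s_0\bar\kappa_n^0\to0$ such that, with $\mathbb P_{\beta^0}$-probability tending to one, $$\sup_{0<\|\widehat J_{S_0}^{1/2}u\|_2\le r_n}\frac{\big\|\widehat J_{S_0}^{-1/2}\{-\nabla_{S_0}^2\ell_{n,S_0}(\widehat\beta_{S_0}+u)-\widehat J_{S_0}\}\widehat J_{S_0}^{-1/2}\big\|_{\rm op}}{\|\widehat J_{S_0}^{1/2}u\|_2}\le\bar\kappa_n^0.$$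
   Context: Asymptotics: $n\to\infty$; $p=p_n$ and all objects below may depend on $n$; constants called fixed do not. Standing assumptions: $s_0\ge1$, $\log p\to\infty$, $\log n=O(\log p)$. Model: $Y_1,\dots,Y_n$ are independent with densities $f_{i,\beta}(y_i)=\exp[\{y_i\theta_i-b(\theta_i)\}/\tau_i+k(y_i,\tau_i)]$ with respect to a dominating measure, $\tau_i>0$ known, $\theta_i=\xi(X_i^\top\beta)$, fixed predictors $X_i=(X_{i1},\dots,X_{ip})^\top\in\mathbb R^p$, $\mathbf X=(X_1,\dots,X_n)^\top$. Log likelihood: $\ell_n(\beta)=\sum_i[\{Y_i\xi(X_i^\top\beta)-b(\xi(X_i^\top\beta))\}/\tau_i+k(Y_i,\tau_i)]$. Data are generated at $\beta^0$; $\mathbb P_{\beta^0},\mathbb E_{\beta^0}$ refer to the law of $Y$ at $\beta^0$. $\eta_i^0=X_i^\top\beta^0$ and $w_i^0=b''\{\xi(\eta_i^0)\}\{\xi'(\eta_i^0)\}^2/\tau_i$. The six models and restrictions: (i) Gaussian: $b(\theta)=\theta^2/2$, $\xi(\eta)=\eta$, $w_i^0=\tau_i^{-1}$, variances $\tau_i$ known, bounded above and away from zero by fixed constants; (ii) logistic: $b(\theta)=\log(1+e^\theta)$, $\xi(\eta)=\eta$, $\tau_i=1$, $w_i^0=e^{\eta_i^0}(1+e^{\eta_i^0})^{-2}$; (iii) Poisson: $b(\theta)=e^\theta$, $\xi(\eta)=\eta$, $\tau_i=1$, $w_i^0=e^{\eta_i^0}$; (iv) probit: $b(\theta)=\log(1+e^\theta)$,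 $\tau_i=1$, $\xi(\eta)=\log\{\Phi(\eta)/(1-\Phi(\eta))\}$, $w_i^0=\phi(\eta_i^0)^2/[\Phi(\eta_i^0)\{1-\Phi(\eta_i^0)\}]$ ($\phi,\Phi$ the standard normal density and distribution function), restriction $\max_i|\eta_i^0|\le L$ with fixed $L<\infty$; (v) Gamma log-link: $b(\theta)=-\log(-\theta)$, $\xi(\eta)=-e^{-\eta}$, $w_i^0=\tau_i^{-1}$, dispersions $\tau_i$ known, bounded above and away from zero by fixed constants; (vi) negative-binomial log-link: $b(\theta)=-\kappa\log(1-e^\theta)$, $\xi(\eta)=\eta-\log(\kappa+e^\eta)$, $\tau_i=1$, $w_i^0=\kappa e^{\eta_i^0}/(\kappa+e^{\eta_i^0})$, fixed known $\kappa>0$. Notation: $S_0=\{j:\beta_j^0\ne0\}$, $s_0=|S_0|$; $\beta_S$ is a coordinate subvector, $\widetilde\beta_S\in\mathbb R^p$ its zero-padded extension, $\ell_{n,S}(\beta_S)=\ell_n(\widetilde\beta_S)$. $\Delta=\nabla\ell_n(\beta^0)$ with subvectors $\Delta_S$; $F^0=\mathbf X^\top\mathrm{diag}(w_i^0)\mathbf X$ with principal submatrices $F_S^0$; $z_{i,S}=(F_S^0)^{-1/2}X_{i,S}$. $\widehat\beta_{S_0}$ is the unique maximizer of $\ell_{n,S_0}$ and $\widehat J_{S_0}=-\nabla_{S_0}^2\ell_{n,S_0}(\widehat\beta_{S_0})$; on the exceptional event (of probability $o(1)$) where it does not exist or $\widehat J_{S_0}$ is not positive definite, set $\widehat\beta_{S_0}=0$,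 $\widehat J_{S_0}=I_{s_0}$. $K_0>1$ is a fixed, sufficiently large integer, $s_n^\star=K_0s_0+s_0$, $\mathcal S_n^+=\{S\supseteq S_0:|S|\le s_n^\star\}$, $\mathcal B_S(r)=\{h\in\mathbb R^{|S|}:\|(F_S^0)^{1/2}h\|_2\le r\}$. *)

(* Defs.v *)
From HB Require Import structures.
From mathcomp Require Import all_boot all_order all_algebra.
From mathcomp Require Import all_classical all_reals all_analysis.

Set Implicit Arguments.
Unset Strict Implicit.
Unset Printing Implicit Defensive.

Import Order.TTheory GRing.Theory Num.Theory.
Import numFieldNormedType.Exports.

Local Open Scope classical_set_scope.
Local Open Scope ring_scope.

Section LinearAlgebra.
Context {R : realType}.

Definition enorm q (v : 'cV[R]_q) : R := Num.sqrt (\sum_i v i 0 ^+ 2).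

Definition dotv q (u v : 'cV[R]_q) : R := (u^T *m v) 0 0.

Definition opnorm q (A : 'M[R]_q) : R :=
  sup [set enorm (A *m u) | u in [set u : 'cV[R]_q | enorm u <= 1]].

Definition psd q (A : 'M[R]_q) : Prop :=
  A^T = A /\ forall v : 'cV[R]_q, 0 <= dotv v (A *m v).

Definition posdef q (A : 'M[R]_q) : Prop :=
  A^T = A /\ forall v : 'cV[R]_q, v != 0 -> 0 < dotv v (A *m v).

(* A positive semidefinite A has exactly one positive semidefinite square
   root; the value is 0 when A is not positive semidefinite. *)
Definition sqrtmx q (A : 'M[R]_q) : 'M[R]_q :=
  xget 0 [set B : 'M[R]_q | psd B /\ B *m B = A].

Definition invsqrtmx q (A : 'M[R]_q) : 'M[R]_q := invmx (sqrtmx A).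

(* Only used for real symmetric matrices of positive size, whose real spectrum
   is finite and nonempty. *)
Definition rho_min q (A : 'M[R]_q) : R := inf [set a : R | eigenvalue A a].
Definition rho_max q (A : 'M[R]_q) : R := sup [set a : R | eigenvalue A a].

Definition gradient q (f : 'cV[R]_q -> R) (x : 'cV[R]_q) : 'cV[R]_q :=
  \col_j 'D_(delta_mx j 0) f x.

Definition hessian q (f : 'cV[R]_q -> R) (x : 'cV[R]_q) : 'M[R]_q :=
  \matrix_(i, j) 'D_(delta_mx i 0) ('D_(delta_mx j 0) f) x.

Definition concave q (f : 'cV[R]_q -> R) : Prop :=
  forall (x y : 'cV[R]_q) (t : R), 0 <= t <= 1 ->
    t * f x + (1 - t) * f y <= f (t *: x + (1 - t) *: y).

Definition unique_maximizer q (f : 'cV[R]_q -> R) (v : 'cV[R]_q) : Prop :=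
  forall x, x != v -> f x < f v.

End LinearAlgebra.

(* R^|S| is 'cV_#|S|, the coordinates being listed by enum_val : 'I_#|S| -> 'I_p. *)
Section Coordinates.
Context {R : realType} {p : nat}.

Definition subvec (S : {set 'I_p}) (v : 'cV[R]_p) : 'cV[R]_#|S| :=
  \col_k v (enum_val k) 0.

Definition submat (S : {set 'I_p}) (A : 'M[R]_p) : 'M[R]_#|S| :=
  \matrix_(k, l) A (enum_val k) (enum_val l).

Definition pad (S : {set 'I_p}) (v : 'cV[R]_#|S|) : 'cV[R]_p :=
  \sum_(k < #|S|) v k 0 *: delta_mx (enum_val k) 0.

Definition supp (beta : 'cV[R]_p) : {set 'I_p} := [set j | beta j 0 != 0]%SET.

Definition sstar (K0 : nat) (beta : 'cV[R]_p) : nat :=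
  (K0 * #|supp beta| + #|supp beta|)%N.

Definition Splus (K0 : nat) (beta : 'cV[R]_p) : {set {set 'I_p}} :=
  [set S : {set 'I_p} | (supp beta \subset S) && (#|S| <= sstar K0 beta)%N]%SET.

End Coordinates.

Inductive glm (R : Type) : Type :=
  Gaussian | Logistic | Poisson | Probit | GammaLog | NegBin of R.
Arguments Gaussian {R}.
Arguments Logistic {R}.
Arguments Poisson {R}.
Arguments Probit {R}.
Arguments GammaLog {R}.

Section Models.
Context {R : realType}.

Definition Phi (x : R) : R := fine (normal_prob (0 : R) 1 `]-oo, x]).

Definition cumulant (m : glm R) (theta : R) : R :=
  match m with
  | Gaussian => theta ^+ 2 / 2
  | Logistic | Probit => ln (1 + expR theta)
  | Poisson => expR theta
  | GammaLog => - ln (- theta)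
  | NegBin kappa => - (kappa * ln (1 - expR theta))
  end.

Definition link (m : glm R) (eta : R) : R :=
  match m with
  | Gaussian | Logistic | Poisson => eta
  | Probit => ln (Phi eta / (1 - Phi eta))
  | GammaLog => - expR (- eta)
  | NegBin kappa => eta - ln (kappa + expR eta)
  end.

Definition sample_space (m : glm R) : set R :=
  match m with
  | Gaussian => setT
  | Logistic | Probit => [set y | y = 0 \/ y = 1]
  | Poisson | NegBin _ => [set y | exists j : nat, y = j%:R]
  | GammaLog => [set y | 0 < y]
  end.

(* The fixed constants are tmin, tmax (dispersion bounds) and L. *)
Definition restriction (m : glm R) (tmin tmax L : R) n
    (tau eta0 : 'I_n -> R) : Prop :=
  match m with
  | Gaussian | GammaLog => forall i, tmin <= tau i <= tmax
  | Logistic | Poisson => forall i, tau i = 1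
  | Probit => forall i, tau i = 1 /\ `|eta0 i| <= L
  | NegBin kappa => 0 < kappa /\ forall i, tau i = 1
  end.

(* Density at y when the linear predictor is eta and the dispersion is t. *)
Definition glm_density (m : glm R) (k : R -> R -> R) (t eta y : R) : R :=
  expR ((y * link m eta - cumulant m (link m eta)) / t + k y t).

(* For the dispersion t the functions above are probability densities with
   respect to nu for every linear predictor, nu being carried by the sample
   space. The laws then do not depend on the choice of nu and k: their moment
   generating functions are determined by the cumulant function. *)
Definition density_family (m : glm R) (nu : {measure set R -> \bar R})
    (k : R -> R -> R) (t : R) : Prop :=
  [/\ nu.-negligible (~` sample_space m),
      measurable_fun setT (k ^~ t) &
      forall eta, (\int[nu]_y (glm_density m k t eta y)%:E = 1)%E].

Definition fisher_weight (m : glm R) (t eta : R) : R :=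
  derive1n 2 (cumulant m) (link m eta) * (derive1 (link m) eta) ^+ 2 / t.

Section Sample.
Variables (m : glm R) (k : R -> R -> R) (n p : nat).
Variables (X : 'M[R]_(n, p)) (tau : 'I_n -> R).

Definition linpred (beta : 'cV[R]_p) (i : 'I_n) : R := (X *m beta) i 0.

Definition loglik (y : 'I_n -> R) (beta : 'cV[R]_p) : R :=
  \sum_i ((y i * link m (linpred beta i) - cumulant m (link m (linpred beta i)))
            / tau i + k (y i) (tau i)).

Definition loglikS (S : {set 'I_p}) (y : 'I_n -> R) (v : 'cV[R]_#|S|) : R :=
  loglik y (pad v).

Definition obs_info (S : {set 'I_p}) (y : 'I_n -> R) (v : 'cV[R]_#|S|)
  : 'M[R]_#|S| := - hessian (@loglikS S y) v.

Definition weight (beta : 'cV[R]_p) (i : 'I_n) : R :=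
  fisher_weight m (tau i) (linpred beta i).

Definition fisher (beta : 'cV[R]_p) : 'M[R]_p :=
  X^T *m diag_mx (\row_i weight beta i) *m X.

Definition fisherS (beta : 'cV[R]_p) (S : {set 'I_p}) : 'M[R]_#|S| :=
  submat S (fisher beta).

Definition zvec (beta : 'cV[R]_p) (S : {set 'I_p}) (i : 'I_n) : 'cV[R]_#|S| :=
  invsqrtmx (fisherS beta S) *m subvec S (row i X)^T.

(* The unique maximizer of loglikS, required to have a positive definite
   observed information; there is at most one such vector. *)
Definition regular_mle (S : {set 'I_p}) (y : 'I_n -> R) : set 'cV[R]_#|S| :=
  [set v | unique_maximizer (@loglikS S y) v /\ posdef (obs_info y v)].

(* On the exceptional event where regular_mle is empty, the maximum likelihood
   estimator is set to 0 and its observed information to the identity. *)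
Definition mle (S : {set 'I_p}) (y : 'I_n -> R) : 'cV[R]_#|S| :=
  xget 0 (@regular_mle S y).

Definition mle_info (S : {set 'I_p}) (y : 'I_n -> R) : 'M[R]_#|S| :=
  if `[< exists v, @regular_mle S y v >] then obs_info y (mle S y) else 1%:M.

End Sample.

Definition rate_condition (m : glm R) (s0 p : nat -> nat) : Prop :=
  match m with
  | Gaussian => True
  | Logistic | Poisson | Probit =>
      (fun n => (s0 n)%:R ^+ 3 / (n%:R * ln (p n)%:R)) @ \oo --> (0 : R)
  | GammaLog | NegBin _ => (fun n => (s0 n)%:R ^+ 3 / n%:R) @ \oo --> (0 : R)
  end.

End Models.

Definition mutually_independent (R : realType) (d : measure_display)
    (T : measurableType d) (P : probability T R) n
    (Y : 'I_n -> {RV P >-> R}) : Prop :=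
  forall (J : {set 'I_n}) (A : 'I_n -> set R), (forall i, measurable (A i)) ->
    P (\bigcap_(i in [set` J]) (Y i @^-1` A i)) =
      (\prod_(i in J) P (Y i @^-1` A i))%E.

Definition glm_law (R : realType) (m : glm R) (nu : {measure set R -> \bar R})
    (k : R -> R -> R) n p (X : 'M[R]_(n, p)) (tau : 'I_n -> R)
    (beta0 : 'cV[R]_p) (d : measure_display) (T : measurableType d)
    (P : probability T R) (Y : 'I_n -> {RV P >-> R}) : Prop :=
  mutually_independent Y /\
  forall i (A : set R), measurable A ->
    distribution P (Y i) A =
      (\int[nu]_(y in A) (glm_density m k (tau i) (linpred X beta0 i) y)%:E)%E.

(* E need not be measurable: it has to contain measurable events whose
   probabilities tend to one. *)
Definition with_high_probability (R : realType) (d : nat -> measure_display)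
    (T : forall n, measurableType (d n)) (P : forall n, probability (T n) R)
    (E : forall n, set (T n)) : Prop :=
  exists A : forall n, set (T n),
    (forall n, measurable (A n) /\ A n `<=` E n) /\
    (fun n => P n (A n)) @ \oo --> 1%E.

(* Main.v *)
Require Import Defs.
From HB Require Import structures.
From mathcomp Require Import all_boot all_order all_algebra.
From mathcomp Require Import all_classical all_reals all_analysis.
From mathcomp Require Import measurable_realfun ring lra.

(** The log likelihood is a sum of concave functions of the linear predictors, so
    everything reduces to facts about one observation and to the concentration
    of weighted sums over the observations.

    One observation. A step s in the direction of the score moves the canonical
    parameter within the natural domain, and the curvature of the cumulant
    function changes by at most a factor (1 - c |s|) ^ (- 3) (cum2_shift). Since
    the densities integrate to one at every natural parameter, the cumulant
    generating function of the score is an increment of the cumulant function,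
    hence at most w s ^ 2 / (2 (1 - c |s|)) (mgf_score, cgf_score_le). The
    observed information a(eta) is Lipschitz in the linear predictor relative to
    w + a, and its relative fluctuation at the truth vanishes, is bounded, or is
    a multiple of the score (model_bounds).

    Part (a). Independence adds up the cumulant generating functions. For a
    standardized direction the weighted squares of the coefficients sum to one,
    and each coefficient is O((s0 / n) ^ (1 / 2)), which is d_n; the product
    d_n (s0 log p) ^ (1 / 2) is of the order of (s0 ^ 2 log p / n) ^ (1 / 2)
    (cgf_standardized_score).

    Part (b). The difference between observed and Fisher information at the truth
    is a quadratic form, and its change over a ball is bounded by the cubic form
    of the weights w + a. At a fixed support and a fixed direction both are
    controlled by Bernstein's inequality and the moment conditions; a grid with
    (8 q + 1) ^ q points and a union bound over the (p + 1) ^ q supports make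
    this uniform, at the price of an exponent of order s0 log p
    (information_event, information_events). This gives a relative error theta
    at the truth and a Lipschitz constant mu in the norm of the Fisher
    information, hence the error 2 mu r + theta on the ball of radius r
    (opnorm_info).

    Part (c). The standardized score is of order (s0 log p) ^ (1 / 2)
    (score_event). On a ball of that radius the log likelihood is uniformly
    strongly concave, so by concavity its global maximizer lies there and is
    unique (unique_maximizer_ball); there the observed information dominates half
    the Fisher information, and its Lipschitz constant in its own norm is 8 mu
    (opnorm_info_diff).

    Rates. Let delta ^ 2 be a vanishing upper bound for (s0 ^ 2 log p / n) ^ (1 / 2),
    in a non-Gaussian model also for (s0 ^ 3 / (n log p)) ^ (1 / 2), and with
    exponential tails of the observed information also for s0 ^ 3 / n. Then the
    radius r = (s0 log p) ^ (1 / 2) / delta makes (2 mu r + theta) (s0 + log p) / log p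
    and s0 mu of order delta (local_rates, rate_sequence). *)

Set Implicit Arguments.
Unset Strict Implicit.
Unset Printing Implicit Defensive.

Import Order.TTheory GRing.Theory Num.Theory.
Import numFieldNormedType.Exports.

Local Open Scope classical_set_scope.
Local Open Scope ring_scope.

(** * Euclidean geometry of column vectors *)

Section Euclid.
Context {R : realType}.

Lemma dotvE q (u v : 'cV[R]_q) : dotv u v = \sum_i u i 0 * v i 0.
Proof. by rewrite /dotv !mxE; apply: eq_bigr => i _; rewrite !mxE. Qed.

Lemma dotvC q (u v : 'cV[R]_q) : dotv u v = dotv v u.
Proof. by rewrite !dotvE; apply: eq_bigr => i _; rewrite mulrC. Qed.

Lemma dotvDr q (u v w : 'cV[R]_q) : dotv u (v + w) = dotv u v + dotv u w.
Proof. by rewrite /dotv mulmxDr mxE. Qed.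

Lemma dotvDl q (u v w : 'cV[R]_q) : dotv (v + w) u = dotv v u + dotv w u.
Proof. by rewrite !(dotvC _ u) dotvDr. Qed.

Lemma dotvZr q a (u v : 'cV[R]_q) : dotv u (a *: v) = a * dotv u v.
Proof. by rewrite /dotv -scalemxAr mxE. Qed.

Lemma dotvZl q a (u v : 'cV[R]_q) : dotv (a *: u) v = a * dotv u v.
Proof. by rewrite dotvC dotvZr dotvC. Qed.

Lemma dotvNr q (u v : 'cV[R]_q) : dotv u (- v) = - dotv u v.
Proof. by rewrite -scaleN1r dotvZr mulN1r. Qed.

Lemma dotvNl q (u v : 'cV[R]_q) : dotv (- u) v = - dotv u v.
Proof. by rewrite dotvC dotvNr dotvC. Qed.

Lemma dotvBr q (u v w : 'cV[R]_q) : dotv u (v - w) = dotv u v - dotv u w.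
Proof. by rewrite dotvDr dotvNr. Qed.

Lemma dotv0 q (u : 'cV[R]_q) : dotv u 0 = 0.
Proof. by rewrite /dotv mulmx0 mxE. Qed.

Lemma dot0v q (u : 'cV[R]_q) : dotv 0 u = 0.
Proof. by rewrite dotvC dotv0. Qed.

Lemma dotv_mx q r (A : 'M[R]_(q, r)) u v :
  dotv u (A *m v) = dotv (A^T *m u) v.
Proof. by rewrite /dotv trmx_mul trmxK mulmxA. Qed.

Lemma dotv_sym q (A : 'M[R]_q) u v :
  A^T = A -> dotv u (A *m v) = dotv v (A *m u).
Proof. by move=> sA; rewrite dotv_mx sA dotvC. Qed.

Lemma dotvv_ge0 q (u : 'cV[R]_q) : 0 <= dotv u u.
Proof. by rewrite dotvE; apply: sumr_ge0 => i _; rewrite -expr2 sqr_ge0. Qed.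

Lemma dotvv_eq0 q (u : 'cV[R]_q) : (dotv u u == 0) = (u == 0).
Proof.
apply/eqP/eqP => [|->]; last by rewrite dotv0.
rewrite dotvE => /eqP; rewrite psumr_eq0 => [/allP u0|i _]; last first.
  by rewrite -expr2 sqr_ge0.
apply/matrixP => i j; rewrite (ord1 j) mxE; apply/eqP.
by have := u0 i (mem_index_enum i); rewrite -expr2 sqrf_eq0.
Qed.

Lemma dotvv_gt0 q (u : 'cV[R]_q) : (0 < dotv u u) = (u != 0).
Proof. by rewrite lt_def dotvv_ge0 andbT dotvv_eq0. Qed.

Lemma enorm_dotv q (u : 'cV[R]_q) : enorm u = Num.sqrt (dotv u u).
Proof. by rewrite /enorm dotvE; under eq_bigr do rewrite expr2. Qed.

Lemma enorm_ge0 q (u : 'cV[R]_q) : 0 <= enorm u.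
Proof. exact: sqrtr_ge0. Qed.

Lemma sqr_enorm q (u : 'cV[R]_q) : enorm u ^+ 2 = dotv u u.
Proof. by rewrite enorm_dotv sqr_sqrtr // dotvv_ge0. Qed.

Lemma enorm0 q : enorm (0 : 'cV[R]_q) = 0.
Proof. by rewrite enorm_dotv dotv0 sqrtr0. Qed.

Lemma enorm_gt0 q (u : 'cV[R]_q) : (0 < enorm u) = (u != 0).
Proof. by rewrite enorm_dotv sqrtr_gt0 dotvv_gt0. Qed.

Lemma enormZ q a (u : 'cV[R]_q) : enorm (a *: u) = `|a| * enorm u.
Proof.
by rewrite !enorm_dotv dotvZl dotvZr mulrA -expr2 sqrtrM ?sqr_ge0 // sqrtr_sqr.
Qed.

Lemma enormN q (u : 'cV[R]_q) : enorm (- u) = enorm u.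
Proof. by rewrite -scaleN1r enormZ normrN1 mul1r. Qed.

Lemma enorm_le q (u : 'cV[R]_q) e :
  0 <= e -> (enorm u <= e) = (dotv u u <= e ^+ 2).
Proof. by move=> e0; rewrite -sqr_enorm ler_sqr ?nnegrE ?enorm_ge0. Qed.

(** The discriminant argument behind both the Cauchy-Schwarz inequality and
    the fact that a null vector of a semidefinite form lies in its kernel. *)
Lemma linear_coef_eq0 (b c : R) :
  (forall t, 0 <= b * t + c * t ^+ 2) -> b = 0.
Proof.
move=> H; apply/eqP; apply: contraT => b0.
have b2 : 0 < b ^+ 2 by rewrite exprn_even_gt0.
pose K := `|c| + 1.
have K0 : 0 < K by rewrite /K ltr_wpDl.
have := H (- b / K).
have -> : b * (- b / K) + c * (- b / K) ^+ 2 = - b ^+ 2 / K ^+ 2 * (K - c).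
  by field; rewrite gt_eqF.
rewrite pmulr_lge0; last first.
  by rewrite subr_gt0 /K (le_lt_trans (ler_norm c)) // ltrDl.
by rewrite pmulr_lge0 ?invr_gt0 ?exprn_gt0 // oppr_ge0 leNgt b2.
Qed.

Lemma cauchy_schwarz q (u v : 'cV[R]_q) : `|dotv u v| <= enorm u * enorm v.
Proof.
have [->|v0] := eqVneq v 0; first by rewrite dotv0 normr0 enorm0 mulr0.
have vv : 0 < dotv v v by rewrite dotvv_gt0.
rewrite -ler_sqr ?nnegrE ?mulr_ge0 ?enorm_ge0 // real_normK ?num_real //.
rewrite exprMn !sqr_enorm.
have := dotvv_ge0 (dotv v v *: u - dotv u v *: v).
rewrite dotvBr !dotvZr !(dotvC (_ - _)) !dotvBr !dotvZr (dotvC v u).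
set a := dotv u v; set b := dotv v v; set c := dotv u u => h.
have : 0 <= b * (c * b - a ^+ 2) by rewrite (le_trans h) // le_eqVlt; apply/orP; left; apply/eqP; ring.
by rewrite pmulr_rge0 // subr_ge0.
Qed.

Lemma enormD q (u v : 'cV[R]_q) : enorm (u + v) <= enorm u + enorm v.
Proof.
rewrite enorm_le ?addr_ge0 ?enorm_ge0 // dotvDr !dotvDl sqrrD !sqr_enorm.
have := ler_norm (dotv u v); have := cauchy_schwarz u v.
by rewrite (dotvC v u) mulr2n; lra.
Qed.

Lemma ler_coord_enorm q (u : 'cV[R]_q) i : `|u i 0| <= enorm u.
Proof.
rewrite -ler_sqr ?nnegrE ?enorm_ge0 // sqr_enorm dotvE (bigD1 i) //=.
rewrite real_normK ?num_real // expr2 lerDl.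
by apply: sumr_ge0 => j _; rewrite -expr2 sqr_ge0.
Qed.

Lemma enorm_le_bound q (u : 'cV[R]_q) K :
  0 <= K -> (forall i, `|u i 0| <= K) -> enorm u <= Num.sqrt q%:R * K.
Proof.
move=> K0 H; rewrite enorm_le ?mulr_ge0 ?sqrtr_ge0 //.
rewrite exprMn sqr_sqrtr // dotvE.
apply: (@le_trans _ _ (\sum_(i < q) K ^+ 2)); last first.
  by rewrite sumr_const card_ord mulr_natl.
apply: ler_sum => i _; rewrite -expr2 -(real_normK (num_real _)).
by rewrite ler_sqr ?nnegrE.
Qed.

(** Polarization: a symmetric form bounded by e on the diagonal is bounded by
    e off the diagonal, hence bounds the matrix itself. *)
Lemma sym_form_bound q (A : 'M[R]_q) e : A^T = A ->
  (forall u, `|dotv u (A *m u)| <= e * dotv u u) ->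
  forall u, enorm (A *m u) <= e * enorm u.
Proof.
move=> sA H u.
have off (x y : 'cV[R]_q) : dotv x (A *m y) *+ 2 <= e * (dotv x x + dotv y y).
  have h1 := le_trans (ler_norm _) (H (x + y)).
  have h3 := H (x - y); rewrite ler_norml in h3; case/andP: h3 => h3 _.
  move: h1 h3; rewrite !mulmxDr !mulmxN !dotvDr !dotvDl !dotvNr !dotvNl.
  rewrite (dotv_sym y x sA) (dotvC y x) mulr2n; lra.
have [Au0|Au0] := eqVneq (A *m u) 0.
  rewrite Au0 enorm0; have [->|u0] := eqVneq u 0; first by rewrite enorm0 mulr0.
  have uu : 0 < dotv u u by rewrite dotvv_gt0.
  have := le_trans (normr_ge0 _) (H u).
  by rewrite pmulr_lge0 // => e0; rewrite mulr_ge0 ?enorm_ge0.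
have u0 : u != 0 by apply: contraNneq Au0 => ->; rewrite mulmx0.
have Au : 0 < enorm (A *m u) by rewrite enorm_gt0.
have uu : 0 < enorm u by rewrite enorm_gt0.
(* both vectors are normalized before polarizing *)
have := off ((enorm (A *m u))^-1 *: (A *m u)) ((enorm u)^-1 *: u).
rewrite -scalemxAr !dotvZl !dotvZr -!sqr_enorm.
set a := enorm (A *m u) in Au *; set b := enorm u in uu *.
have -> : a^-1 * (b^-1 * a ^+ 2) = a / b by field; rewrite !gt_eqF.
have -> : a^-1 * (a^-1 * a ^+ 2) = 1 by field; rewrite !gt_eqF.
have -> : b^-1 * (b^-1 * b ^+ 2) = 1 by field; rewrite !gt_eqF.
move=> h; have : a / b <= e by move: h; rewrite mulr2n; lra.
by rewrite ler_pdivrMr.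
Qed.

Lemma opnorm_le q (A : 'M[R]_q) e :
  (forall u, enorm u <= 1 -> enorm (A *m u) <= e) -> opnorm A <= e.
Proof.
move=> H; apply: ge_sup => [|_ [u /= u1 <-]]; last exact: H.
by exists (enorm (A *m 0)); exists 0 => //=; rewrite enorm0.
Qed.

Lemma opnorm_sym_le q (A : 'M[R]_q) e : A^T = A -> 0 <= e ->
  (forall u, `|dotv u (A *m u)| <= e * dotv u u) -> opnorm A <= e.
Proof.
move=> sA e0 H; apply: opnorm_le => u u1.
by rewrite (le_trans (sym_form_bound sA H u)) // ler_piMr.
Qed.

End Euclid.

(** * Spectral theory of real symmetric matrices *)

Section Spectral.
Context {R : realType}.

Lemma continuous_sumr (T : topologicalType) n (f : 'I_n -> T -> R) :
  (forall i, continuous (f i)) -> continuous (fun v => \sum_i f i v).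
Proof.
move=> fc v; elim: (index_enum _) => [|i s IH].
  rewrite (_ : (fun _ => _) = cst 0); first exact: cvg_cst.
  by apply/funext => w; rewrite big_nil.
rewrite (_ : (fun _ => _) = fun w => f i w + \sum_(j <- s) f j w).
  by apply: cvgD => //; exact: fc.
by apply/funext => w; rewrite big_cons.
Qed.

Lemma continuous_dotv q (x : 'cV[R]_q) : continuous (dotv x).
Proof.
rewrite (_ : dotv x = fun v => \sum_i x i 0 * v i 0); last first.
  by apply/funext => w; rewrite dotvE.
apply: continuous_sumr => i v; apply: continuousM; first exact: cst_continuous.
exact: coord_continuous.
Qed.

Lemma continuous_trmx m n : continuous (fun A : 'M[R]_(m, n) => A^T).
Proof.
move=> A U [P HP PU]; exists (fun i j => P j i) => [i j|B HB].
  by have := HP j i; rewrite mxE.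
by apply: PU => i j; rewrite mxE; exact: HB.
Qed.

(** The transpose identifies columns with row vectors, where a closed bounded
    set is compact; the Euclidean norm dominates the coordinates. *)
Lemma compact_enorm_ball q (r : R) : compact [set v : 'cV[R]_q | enorm v <= r].
Proof.
have [r0|r0] := leP 0 r; last first.
  rewrite (_ : [set _ | _] = set0); first exact: compact0.
  rewrite -subset0 => v /= h.
  by have := lt_le_trans r0 (enorm_ge0 v); rewrite ltNge h.
rewrite (_ : [set _ | _] =
    (fun v : 'rV[R]_q => v^T) @` [set v : 'rV_q | enorm v^T <= r]); last first.
  apply/seteqP; split => [v /= vr|_ /= [v vr <-] //].
  by exists v^T; rewrite ?trmxK.
apply: continuous_compact.
  by apply: continuous_subspaceT => v; exact: continuous_trmx.
apply: bounded_closed_compact.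
  exists r; split; first exact: num_real.
  move=> x rx v /= vr; rewrite /Num.norm /= mx_normrE.
  apply/bigmax_leP; split => [|[i j] _ /=].
    exact: le_trans (ltW rx).
  rewrite (ord1 i); have := ler_coord_enorm v^T j; rewrite mxE => h.
  exact: le_trans h (le_trans vr (ltW rx)).
rewrite (_ : [set _ | _] = (fun v : 'rV[R]_q => dotv v^T v^T) @^-1`
    [set x | x <= r ^+ 2]); last first.
  by apply/seteqP; split => v /=; rewrite enorm_le.
apply: closed_comp; last exact: closed_le.
move=> v _; move: v.
rewrite (_ : (fun _ => _) = fun v : 'rV[R]_q => \sum_i v 0 i * v 0 i).
  by apply: continuous_sumr => i w; apply: continuousM; exact: coord_continuous.
by apply/funext => w; rewrite dotvE; apply: eq_bigr => i _; rewrite !mxE.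
Qed.

Lemma continuous_dotv2 q (A : 'M[R]_q) :
  continuous (fun v : 'cV[R]_q => dotv v (A *m v)).
Proof.
rewrite (_ : (fun _ => _) =
    fun v : 'cV[R]_q => \sum_i v i 0 * \sum_j A i j * v j 0); last first.
  by apply/funext => w; rewrite dotvE; apply: eq_bigr => i _; rewrite mxE.
apply: continuous_sumr => i v; apply: continuousM; first exact: coord_continuous.
apply: (@continuous_sumr _ _ (fun j (v : 'cV[R]_q) => A i j * v j 0)) => j w.
apply: continuousM; first exact: cst_continuous.
exact: coord_continuous.
Qed.

(** A minimizer of the Rayleigh quotient over the unit sphere is an eigenvector:
    the form shifted by the minimum is semidefinite and vanishes there. *)
Lemma rayleigh_min q (A : 'M[R]_q) : (0 < q)%N -> A^T = A ->
  exists a (v : 'cV[R]_q), [/\ enorm v = 1, A *m v = a *: v &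
    forall u, a * dotv u u <= dotv u (A *m u)].
Proof.
move=> q0 sA; pose f (v : 'cV[R]_q) := dotv v (A *m v).
pose D := [set v : 'cV[R]_q | enorm v <= 1] `&` [set v | dotv v v >= 1].
have DE v : D v -> enorm v = 1.
  move=> [/= v1 v2]; apply/eqP; rewrite eq_le v1 /=.
  by rewrite -ler_sqr ?nnegrE ?enorm_ge0 // expr1n sqr_enorm.
have ED (v : 'cV[R]_q) : v != 0 -> D ((enorm v)^-1 *: v).
  move=> v0; have v1 : 0 < enorm v by rewrite enorm_gt0.
  have e1 : enorm ((enorm v)^-1 *: v) = 1.
    by rewrite enormZ ger0_norm ?invr_ge0 ?ltW // mulVf // gt_eqF.
  by split; rewrite /= -?sqr_enorm e1 ?expr1n.
have [|||v vD vmin] := @compact_EVT_min _ R f D.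
- exists ((enorm (const_mx 1 : 'cV[R]_q))^-1 *: const_mx 1); apply: ED.
  apply/eqP => /matrixP /(_ (Ordinal q0) 0); rewrite !mxE => /eqP.
  by rewrite oner_eq0.
- apply: compact_closedI; first exact: compact_enorm_ball.
  rewrite (_ : [set _ | _] = (fun v : 'cV[R]_q => dotv v (1%:M *m v)) @^-1`
    [set x | 1 <= x]); last first.
    by apply/seteqP; split => w /=; rewrite mul1mx.
  by apply: closed_comp; [move=> w _; exact: continuous_dotv2|exact: closed_ge].
- by apply: continuous_subspaceT => w; exact: continuous_dotv2.
have v1 : enorm v = 1 by apply: DE; rewrite inE in vD.
exists (f v), v.
have Hmin u : f v * dotv u u <= dotv u (A *m u).
  have [->|u0] := eqVneq u 0; first by rewrite mulmx0 !dotv0 mulr0.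
  have uu : 0 < enorm u by rewrite enorm_gt0.
  have := vmin _ (mem_set (ED u u0)); rewrite /f -scalemxAr dotvZl dotvZr mulrA.
  by rewrite -expr2 mulrC exprVn ler_pdivlMr ?exprn_gt0 // sqr_enorm.
split => //; apply/eqP; rewrite -subr_eq0 -dotvv_eq0; apply/eqP.
set x := A *m v - f v *: v.
have xE : A *m v = x + f v *: v by rewrite /x subrK.
clearbody x.
have vv : dotv v v = 1 by rewrite -sqr_enorm v1 expr1n.
apply: (@mulfI _ 2%:R); first by rewrite pnatr_eq0.
rewrite mulr0; apply: (@linear_coef_eq0 R _ (dotv x (A *m x) - f v * dotv x x)).
move=> t; have := Hmin (v + t *: x).
rewrite mulmxDr -scalemxAr !dotvDr !dotvDl !dotvZr !dotvZl vv.
rewrite (dotv_sym v x sA) (dotvC v x) -/(f v).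
have -> : dotv x (A *m v) = dotv x x + f v * dotv x v.
  by rewrite xE dotvDr dotvZr.
by lra.
Qed.

Lemma eigenvalue_ge q (A : 'M[R]_q) a e : A^T = A ->
  (forall u, a * dotv u u <= dotv u (A *m u)) -> eigenvalue A e -> a <= e.
Proof.
move=> sA H /eigenvalueP[x xA x0].
have : A *m x^T = e *: x^T by rewrite -{1}sA -trmx_mul xA linearZ.
move=> Ax; have := H x^T; rewrite Ax dotvZr ler_pM2r // dotvv_gt0.
by rewrite -(inj_eq trmx_inj) trmxK trmx0.
Qed.

Lemma eigenvalue_sym q (A : 'M[R]_q) a (v : 'cV[R]_q) : A^T = A ->
  enorm v = 1 -> A *m v = a *: v -> eigenvalue A a.
Proof.
move=> sA v1 Av; apply/eigenvalueP; exists v^T.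
  by rewrite -{1}sA -trmx_mul Av linearZ.
rewrite -(inj_eq trmx_inj) trmxK trmx0; apply: contra_eq_neq v1 => ->.
by rewrite enorm0 eq_sym oner_eq0.
Qed.

Lemma rho_min_le q (A : 'M[R]_q) u : (0 < q)%N -> A^T = A ->
  rho_min A * dotv u u <= dotv u (A *m u).
Proof.
move=> q0 sA; have [a [v [v1 Av H]]] := rayleigh_min q0 sA.
apply: le_trans (H u); rewrite ler_wpM2r ?dotvv_ge0 //.
apply: ge_inf; last exact: eigenvalue_sym v1 Av.
by exists a => e /= /(eigenvalue_ge sA); apply.
Qed.

Lemma rho_max_ge q (A : 'M[R]_q) u : (0 < q)%N -> A^T = A ->
  dotv u (A *m u) <= rho_max A * dotv u u.
Proof.
move=> q0 sA; have sNA : (- A)^T = - A by rewrite linearN /= sA.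
have [a [v [v1 Av H]]] := rayleigh_min q0 sNA.
have Av' : A *m v = - a *: v by rewrite scaleNr -Av mulNmx opprK.
have H' w : dotv w (A *m w) <= - a * dotv w w.
  by have := H w; rewrite mulNmx dotvNr; lra.
apply: (le_trans (H' u)); rewrite ler_wpM2r ?dotvv_ge0 //.
apply: ub_le_sup; last exact: eigenvalue_sym v1 Av'.
exists (- a) => e /= /eigenvalueP[x xA x0].
have eN : eigenvalue (- A) (- e).
  by apply/eigenvalueP; exists x; rewrite // mulmxN xA scaleNr.
by have := eigenvalue_ge sNA H eN; rewrite lerNr.
Qed.

(** The reflection in the hyperplane orthogonal to v - e_1, or the identity when
    v = e_1. *)
Lemma householder q (v : 'cV[R]_(1 + q)) : enorm v = 1 ->
  exists H : 'M[R]_(1 + q),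
    [/\ H^T = H, H *m H = 1%:M & H *m delta_mx 0 0 = v].
Proof.
move=> v1; pose e : 'cV[R]_(1 + q) := delta_mx 0 0.
have [ve|ve] := eqVneq v e.
  by exists 1%:M; rewrite trmx1 !mul1mx ve.
pose w := v - e; pose N := dotv w w.
have N0 : N != 0 by rewrite /N dotvv_eq0 subr_eq0.
pose H : 'M[R]_(1 + q) := 1%:M - (2 / N) *: (w *m w^T).
have HE (x : 'cV[R]_(1 + q)) : H *m x = x - (2 / N * dotv w x) *: w.
  rewrite /H mulmxBl mul1mx -scalemxAl -mulmxA -scalerA; congr (_ - _ *: _).
  by rewrite [w^T *m x]mx11_scalar mul_mx_scalar.
have sH : H^T = H by rewrite /H linearB /= trmx1 linearZ /= trmx_mul trmxK.
have vv : dotv v v = 1 by rewrite -sqr_enorm v1 expr1n.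
have ee : dotv e e = 1.
  rewrite dotvE (bigD1 0) //= !mxE !eqxx mulr1 big1 ?addr0 // => i i0.
  by rewrite !mxE (negPf i0) mul0r.
have NE : N = 2 - 2 * dotv v e.
  rewrite /N /w dotvBr 2!(dotvC (v - e)) !dotvBr vv ee (dotvC e v); ring.
exists H; split => //; last first.
  rewrite HE (_ : 2 / N * dotv w e = -1); first by rewrite scaleN1r opprK addrC subrK.
  have we : dotv w e = - N / 2.
    by rewrite NE (dotvC w e) /w dotvBr ee (dotvC e v); field.
  by rewrite we; field.
apply/matrixP => a b.
have hh (x : 'cV[R]_(1 + q)) : H *m (H *m x) = x.
  rewrite !HE dotvBr dotvZr -/N -addrA -opprD -scalerDl.
  have -> : 2 / N * dotv w x + 2 / N * (dotv w x - 2 / N * dotv w x * N) = 0.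
    by field.
  by rewrite scale0r subr0.
have := hh (delta_mx b 0); rewrite mulmxA -colE => /matrixP/(_ a 0).
by rewrite !mxE eqxx andbT.
Qed.

(** Square roots of semidefinite matrices, by splitting off one eigenvector at a
    time with a Householder reflection. *)
Lemma psd_sqrt q (A : 'M[R]_q) : psd A -> exists B, psd B /\ B *m B = A.
Proof.
elim: q A => [A _|q IH A [sA pA]].
  exists A; split; last by apply/matrixP => -[].
  by split; [apply/matrixP => -[]|move=> v; rewrite dotvE big_ord0].
have [a [v [v1 Av _]]] := rayleigh_min (ltn0Sn q) sA.
have a0 : 0 <= a.
  by have := pA v; rewrite Av dotvZr -sqr_enorm v1 expr1n mulr1.
have [H [sH HH He]] := @householder q v v1.
pose M : 'M[R]_(1 + q) := H *m A *m H.
have AM : A = H *m M *m H.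
  by rewrite /M !mulmxA HH mul1mx -!mulmxA HH mulmx1.
have sM : M^T = M by rewrite /M !trmx_mul sA sH mulmxA.
have Me : M *m delta_mx 0 0 = a *: (delta_mx 0 0 : 'cV_(1 + q)).
  by rewrite /M -!mulmxA He Av -scalemxAr -He mulmxA HH mul1mx.
clearbody M.
have M0 i : M i 0 = a * (i == 0)%:R.
  have /matrixP/(_ i 0) := Me; rewrite -colE !mxE => ->.
  by rewrite eqxx andbT.
pose M' : 'M[R]_q := drsubmx (M : 'M[R]_(1 + q)).
have l0 : lshift q (0 : 'I_1) = 0 by apply/val_inj.
have ME : M = block_mx a%:M 0 0 M'.
  rewrite -[LHS]submxK /M'; congr block_mx.
  - by apply/matrixP => i j; rewrite !mxE (ord1 i) (ord1 j) l0 M0 eqxx mulr1.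
  - apply/matrixP => i j; rewrite !mxE (ord1 i) l0 -sM mxE M0.
    by rewrite (_ : (rshift 1 _ == 0) = false) // mulr0.
  - apply/matrixP => i j; rewrite !mxE (ord1 j) l0 M0.
    by rewrite (_ : (rshift 1 _ == 0) = false) // mulr0.
have qblk (b : R) (C : 'M[R]_q) (x : 'cV[R]_(1 + q)) :
    dotv x (block_mx b%:M 0 0 C *m x) =
    b * (usubmx x 0 0) ^+ 2 + dotv (dsubmx x) (C *m dsubmx x).
  rewrite -{1 2}[x]vsubmxK mul_block_col !mul0mx addr0 add0r mul_scalar_mx.
  rewrite /dotv tr_col_mx mul_row_col mxE; congr (_ + _).
  by rewrite -scalemxAr mxE mxE big_ord1 mxE expr2.
have pM' : psd M'.
  split.
    have := sM; rewrite ME tr_block_mx => /eq_block_mx[_ _ _].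
    by [].
  move=> y; pose x := col_mx (0 : 'cV[R]_1) y.
  have := pA (H *m x); rewrite AM -!mulmxA (mulmxA H H) HH mul1mx.
  rewrite dotv_mx sH mulmxA HH mul1mx ME qblk.
  by rewrite /x col_mxKu col_mxKd mxE expr0n mulr0 add0r.
have [B' [[sB' pB'] BB']] := IH _ pM'.
pose N : 'M[R]_(1 + q) := block_mx (Num.sqrt a)%:M 0 0 B'.
exists (H *m N *m H); split; last first.
  rewrite AM -!mulmxA (mulmxA H H) HH mul1mx; congr (_ *m _).
  rewrite !mulmxA; congr (_ *m _).
  rewrite /N mulmx_block ME !mulmx0 !mul0mx !addr0 !add0r -scalar_mxM.
  by rewrite -expr2 sqr_sqrtr // BB'.
split.
  rewrite !trmx_mul sH mulmxA; congr (_ *m _ *m _).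
  by rewrite /N tr_block_mx sB' !trmx0 tr_scalar_mx.
move=> x; rewrite -!mulmxA dotv_mx sH qblk addr_ge0 //.
by rewrite mulr_ge0 ?sqrtr_ge0 ?sqr_ge0.
Qed.

Lemma sqrtmxP q (A : 'M[R]_q) : psd A ->
  psd (sqrtmx A) /\ sqrtmx A *m sqrtmx A = A.
Proof. by move=> /psd_sqrt; exact: xgetPex. Qed.

Lemma posdef_psd q (A : 'M[R]_q) : posdef A -> psd A.
Proof.
move=> [sA pA]; split => // v; have [->|/pA/ltW//] := eqVneq v 0.
by rewrite dot0v.
Qed.

Lemma enorm_sqrtmx q (A : 'M[R]_q) u : psd A ->
  enorm (sqrtmx A *m u) ^+ 2 = dotv u (A *m u).
Proof.
move=> /sqrtmxP[[sB _] BB]; rewrite sqr_enorm dotv_mx sB mulmxA BB.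
by rewrite dotvC.
Qed.

Lemma posdef_unitmx q (A : 'M[R]_q) : posdef A -> A \in unitmx.
Proof.
move=> [sA pA]; rewrite -row_free_unit -kermx_eq0; apply/rowV0P => x.
move/sub_kermxP => xA; apply/eqP; apply: contraT => x0.
have xt0 : x^T != 0 by rewrite -(inj_eq trmx_inj) trmxK trmx0.
have := pA _ xt0; rewrite (_ : A *m x^T = 0) ?dotv0 ?ltxx //.
by rewrite -sA -trmx_mul xA trmx0.
Qed.

Lemma invsqrtmxP q (A : 'M[R]_q) : posdef A ->
  [/\ (invsqrtmx A)^T = invsqrtmx A,
      invsqrtmx A *m sqrtmx A = 1%:M,
      sqrtmx A *m invsqrtmx A = 1%:M &
      forall u, dotv (invsqrtmx A *m u) (A *m (invsqrtmx A *m u)) = dotv u u].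
Proof.
move=> pA; have [[sB _] BB] := sqrtmxP (posdef_psd pA).
have uB : sqrtmx A \in unitmx.
  have := posdef_unitmx pA; rewrite -{1}BB unitmx_mul.
  by case/andP.
rewrite /invsqrtmx; split; rewrite ?mulVmx ?mulmxV //.
  by rewrite trmx_inv sB.
move=> u; rewrite -{2}BB -mulmxA mulKVmx // dotv_mx sB mulKVmx //.
Qed.

(** Conjugation by the inverse square root turns the order between quadratic
    forms into an operator norm bound. *)
Lemma opnorm_conj_le q (A D : 'M[R]_q) e : posdef A -> D^T = D -> 0 <= e ->
  (forall u, `|dotv u (D *m u)| <= e * dotv u (A *m u)) ->
  opnorm (invsqrtmx A *m D *m invsqrtmx A) <= e.
Proof.
move=> pA sD e0 H; have [sB _ _ BA] := invsqrtmxP pA.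
apply: opnorm_sym_le => // [|u].
  by rewrite !trmx_mul sB sD mulmxA.
by rewrite -!mulmxA dotv_mx sB -BA; exact: H.
Qed.

End Spectral.

(** * Sums of scalar functions of linear forms *)

Section ScalarCalculus.
Context {R : realType}.

Lemma is_derive_affine (k : R -> R) (x v s d : R) :
  is_derive (x + s * v) 1 k d ->
  is_derive s 1 (fun s => k (x + s * v)) (d * v).
Proof.
move=> kd.
have -> : (fun s => k (x + s * v)) = k \o (fun s => x + s * v) by [].
have hv : is_derive s 1 (fun s : R => x + s * v) v.
  by apply: is_derive_eq; rewrite /GRing.scale /=; ring.
by have := @is_derive1_comp R k (fun s => x + s * v) s d v kd hv; rewrite mulrC.
Qed.

Lemma is_derive_inv (x : R) : x != 0 ->
  is_derive x 1 (GRing.inv : R -> R) (- x ^- 2).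
Proof.
move=> x0; have h := is_deriveV x0 (is_derive_id x 1).
by apply: is_derive_eq; rewrite /GRing.scale /= mulr1.
Qed.

Lemma MVT01 (k k1 : R -> R) (x v c : R) : 0 < c ->
  (forall s : R, 0 <= s <= c -> is_derive (x + s * v) 1 k (k1 (x + s * v))) ->
  exists2 s : R, 0 < s < c & k (x + c * v) - k x = k1 (x + s * v) * v * c.
Proof.
move=> c0 H.
have := @MVT R (fun s => k (x + s * v)) (fun s => k1 (x + s * v) * v) 0 c c0.
case=> [s|/=|s sI].
- rewrite in_itv /= => /andP[s0 s1]; apply: is_derive_affine.
  by apply: H; rewrite !ltW.
- apply: derivable_within_continuous => s; rewrite in_itv /= => sI.
  by apply: ex_derive; apply: is_derive_affine; exact: H.
by rewrite mul0r addr0 subr0 => E; exists s.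
Qed.

(** Applying the mean value theorem twice along the segment from x to x + v. *)
Lemma second_order_ge0 (k k1 k2 : R -> R) (x v : R) :
  (forall s : R, 0 <= s <= 1 ->
     [/\ is_derive (x + s * v) 1 k (k1 (x + s * v)),
         is_derive (x + s * v) 1 k1 (k2 (x + s * v)) &
         0 <= k2 (x + s * v)]) ->
  k x = 0 -> k1 x = 0 -> 0 <= k (x + v).
Proof.
move=> H kx k1x.
have [s|c /andP[c0 c1]] := @MVT01 k k1 x v 1 ltr01; first by case/H.
rewrite kx subr0 mul1r mulr1 => ->.
have [s /andP[s0 sc]|s /andP[s0 sc]] := @MVT01 k1 k2 x v c c0.
  by have [] := H s; rewrite ?s0 ?(le_trans sc (ltW c1)).
rewrite k1x subr0 => ->.
have [|_ _ k20] := H s; first by rewrite !ltW // (lt_trans sc).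
have -> : k2 (x + s * v) * v * c * v = k2 (x + s * v) * c * v ^+ 2 by ring.
by apply: mulr_ge0; [apply: mulr_ge0 => //; exact: ltW|exact: sqr_ge0].
Qed.

Lemma taylor_upper (g g1 a : R -> R) (m x v : R) :
  (forall t : R, is_derive t 1 g (g1 t)) ->
  (forall t : R, is_derive t 1 g1 (- a t)) ->
  (forall s : R, 0 <= s <= 1 -> m <= a (x + s * v)) ->
  g (x + v) <= g x + g1 x * v - m / 2 * v ^+ 2.
Proof.
move=> gd g1d am.
pose k t := g x + g1 x * (t - x) - m / 2 * (t - x) ^+ 2 - g t.
pose k1 t := g1 x - m * (t - x) - g1 t.
have k0 : 0 <= k (x + v).
  apply: (@second_order_ge0 k k1 (fun t => a t - m)) => [s sI||].
  - split; last by rewrite subr_ge0 am.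
      rewrite /k /k1; apply: is_derive_eq.
      by rewrite /GRing.scale /=; field.
    rewrite /k1; apply: is_derive_eq.
    by rewrite /GRing.scale /=; ring.
  - by rewrite /k; ring.
  - by rewrite /k1; ring.
rewrite -subr_ge0; apply: (le_trans k0); rewrite /k le_eqVlt.
by apply/orP; left; apply/eqP; ring.
Qed.

Lemma concave_scalar (g g1 a : R -> R) (x y t : R) :
  (forall t : R, is_derive t 1 g (g1 t)) ->
  (forall t : R, is_derive t 1 g1 (- a t)) ->
  (forall t, 0 <= a t) -> 0 <= t <= 1 ->
  t * g x + (1 - t) * g y <= g (t * x + (1 - t) * y).
Proof.
move=> gd g1d a0 /andP[t0 t1]; pose z := t * x + (1 - t) * y; rewrite -/z.
have h u : g u <= g z + g1 z * (u - z).
  have := @taylor_upper g g1 a 0 z (u - z) gd g1d (fun s _ => a0 _).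
  by rewrite mul0r mul0r subr0 (addrC z) subrK.
have h1 := ler_wpM2l t0 (h x).
have t1' : 0 <= 1 - t by rewrite subr_ge0.
have h2 := ler_wpM2l t1' (h y).
apply: (le_trans (lerD h1 h2)); rewrite le_eqVlt; apply/orP; left; apply/eqP.
by rewrite /z; ring.
Qed.

End ScalarCalculus.

Section LineDerivative.
Context {R : realType}.

(** The difference quotients of v |-> g (x . v) in the direction w are those of
    g along an affine line. *)
Lemma is_derive_dotv q (x v w : 'cV[R]_q) (g : R -> R) (d : R) :
  is_derive (dotv x v) 1 g d ->
  is_derive v w (fun v => g (dotv x v)) (d * dotv x w).
Proof.
move=> gd.
have gd' : is_derive (dotv x v + 0 * dotv x w) 1 g d by rewrite mul0r addr0.
have [dl dE] := is_derive_affine gd'.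
have E : (fun h : R => h^-1 *: (((fun v => g (dotv x v)) \o shift v) (h *: w)
            - g (dotv x v))) =
         (fun h : R => h^-1 *: (((fun s => g (dotv x v + s * dotv x w)) \o
            shift 0) (h *: 1) - g (dotv x v + 0 * dotv x w))).
  apply/funext => h /=; rewrite dotvDr dotvZr /GRing.scale /=.
  by congr (_ * (g _ - g _)); ring.
split; first by rewrite /derivable E.
by rewrite -dE /derive E.
Qed.

Lemma is_derive_sum_dotv n q (x : 'I_n -> 'cV[R]_q) (v w : 'cV[R]_q)
    (g : 'I_n -> R -> R) (d : 'I_n -> R) :
  (forall i, is_derive (dotv (x i) v) 1 (g i) (d i)) ->
  is_derive v w (fun v => \sum_i g i (dotv (x i) v))
    (\sum_i d i * dotv (x i) w).
Proof.
move=> gd.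
have -> : (fun v => \sum_i g i (dotv (x i) v)) =
    \sum_i (fun v => g i (dotv (x i) v)).
  by apply/funext => u; rewrite fct_sumE.
by apply: is_derive_sum => i; exact: is_derive_dotv.
Qed.

End LineDerivative.

Section Gram.
Context {R : realType} (n q : nat) (x : 'I_n -> 'cV[R]_q).

(** The matrix X^T diag(c) X, the x i being the rows of X. *)
Definition gram (c : 'I_n -> R) : 'M[R]_q :=
  \matrix_(k, l) \sum_i c i * x i k 0 * x i l 0.

Lemma gram_form c u v :
  dotv u (gram c *m v) = \sum_i c i * dotv (x i) u * dotv (x i) v.
Proof.
rewrite dotvE.
under eq_bigr => k _ do rewrite !mxE big_distrr /=.
under [RHS]eq_bigr => i _ do
  rewrite [dotv (x i) u]dotvE big_distrr big_distrl /=.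
rewrite [RHS]exchange_big /=; apply: eq_bigr => k _.
under eq_bigr => l _ do rewrite !mxE big_distrl big_distrr /=.
rewrite exchange_big /=; apply: eq_bigr => i _.
rewrite [in RHS]dotvE big_distrr /=; apply: eq_bigr => l _; ring.
Qed.

Lemma gram_sym c : (gram c)^T = gram c.
Proof.
by apply/matrixP => k l; rewrite !mxE; apply: eq_bigr => i _; rewrite mulrAC.
Qed.

Lemma gramB c c' : gram c - gram c' = gram (fun i => c i - c' i).
Proof.
apply/matrixP => k l; rewrite !mxE -sumrB; apply: eq_bigr => i _.
by rewrite !mulrBl.
Qed.

Lemma gram_quad c u : dotv u (gram c *m u) = \sum_i c i * dotv (x i) u ^+ 2.
Proof.
by rewrite gram_form; apply: eq_bigr => i _; rewrite -mulrA expr2.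
Qed.

Lemma dotv_delta (u : 'cV[R]_q) j : dotv u (delta_mx j 0) = u j 0.
Proof.
rewrite dotvE (bigD1 j) //= mxE !eqxx mulr1 big1 ?addr0 // => i ij.
by rewrite mxE (negPf ij) mulr0.
Qed.

Variables (g g1 a : 'I_n -> R -> R).
Hypothesis gd : forall i (t : R), is_derive t 1 (g i) (g1 i t).
Hypothesis g1d : forall i (t : R), is_derive t 1 (g1 i) (- a i t).

Let f (v : 'cV[R]_q) := \sum_i g i (dotv (x i) v).

Lemma gradient_sum v :
  gradient f v = \col_j \sum_i g1 i (dotv (x i) v) * x i j 0.
Proof.
apply/matrixP => j l; rewrite !mxE.
have [_ ->] := @is_derive_sum_dotv _ _ _ x v (delta_mx j 0) g
  (fun i => g1 i (dotv (x i) v)) (fun i => gd i _).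
by apply: eq_bigr => i _; rewrite dotv_delta.
Qed.

Lemma hessian_sum v : hessian f v = - gram (fun i => a i (dotv (x i) v)).
Proof.
apply/matrixP => k l; rewrite !mxE.
have -> : 'D_(delta_mx l 0) f =
    fun v => \sum_i (fun t => g1 i t * x i l 0) (dotv (x i) v).
  apply/funext => u.
  have [_ ->] := @is_derive_sum_dotv _ _ _ x u (delta_mx l 0) g
    (fun i => g1 i (dotv (x i) u)) (fun i => gd i _).
  by apply: eq_bigr => i _; rewrite dotv_delta.
have [|_ ->] := @is_derive_sum_dotv _ _ _ x v (delta_mx k 0)
    (fun i t => g1 i t * x i l 0) (fun i => - a i (dotv (x i) v) * x i l 0).
  move=> i; apply: is_derive_eq.
  by rewrite /GRing.scale /=; ring.
rewrite -sumrN; apply: eq_bigr => i _; rewrite dotv_delta; ring.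
Qed.

Lemma concave_sum : (forall i t, 0 <= a i t) -> concave f.
Proof.
move=> a0 u v t tI; rewrite /f !big_distrr -big_split /=; apply: ler_sum => i _.
by rewrite dotvDr !dotvZr; apply: concave_scalar (gd i) (g1d i) (a0 i) tI.
Qed.

Lemma continuous_sum_dotv : continuous f.
Proof.
apply: continuous_sumr => i v; apply: continuous_comp.
  exact: continuous_dotv.
by apply/differentiable_continuous/derivable1_diffP; apply: ex_derive.
Qed.

End Gram.

Section Maximizer.
Context {R : realType} (n q : nat) (z : 'I_n -> 'cV[R]_q).
Variables (g g1 a : 'I_n -> R -> R) (e m : 'I_n -> R) (rho delta : R).
Hypothesis gd : forall i (t : R), is_derive t 1 (g i) (g1 i t).
Hypothesis g1d : forall i (t : R), is_derive t 1 (g1 i) (- a i t).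
Hypothesis a0 : forall i t, 0 <= a i t.
Hypothesis rho0 : 0 < rho.
Hypothesis zsmall :
  forall h, enorm h <= rho -> forall i, `|dotv (z i) h| <= delta.
Hypothesis am : forall i t, `|t - e i| <= delta -> m i <= a i t.
Hypothesis mF : forall u, dotv u u / 2 <= \sum_i m i * dotv (z i) u ^+ 2.
Hypothesis score :
  forall u, \sum_i g1 i (e i) * dotv (z i) u <= rho / 5 * enorm u.

Let f (h : 'cV[R]_q) := \sum_i g i (e i + dotv (z i) h).

Let gs i t := g i (e i + t).
Let g1s i t := g1 i (e i + t).
Let as_ i t := a i (e i + t).

Let gsd i (t : R) : is_derive t 1 (gs i) (g1s i t).
Proof.
have h : is_derive (e i + t * 1) 1 (g i) (g1 i (e i + t * 1)) by exact: gd.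
have := is_derive_affine h; rewrite !mulr1 /gs.
by under eq_fun do rewrite mulr1.
Qed.

Let g1sd i (t : R) : is_derive t 1 (g1s i) (- as_ i t).
Proof.
have h : is_derive (e i + t * 1) 1 (g1 i) (- a i (e i + t * 1)) by exact: g1d.
have := is_derive_affine h; rewrite !mulr1 /g1s.
by under eq_fun do rewrite mulr1.
Qed.

Let ball_convex (x y : 'cV[R]_q) s : enorm x <= rho -> enorm y <= rho ->
  0 <= s <= 1 -> enorm (x + s *: (y - x)) <= rho.
Proof.
move=> xr yr /andP[s0 s1].
rewrite (_ : x + _ = (1 - s) *: x + s *: y); last first.
  by rewrite scalerBr scalerBl scale1r addrA addrAC.
apply: (le_trans (enormD _ _)); rewrite !enormZ !ger0_norm ?subr_ge0 //.
apply: (@le_trans _ _ ((1 - s) * rho + s * rho)); last first.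
  by rewrite -mulrDl subrK mul1r.
by rewrite lerD // ler_wpM2l // subr_ge0.
Qed.

Let taylor_ball x y : enorm x <= rho -> enorm y <= rho ->
  f y <= f x + \sum_i g1s i (dotv (z i) x) * dotv (z i) (y - x)
         - dotv (y - x) (y - x) / 4.
Proof.
move=> xr yr.
apply: (@le_trans _ _ (\sum_i (gs i (dotv (z i) x) +
    g1s i (dotv (z i) x) * dotv (z i) (y - x) -
    m i / 2 * dotv (z i) (y - x) ^+ 2))).
  apply: ler_sum => i _.
  rewrite -/(gs i _) {1}(_ : y = x + (y - x)); last by rewrite addrC subrK.
  rewrite dotvDr; apply: taylor_upper (gsd i) (g1sd i) _ => s sI.
  apply: am; rewrite addrAC subrr add0r -dotvZr -dotvDr.
  exact: zsmall (ball_convex xr yr sI) i.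
rewrite sumrB big_split /=; apply: lerB => //.
have -> : \sum_i m i / 2 * dotv (z i) (y - x) ^+ 2 =
    (\sum_i m i * dotv (z i) (y - x) ^+ 2) / 2.
  by rewrite mulr_suml; apply: eq_bigr => i _; ring.
by have := mF (y - x); lra.
Qed.

(** Concavity, a curvature bound on the ball of radius rho and a score that is
    small compared with rho place the unique global maximizer inside the ball:
    at the boundary the quadratic loss exceeds the linear gain, and strict
    concavity inside the ball rules out a second maximizer anywhere. *)
Lemma unique_maximizer_ball : exists2 h, enorm h < rho & unique_maximizer f h.
Proof.
have fc : continuous f.
  exact: (@continuous_sum_dotv _ _ _ z gs g1s gsd).
have fconc : concave f.
  exact: (@concave_sum _ _ _ z gs g1s as_ gsd g1sd (fun i t => a0 i _)).
have r0 := ltW rho0.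
have [||v vD vmax] :=
    @compact_EVT_max _ R f [set h | enorm h <= rho] _ (@compact_enorm_ball R q rho).
- by exists 0; rewrite /= enorm0.
- exact: continuous_subspaceT.
have vr : enorm v <= rho by rewrite inE in vD.
have {}vmax h : enorm h <= rho -> f h <= f v by move=> hr; apply: vmax; rewrite inE.
have vlt : enorm v < rho.
  rewrite lt_neqAle vr andbT; apply/eqP => vE.
  have zr : enorm (0 : 'cV[R]_q) <= rho by rewrite enorm0.
  have := taylor_ball zr vr; have := vmax 0 zr; rewrite subr0 -sqr_enorm vE.
  have := score v; rewrite vE.
  have -> : \sum_i g1s i (dotv (z i) 0) * dotv (z i) v =
            \sum_i g1 i (e i) * dotv (z i) v.
    by apply: eq_bigr => i _; rewrite /g1s dotv0 addr0.
  have : 0 < rho ^+ 2 by rewrite exprn_gt0.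
  have -> : rho / 5 * rho = rho ^+ 2 / 5 by ring.
  lra.
exists v => //.
move=> x xv; rewrite ltNge; apply/negP => fvx.
(* a point of the segment from v to x that is still in the ball *)
pose D := enorm (x - v).
have D0 : 0 < D by rewrite enorm_gt0 subr_eq0.
pose t := Num.min 1 ((rho - enorm v) / D).
have t0 : 0 < t by rewrite /t lt_min ltr01 divr_gt0 ?subr_gt0.
have t1 : t <= 1 by rewrite /t ge_min lexx.
pose y := t *: x + (1 - t) *: v.
have yE : y = v + t *: (x - v).
  by rewrite /y scalerBl scale1r scalerBr addrC -addrA (addrC (- _)).
have yr : enorm y <= rho.
  rewrite yE; apply: (le_trans (enormD _ _)); rewrite enormZ (ger0_norm (ltW t0)).
  have : t * D <= rho - enorm v.
    by rewrite -ler_pdivlMr // /t ge_min lexx orbT.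
  by rewrite -/D -lerBrDl.
have fy : f v <= f y.
  have tI : 0 <= t <= 1 by rewrite ltW.
  apply: (le_trans _ (fconc x v t tI)).
  by have := ler_wpM2l (ltW t0) fvx; lra.
pose w := v + 2^-1 *: (y - v).
have hI : 0 <= (2^-1 : R) <= 1 by rewrite invr_ge0 ler0n invf_le1 ?ler1n ?ltr0n.
have wr : enorm w <= rho by exact: ball_convex.
have h1 := taylor_ball wr yr; have h2 := taylor_ball wr vr.
have yw : y - w = 2^-1 *: (y - v).
  rewrite /w opprD addrA -{1}(scale1r (y - v)) -scalerBl; congr (_ *: _); lra.
have vw : v - w = - (2^-1 *: (y - v)) by rewrite /w opprD addrA subrr add0r.
have S : \sum_i g1s i (dotv (z i) w) * dotv (z i) (v - w) =
   - \sum_i g1s i (dotv (z i) w) * dotv (z i) (y - w).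
  by rewrite -sumrN; apply: eq_bigr => i _; rewrite vw yw dotvNr mulrN.
have yv : 0 < dotv (y - v) (y - v).
  rewrite dotvv_gt0 yE addrAC subrr add0r scaler_eq0 negb_or gt_eqF //=.
  by rewrite subr_eq0.
have fw := vmax _ wr.
move: h1 h2; rewrite S yw vw dotvNl !dotvNr opprK !dotvZl !dotvZr; lra.
Qed.

End Maximizer.

(** * Change of measure and independent sums *)

Section ChangeOfMeasure.
Context {R : realType} d (T : measurableType d).
Import HBNNSimple.

(** Stated with both a density H and a map phi, so that it serves twice: with
    phi the identity it turns the law of a response into its density, and with
    H the product of the other factors it replaces one coordinate of an
    independent family by its law. Monotone approximation by simple functions reduces it to
    indicators. *)
Lemma ge0_integral_density_image (mu : {measure set T -> \bar R})
    (rho : {measure set R -> \bar R}) (phi : T -> R) (H : T -> R) (g : R -> R) :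
  measurable_fun setT phi -> measurable_fun setT H -> (forall x, 0 <= H x) ->
  measurable_fun setT g -> (forall y, 0 <= g y) ->
  (forall A, measurable A ->
     rho A = \int[mu]_x (\1_A (phi x) * H x)%:E)%E ->
  (\int[rho]_y (g y)%:E = \int[mu]_x (g (phi x) * H x)%:E)%E.
Proof.
move=> mphi mH H0 mg g0 rhoE.
have mEg : measurable_fun setT (EFin \o g) by exact/measurable_EFinP.
pose h := nnsfun_approx measurableT mEg.
have hphi n : measurable_fun setT (h n \o phi) by exact: measurableT_comp.
have hcvg (y : R) : (h n y)%:E @[n --> \oo] --> (g y)%:E.
  by apply: (cvg_nnsfun_approx measurableT mEg) => // z _; rewrite lee_fin.
have -> : (\int[rho]_y (g y)%:E =
    lim (\int[rho]_y (h n y)%:E @[n --> \oo]))%E.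
  under eq_integral => y _ do rewrite -(cvg_lim (@ereal_hausdorff R) (hcvg y)).
  apply: monotone_convergence => //.
  - by move=> n; apply/measurable_EFinP; exact: measurable_funP.
  - by move=> n x _ /=; rewrite lee_fin.
  - move=> x _ a b ab /=; rewrite lee_fin; exact/lefP/nd_nnsfun_approx.
have -> : (\int[mu]_x (g (phi x) * H x)%:E =
    lim (\int[mu]_x ((h n (phi x)) * H x)%:E @[n --> \oo]))%E.
  have cv x : ((h n (phi x)) * H x)%:E @[n --> \oo] --> (g (phi x) * H x)%:E.
    under eq_fun do rewrite EFinM.
    rewrite EFinM; apply: cvgeZr => //; exact: hcvg.
  under eq_integral => x _ do rewrite -(cvg_lim (@ereal_hausdorff R) (cv x)).
  apply: monotone_convergence => //.
  - by move=> n; apply/measurable_EFinP; apply: measurable_funM => //; exact: hphi.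
  - by move=> n x _ /=; rewrite lee_fin mulr_ge0.
  - move=> x _ a b ab /=; rewrite lee_fin ler_wpM2r //.
    exact/lefP/nd_nnsfun_approx.
suff E n : (\int[rho]_y (h n y)%:E = \int[mu]_x ((h n (phi x)) * H x)%:E)%E.
  by under eq_fun do rewrite E.
have fE y : h n y = \sum_(r \in range (h n)) (r * \1_(h n @^-1` [set r]) y).
  exact: fimfunE.
have ind r : measurable (h n @^-1` [set r]) by exact: measurable_sfunP.
transitivity (\sum_(r \in range (h n)) (r%:E * rho (h n @^-1` [set r])))%E.
  under eq_integral => y _ do rewrite /= fE -fsumEFin //.
  rewrite ge0_integral_fsum //; last 2 first.
  - by move=> r; apply/measurable_EFinP/measurable_funM.
  - by move=> r y _; exact: nnfun_muleindic_ge0.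
  apply: eq_fsbigr => r _.
  under eq_integral => y _ do rewrite EFinM.
  by rewrite integralZl_indic_nnsfun // integral_indic // setIT.
under [RHS]eq_integral => x _.
  rewrite fE EFinM -fsumEFin // ge0_mule_fsuml; last first.
    by move=> r; exact: nnfun_muleindic_ge0.
  over.
rewrite ge0_integral_fsum //; last 2 first.
- move=> r; apply: emeasurable_funM; apply/measurable_EFinP => //.
  by apply: measurable_funM => //; apply: measurableT_comp.
- move=> r x _; rewrite mule_ge0 ?lee_fin //.
  by rewrite -lee_fin EFinM; exact: nnfun_muleindic_ge0.
apply: eq_fsbigr => r; rewrite inE => -[y _ <-]; rewrite rhoE //.
rewrite -ge0_integralZl_EFin //.
- by apply: eq_integral => x _; rewrite !EFinM muleA.
- by move=> x _; rewrite lee_fin mulr_ge0.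
- apply/measurable_EFinP/measurable_funM => //; exact: measurableT_comp.
Qed.

End ChangeOfMeasure.

Section Independence.
Context {R : realType} d (T : measurableType d) (P : probability T R) (n : nat).
Variable Y : 'I_n -> {RV P >-> R}.
Hypothesis indY : mutually_independent Y.

(** The product rule extends from events to nonnegative functions one
    coordinate at a time: both sides of the rule are measures in the event of
    the coordinate being replaced. *)
Lemma integral_prod_independent (h : 'I_n -> R -> R) (M : 'I_n -> R) :
  (forall i, measurable_fun setT (h i)) -> (forall i y, 0 <= h i y) ->
  (forall i, \int[P]_w (h i (Y i w))%:E = (M i)%:E)%E ->
  (\int[P]_w (\prod_i h i (Y i w))%:E = (\prod_i M i)%:E)%E.
Proof.
move=> mh h0 hM.
(* the first k factors are arbitrary functions, the others indicators of events *)
pose fac (k : nat) (A : 'I_n -> set R) (i : 'I_n) : R -> R :=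
  if (i < k)%N then h i else \1_(A i).
pose Mfac (k : nat) (A : 'I_n -> set R) (i : 'I_n) : R :=
  if (i < k)%N then M i else fine (P (Y i @^-1` A i)).
have M0 i : 0 <= M i.
  by rewrite -lee_fin -hM; apply: integral_ge0 => w _; rewrite lee_fin.
have fac0 k A i y : 0 <= fac k A i y by rewrite /fac; case: ifP.
have Mfac0 k A i : 0 <= Mfac k A i.
  by rewrite /Mfac; case: ifP => // _; exact: fine_ge0.
have mfac k A i : measurable (A i) -> measurable_fun setT (fac k A i).
  by move=> mA; rewrite /fac; case: ifP.
have mprod k A (J : pred 'I_n) : (forall i, measurable (A i)) ->
    measurable_fun setT (fun w => \prod_(i | J i) fac k A i (Y i w)).
  move=> mA; under eq_fun do rewrite big_mkcond /=.
  apply: measurable_prod => i _; case: (J i); last exact: measurable_cst.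
  by apply: measurableT_comp => //; exact: mfac.
suff claim k : (k <= n)%N -> forall A, (forall i, measurable (A i)) ->
    (\int[P]_w (\prod_i fac k A i (Y i w))%:E = (\prod_i Mfac k A i)%:E)%E.
  have := claim n (leqnn n) (fun=> setT) (fun=> measurableT).
  by under eq_integral => w _ do
    under eq_bigr => i _ do rewrite /fac ltn_ord;
    rewrite /Mfac; under eq_bigr => i _ do rewrite ltn_ord.
elim: k => [_ A mA|k IH kn A mA].
  have -> : (\prod_i Mfac 0 A i)%:E = P (\bigcap_(i in [set` [set: 'I_n]%SET]) (Y i @^-1` A i)).
    rewrite indY // -prodEFin.
    under [RHS]eq_bigl do rewrite inE.
    apply: eq_bigr => i _; rewrite /Mfac /= fineK //.
    by apply: fin_num_measure; rewrite -[_ @^-1` _]setTI; exact: measurable_funP.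
  rewrite -[in RHS](setIT (\bigcap_(_ in _) _)) -integral_indic //; last first.
    apply: fin_bigcap_measurable => // i _.
    by rewrite -[_ @^-1` _]setTI; exact: measurable_funP.
  apply: eq_integral => w _; congr EFin; rewrite /fac /=.
  rewrite indicE; case: (boolP (w \in _)) => [|/negP] wA.
    rewrite inE in wA; apply: big1 => i _.
    by rewrite indicE mem_set //; apply: wA => /=; rewrite inE.
  have [i wi] : exists i, ~ A i (Y i w).
    apply/existsNP => H; apply: wA; rewrite inE => i _; exact: H.
  by rewrite (bigD1 i) //= indicE memNset // mul0r.
have kk : (k < n)%N by [].
pose i0 : 'I_n := Ordinal kk.
pose H w := \prod_(i | i != i0) fac k A i (Y i w).
pose c := \prod_(i | i != i0) Mfac k A i.
have c0 : 0 <= c by apply: prodr_ge0.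
have faceq B i : i != i0 -> fac k (fun j => if j == i0 then B else A j) i = fac k A i.
  by move=> ii; rewrite /fac (negPf ii).
have facS i : i != i0 -> fac k.+1 A i = fac k A i.
  by move=> ii; rewrite /fac ltnS leq_eqVlt (_ : (i == k :> nat) = false) //; exact: negbTE.
have MfacS i : i != i0 -> Mfac k.+1 A i = Mfac k A i.
  by move=> ii; rewrite /Mfac ltnS leq_eqVlt (_ : (i == k :> nat) = false) //; exact: negbTE.
transitivity (\int[P]_w (h i0 (Y i0 w) * H w)%:E)%E.
  apply: eq_integral => w _; rewrite (bigD1 i0) //= {1}/fac /= ltnSn.
  by congr (_ * _)%:E; apply: eq_bigr => i ii; rewrite facS.
rewrite -(@ge0_integral_density_image R _ T P
  (mscale (NngNum c0) (distribution P (Y i0))) (Y i0) H (h i0)) //; last 3 first.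
- exact: mprod.
- by move=> w; apply: prodr_ge0.
- move=> B mB; pose A' i := if i == i0 then B else A i.
  have mA' i : measurable (A' i) by rewrite /A'; case: ifP.
  have := IH (ltnW kn) A' mA'.
  rewrite [X in X%:E](bigD1 i0) //= /Mfac /= ltnn /A' eqxx => E.
  rewrite /mscale /= EFinM in E *.
  rewrite [LHS](_ : _ = (fine (P (Y i0 @^-1` B)))%:E * c%:E)%E; last first.
    rewrite muleC fineK //; apply: fin_num_measure.
    by rewrite -[_ @^-1` _]setTI; exact: measurable_funP.
  rewrite (_ : c%:E = (\prod_(i | i != i0) (if (i < k)%N then M i
      else fine (P (Y i @^-1` (if i == i0 then B else A i)))))%:E); last first.
    by congr EFin; apply: eq_bigr => i ii; rewrite (negPf ii).
  rewrite -E; apply: eq_integral => w _; congr EFin.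
  rewrite (bigD1 i0) //= {1}/fac /= ltnn eqxx; congr (_ * _).
  by apply: eq_bigr => i ii; rewrite faceq.
have mEh : measurable_fun setT (EFin \o h i0) by exact/measurable_EFinP.
rewrite ge0_integral_mscale //; last by move=> y _; rewrite lee_fin.
rewrite ge0_integral_distribution //; last by move=> y; rewrite lee_fin.
rewrite /= hM [in RHS](bigD1 i0) //= {1}/Mfac /= ltnSn.
rewrite [in RHS]mulrC EFinM; congr (_ * _)%E; congr EFin.
by apply: eq_bigr => i ii; rewrite MfacS.
Qed.

(** Independence makes the exponential moment of the sum a product; Markov's
    inequality turns it into a tail bound. *)
Lemma chernoff_independent (h : 'I_n -> R -> R) (B : 'I_n -> R) (t b : R) :
  (forall i, measurable_fun setT (h i)) ->
  (forall i, exists2 M, (\int[P]_w (expR (h i (Y i w)))%:E = M%:E)%E &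
     M <= expR (B i)) ->
  \sum_i B i - t <= b ->
  (P [set w | (t < \sum_i h i (Y i w))%R] <= (expR b)%:E)%E.
Proof.
move=> mh hB tb.
have {}hB i : {M | (\int[P]_w (expR (h i (Y i w)))%:E = M%:E)%E /\
    M <= expR (B i)}.
  by apply: cid; have [M ? ?] := hB i; exists M.
pose M i := projT1 (hB i).
have mexp i : measurable_fun setT (expR \o h i) by apply: measurableT_comp.
have := @integral_prod_independent (fun i => expR \o h i) M mexp
  (fun i y => expR_ge0 _) (fun i => (projT2 (hB i)).1).
under eq_integral => w _ do rewrite /= -expR_sum.
move=> E.
have mS : measurable_fun setT (fun w => \sum_i h i (Y i w)).
  by apply: measurable_sum => i; apply: measurableT_comp.
have mA : measurable [set w | (t < \sum_i h i (Y i w))%R].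
  rewrite (_ : [set _ | _] = setT `&` (fun w => \sum_i h i (Y i w)) @^-1` `]t, +oo[); last first.
    by apply/seteqP; split => w /=; rewrite in_itv /= andbT // => -[].
  exact: mS.
have e0 : (0 < expR t)%R by exact: expR_gt0.
have PA : ((expR t)%:E * P [set w | (t < \sum_i h i (Y i w))%R] <=
    \int[P]_w (expR (\sum_i h i (Y i w))%R)%:E)%E.
  rewrite -[X in P X](setIT _) -integral_indic // -ge0_integralZl_EFin //; last first.
    by apply/measurable_EFinP; exact: measurable_indic.
  apply: ge0_le_integral => //.
  - apply/measurable_EFinP/measurable_funM => //; exact: measurable_indic.
  - by apply/measurable_EFinP; apply: measurableT_comp.
  - move=> w _; rewrite -EFinM lee_fin indicE.
    case: (boolP (w \in _)) => [|_]; last by rewrite mulr0 expR_ge0.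
    by rewrite inE mulr1 ler_expR => /ltW.
rewrite E in PA.
have MB : \prod_i M i <= expR (\sum_i B i).
  rewrite expR_sum; apply: ler_prod => i _; rewrite (projT2 (hB i)).2 andbT.
  by rewrite -lee_fin -(projT2 (hB i)).1; apply: integral_ge0 => w _; rewrite lee_fin expR_ge0.
rewrite -(@lee_pmul2l _ (expR t)%:E) ?lte_fin //.
apply: (le_trans PA); rewrite -EFinM lee_fin -expRD; apply: (le_trans MB).
by rewrite ler_expR; lra.
Qed.

End Independence.

(** * The normal distribution function *)

Section NormalDistribution.
Context {R : realType}.

Definition npdf (x : R) : R := normal_pdf 0 1 x.

Lemma npdfE x : npdf x = normal_peak 1 * expR (- x ^+ 2 / 2).
Proof.
rewrite /npdf normal_pdfE ?oner_eq0 // /normal_fun subr0 expr1n.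
by [].
Qed.

Lemma npdf_gt0 x : 0 < npdf x.
Proof. by rewrite npdfE mulr_gt0 ?expR_gt0 // normal_peak_gt0 // oner_eq0. Qed.

Lemma npdf_sym x : npdf (- x) = npdf x.
Proof. by rewrite !npdfE sqrrN. Qed.

Lemma npdf_le0 x : npdf x <= npdf 0.
Proof.
rewrite !npdfE ler_pM2l ?normal_peak_gt0 ?oner_eq0 // ler_expR.
by rewrite expr0n oppr0 mul0r mulNr oppr_le0 divr_ge0 // sqr_ge0.
Qed.

Global Instance is_derive_npdf (x : R) : is_derive x 1 npdf (- x * npdf x).
Proof.
have -> : npdf = fun x => normal_peak 1 * expR (- x ^+ 2 / 2).
  by apply/funext => y; rewrite npdfE.
by apply: is_derive_eq; rewrite /GRing.scale /=; field.
Qed.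

Global Instance is_derive_Phi (x : R) : is_derive x 1 Phi (npdf x).
Proof.
have x1 : x < x + 1 by rewrite ltrDl.
have [||dF FE] := continuous_FTC1 x1 _ _
    (@continuous_normal_pdf R 0 1 (oner_neq0 _) x) (a := -oo%O).
- apply: (integrableS _ _ (subsetT _)) => //; exact: integrable_normal_pdf.
- exact: ltNyr.
by split; [exact: dF|rewrite -derive1E; exact: FE].
Qed.

Let idR : measurableTypeR R -> R := idfun.

#[local] HB.instance Definition _ :=
  @isMeasurableFun.Build _ _ _ _ idR (@measurable_id _ _ setT).

Let X : {RV (normal_prob (0 : R) 1) >-> R} := idR.

Lemma PhiE (x : R) : (Phi x)%:E = cdf X x.
Proof. by rewrite /Phi fineK // fin_num_measure. Qed.

Lemma Phi_ge0 (x : R) : 0 <= Phi x.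
Proof. by rewrite -lee_fin PhiE cdf_ge0. Qed.

Lemma Phi_le1 (x : R) : Phi x <= 1.
Proof. by rewrite -lee_fin PhiE cdf_le1. Qed.

Lemma Phi_lt (x y : R) : x < y -> Phi x < Phi y.
Proof.
move=> xy; have d0 : 0 < y - x by rewrite subr_gt0.
have [s _] := @MVT01 R Phi npdf x 1 (y - x) d0.
rewrite !mulr1 (addrC x) subrK => E.
by rewrite -subr_gt0 E mulr_gt0 ?npdf_gt0.
Qed.

Lemma Phi_gt0 (x : R) : 0 < Phi x.
Proof. by apply: le_lt_trans (Phi_ge0 (x - 1)) _; apply: Phi_lt; rewrite ltrBlDr ltrDl. Qed.

Lemma Phi_lt1 (x : R) : Phi x < 1.
Proof. by apply: lt_le_trans _ (Phi_le1 (x + 1)); apply: Phi_lt; rewrite ltrDl. Qed.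

Lemma Phi_le (x y : R) : x <= y -> Phi x <= Phi y.
Proof. by rewrite le_eqVlt => /predU1P[->//|/Phi_lt/ltW]. Qed.

Lemma Phi_small (e x : R) : 0 < e -> exists2 y, y < x & Phi y < e.
Proof.
move=> e0.
have F0 : Phi y @[y --> -oo] --> (0 : R) by exact: fine_cvg (cvg_cdfNy0 X).
near (ninfty_nbhs R) => y; exists y.
  by near: y; exact: nbhs_ninfty_lt (num_real _).
by near: y; exact: (cvgr_lt _ F0 _ e0).
Unshelve. all: by end_near. Qed.

Lemma Phi_large (e x : R) : 0 < e -> exists2 y, x < y & 1 - e < Phi y.
Proof.
move=> e0.
have F1 : Phi y @[y --> +oo] --> (1 : R) by exact: fine_cvg (cvg_cdfy1 X).
near (pinfty_nbhs R) => y; exists y.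
  by near: y; exact: nbhs_pinfty_gt (num_real _).
by near: y; apply: (cvgr_gt _ F1); rewrite ltrBlDr ltrDl.
Unshelve. all: by end_near. Qed.

Lemma PhiN (x : R) : Phi (- x) = 1 - Phi x.
Proof.
pose D (x : R) := Phi x + Phi (- x).
have Dd (y : R) : is_derive y 1 D 0.
  rewrite /D; apply: is_derive_eq.
  by rewrite /GRing.scale /= npdf_sym; ring.
have Dc y z : D y = D z by exact: is_derive_0_is_cst Dd.
suff : D x = 1 by rewrite /D => <-; ring.
apply/eqP; rewrite eq_le; apply/andP; split; apply/ler_addgt0Pr => e e0.
  have [y y0 ye] := Phi_small 0 e0; rewrite (Dc x y) /D.
  by rewrite addrC lerD ?Phi_le1 // ltW.
have [y y0 ye] := Phi_large 0 e0; rewrite (Dc x y) /D.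
by have := Phi_ge0 (- y); lra.
Qed.

(** Mills ratio bound. The function Phi + npdf / id is decreasing on the
    negative half-line and tends to 0 at minus infinity. *)
Lemma mills (x : R) : 0 <= npdf x + x * Phi x.
Proof.
have [x0|x0] := leP 0 x.
  by rewrite addr_ge0 ?mulr_ge0 ?Phi_ge0 // ltW // npdf_gt0.
pose k y := Phi y + npdf y / y.
have kd (y : R) : y < 0 -> is_derive y 1 k (- npdf y / y ^+ 2).
  move=> y0; have y00 : y != 0 by rewrite lt_eqF.
  have h := is_derive_inv y00.
  by rewrite /k; apply: is_derive_eq; rewrite /GRing.scale /=; field.
suff : k x <= 0.
  rewrite /k => h; have := ler_wnM2l (ltW x0) h.
  rewrite mulr0 mulrDr mulrCA divff ?lt_eqF // mulr1; lra.
rewrite leNgt; apply/negP => kx.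
have [y yx Fy] := Phi_small x kx.
have d0 : 0 < x - y by rewrite subr_gt0.
have [s /andP[s0 s1]|s /andP[s0 s1]] :=
    @MVT01 R k (fun y => - npdf y / y ^+ 2) y 1 (x - y) d0.
  by apply: kd; rewrite mulr1; lra.
rewrite !mulr1 (addrC y) subrK => E.
have : k x <= k y.
  rewrite -subr_le0 E mulr_le0_ge0 ?(ltW d0) // mulNr oppr_le0 divr_ge0 ?sqr_ge0 //.
  exact/ltW/npdf_gt0.
have : npdf y / y < 0 by rewrite pmulr_rlt0 ?npdf_gt0 // invr_lt0 (lt_trans yx).
have h3 : k y = Phi y + npdf y / y by [].
by clearbody k; move: Fy; rewrite h3; lra.
Qed.

Lemma Phi_surj (v : R) : 0 < v < 1 -> exists x, Phi x = v.
Proof.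
move=> /andP[v0 v1].
have [a a0 av] := Phi_small 0 v0.
have v1' : 0 < 1 - v by rewrite subr_gt0.
have [b b0 bv] := Phi_large 0 v1'.
have ab : a <= b by rewrite ltW // (lt_trans a0).
have bv' : v < Phi b by move: bv; lra.
have [||c _ cv] := @IVT R Phi a b v ab.
- apply: derivable_within_continuous => y _.
  by apply: ex_derive; exact: is_derive_Phi.
- by rewrite ge_min (ltW av) /= le_max (ltW bv') orbT.
by exists c.
Qed.

End NormalDistribution.

(** * Derivatives of the six log likelihoods *)

Section SelfConcordance.
Context {R : realType}.

Lemma lipschitz_le (f f1 : R -> R) (K x y : R) :
  (forall s : R, 0 <= s <= 1 ->
     is_derive (x + s * (y - x)) 1 f (f1 (x + s * (y - x))) /\
     `|f1 (x + s * (y - x))| <= K) ->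
  `|f y - f x| <= K * `|y - x|.
Proof.
move=> H.
have [s sI|s /andP[s0 s1]] := @MVT01 R f f1 x (y - x) 1 ltr01.
  by have [] := H s sI.
rewrite mul1r mulr1 (addrC x) subrK => ->; rewrite normrM ler_wpM2r //.
by have [|_ ->] := H s; rewrite ?(ltW s0) ?(ltW s1).
Qed.

Lemma nondecreasing_of_derive (f f1 : R -> R) (x y : R) :
  (forall t : R, is_derive t 1 f (f1 t)) -> (forall t, 0 <= f1 t) ->
  x <= y -> f x <= f y.
Proof.
move=> fd f0; rewrite le_eqVlt => /predU1P[->//|xy].
have d0 : 0 < y - x by rewrite subr_gt0.
have [s _] := @MVT01 R f f1 x 1 (y - x) d0 (fun s _ => fd _).
rewrite mulr1 (addrC x) subrK => E.
by rewrite -subr_ge0 E mulr_ge0 ?(ltW d0) // mulr1.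
Qed.

(** Gronwall: h times exp of plus or minus the argument is monotone. *)
Lemma self_concordant_le (h h1 : R -> R) (x y : R) :
  (forall t : R, is_derive t 1 h (h1 t)) -> (forall t, `|h1 t| <= h t) ->
  h y <= expR `|y - x| * h x.
Proof.
move=> hd hh.
have [xy|yx] := leP x y.
  rewrite ger0_norm ?subr_ge0 //.
  have : - (expR (- x) * h x) <= - (expR (- y) * h y).
    apply: (@nondecreasing_of_derive (fun t => - (expR (- t) * h t))
      (fun t => expR (- t) * (h t - h1 t))) => // t.
      by have h' := hd t; apply: is_derive_eq; rewrite /GRing.scale /=; ring.
    by rewrite mulr_ge0 ?expR_ge0 // subr_ge0 (le_trans (ler_norm _)).
  rewrite lerN2 => H; have := ler_wpM2l (expR_ge0 y) H.
  by rewrite !mulrA -!expRD subrr expR0 mul1r.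
rewrite ltr0_norm ?subr_lt0 // opprB.
have : expR y * h y <= expR x * h x.
  apply: (@nondecreasing_of_derive (fun t => expR t * h t)
    (fun t => expR t * (h t + h1 t))) => //; last exact: ltW.
    by move=> t; have h' := hd t; apply: is_derive_eq; rewrite /GRing.scale /=; ring.
  move=> t; rewrite mulr_ge0 ?expR_ge0 //.
  by have := hh t; rewrite ler_norml => /andP[]; lra.
move=> H; have := ler_wpM2l (expR_ge0 (- y)) H.
by rewrite !mulrA -!expRD addNr expR0 mul1r (addrC (- y)).
Qed.

Lemma self_concordant_lipschitz (h h1 : R -> R) (e x y : R) :
  (forall t : R, is_derive t 1 h (h1 t)) -> (forall t, `|h1 t| <= h t) ->
  `|x - e| <= 1 -> `|y - e| <= 1 ->
  `|h y - h x| <= expR 1 * h e * `|y - x|.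
Proof.
move=> hd hh xe ye; apply: (@lipschitz_le h h1) => s /andP[s0 s1]; split=> //.
apply: (le_trans (hh _)); apply: (le_trans (self_concordant_le e _ hd hh)).
have he : 0 <= h e by apply: le_trans (normr_ge0 _) (hh e).
rewrite ler_wpM2r // ler_expR.
rewrite (_ : x + s * (y - x) - e = (1 - s) * (x - e) + s * (y - e)); last by ring.
have s1' : 0 <= 1 - s by rewrite subr_ge0.
apply: (le_trans (ler_normD _ _)); rewrite !normrM (ger0_norm s1') (ger0_norm s0).
have := ler_wpM2l s1' xe; have := ler_wpM2l s0 ye; lra.
Qed.

Lemma expR_le_inv (u : R) : 0 <= u < 1 -> expR u <= (1 - u)^-1.
Proof.
move=> /andP[u0 u1]; have h : 0 < 1 - u by rewrite subr_gt0.
rewrite -[expR u]invrK lef_pV2 ?posrE ?invr_gt0 ?expR_gt0 // -expRN.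
exact: expR_ge1Dx.
Qed.

Lemma expR_le_inv3 (u : R) : 0 <= u < 1 -> expR u <= ((1 - u) ^+ 3)^-1.
Proof.
move=> /[dup] uI /andP[u0 u1]; apply: (le_trans (expR_le_inv uI)).
have h : 0 < 1 - u by rewrite subr_gt0.
rewrite lef_pV2 ?posrE ?exprn_gt0 //.
by rewrite exprS ler_piMr ?(ltW h) // exprn_ile1 ?(ltW h) // gerBl.
Qed.

Lemma inv_cube_ge (u a : R) : 0 <= u < 1 -> 1 - u <= a -> 0 < a ->
  (a ^+ 2)^-1 <= ((1 - u) ^+ 3)^-1.
Proof.
move=> /andP[u0 u1] ua a0; have h : 0 < 1 - u by rewrite subr_gt0.
rewrite lef_pV2 ?posrE ?exprn_gt0 //.
apply: (@le_trans _ _ ((1 - u) ^+ 2)).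
  by rewrite exprSr ler_piMr ?sqr_ge0 // gerBl.
by rewrite ler_sqr ?nnegrE ?(ltW h) ?(ltW a0).
Qed.

End SelfConcordance.

Section ModelCalculus.
Context {R : realType}.

Definition expit (x : R) : R := expR x / (1 + expR x).

Lemma expR1D_gt0 (x : R) : 0 < 1 + expR x.
Proof. by rewrite ltr_wpDr ?expR_ge0. Qed.

Lemma expit_gt0 (x : R) : 0 < expit x.
Proof. by rewrite divr_gt0 ?expR_gt0 ?expR1D_gt0. Qed.

Lemma expit_lt1 (x : R) : expit x < 1.
Proof. by rewrite ltr_pdivrMr ?expR1D_gt0 // mul1r ltrDr. Qed.

Lemma is_derive_expit (x : R) : is_derive x 1 expit (expit x * (1 - expit x)).
Proof.
have n0 : 1 + expR x != 0 by rewrite gt_eqF // expR1D_gt0.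
have h := is_derive_inv n0.
by rewrite /expit; apply: is_derive_eq; rewrite /GRing.scale /=; field.
Qed.

Lemma is_derive_expit_var (x : R) : is_derive x 1
  (fun x => expit x * (1 - expit x))
  (expit x * (1 - expit x) * (1 - 2 * expit x)).
Proof.
have h := is_derive_expit x.
by apply: is_derive_eq; rewrite /GRing.scale /=; ring.
Qed.

Lemma expit_var_gt0 (x : R) : 0 < expit x * (1 - expit x).
Proof. by rewrite mulr_gt0 ?expit_gt0 // subr_gt0 expit_lt1. Qed.

Lemma expit_var_self_concordant (x : R) :
  `|expit x * (1 - expit x) * (1 - 2 * expit x)| <= expit x * (1 - expit x).
Proof.
have h0 := expit_gt0 x; have h1 := expit_lt1 x.
have h2 := ltW (expit_var_gt0 x).
rewrite normrM (ger0_norm h2) ler_piMr // ler_norml; apply/andP; split; lra.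
Qed.

(** Inverse Mills ratio, the derivative of log Phi. *)
Definition imills (x : R) : R := npdf x / Phi x.

Lemma imills_gt0 (x : R) : 0 < imills x.
Proof. by rewrite divr_gt0 ?npdf_gt0 ?Phi_gt0. Qed.

Lemma is_derive_imills (x : R) :
  is_derive x 1 imills (- (imills x * (imills x + x))).
Proof.
have n0 : Phi x != 0 by rewrite gt_eqF // Phi_gt0.
have h := is_derive_inv n0.
by rewrite /imills; apply: is_derive_eq; rewrite /GRing.scale /=; field.
Qed.

(** Mills inequality; it makes the probit log likelihood concave. *)
Lemma imillsD_ge0 (x : R) : 0 <= imills x + x.
Proof.
have := mills x; have P0 := Phi_gt0 x; have Pn : Phi x != 0 by rewrite gt_eqF.
rewrite (_ : npdf x + x * Phi x = (imills x + x) * Phi x).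
  by rewrite pmulr_lge0.
by rewrite /imills; field.
Qed.

(** Minus the second derivative of log Phi. *)
Definition probit_curv (x : R) : R := imills x * (imills x + x).

Lemma probit_curv_ge0 (x : R) : 0 <= probit_curv x.
Proof. by rewrite mulr_ge0 ?imillsD_ge0 // ltW // imills_gt0. Qed.

Definition probit_curv1 (x : R) : R :=
  imills x - probit_curv x * (2 * imills x + x).

Lemma is_derive_probit_curv (x : R) :
  is_derive x 1 probit_curv (probit_curv1 x).
Proof.
have h := is_derive_imills x.
rewrite /probit_curv /probit_curv1; apply: is_derive_eq.
by rewrite /GRing.scale /= /probit_curv; ring.
Qed.

Lemma imills_le (L x : R) : `|x| <= L -> imills x <= npdf 0 / Phi (- L).
Proof.
rewrite ler_norml => /andP[x1 _].
apply: ler_pM; rewrite ?npdf_le0 ?invr_ge0 ?(ltW (npdf_gt0 _)) ?Phi_ge0 //.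
by rewrite lef_pV2 ?posrE ?Phi_gt0 // Phi_le.
Qed.

Lemma probit_curv1_bounded (L : R) : 0 <= L ->
  exists2 K, 0 <= K & forall x, `|x| <= L -> `|probit_curv1 x| <= K.
Proof.
move=> L0; pose l := npdf 0 / Phi (- L).
have l0 : 0 <= l by rewrite divr_ge0 ?Phi_ge0 ?(ltW (npdf_gt0 _)).
have lL : 0 <= l + L by exact: addr_ge0.
have l2 : 0 <= 2 * l + L by rewrite addr_ge0 // mulr_ge0.
exists (l + l * (l + L) * (2 * l + L)).
  by apply: addr_ge0 => //; apply: mulr_ge0 => //; exact: mulr_ge0.
move=> x xL; have il := imills_le xL; have i0 := ltW (imills_gt0 x).
have xL' : x <= L by apply: le_trans (ler_norm x) xL.
apply: (le_trans (ler_normB _ _)); rewrite ger0_norm // lerD //.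
rewrite [leLHS]normrM; apply: ler_pM => //.
- rewrite [leLHS]normrM; apply: ler_pM; rewrite ?normr_ge0 ?(ger0_norm i0) //.
  by rewrite ger0_norm ?imillsD_ge0 // lerD.
- apply: (le_trans (ler_normD _ _)); rewrite lerD // normrM (ger0_norm i0).
  by rewrite ger0_norm // ler_wpM2l.
Qed.

Definition model_ok (m : glm R) : Prop :=
  match m with NegBin kappa => 0 < kappa | _ => True end.

Definition natural_domain (m : glm R) (theta : R) : Prop :=
  match m with GammaLog | NegBin _ => theta < 0 | _ => True end.

(** Mean and variance functions: the derivatives of the cumulant function on the
    natural domain. *)
Definition cum1 (m : glm R) (theta : R) : R :=
  match m with
  | Gaussian => theta
  | Logistic | Probit => expit theta
  | Poisson => expR theta
  | GammaLog => - theta^-1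
  | NegBin kappa => kappa * expR theta / (1 - expR theta)
  end.

Definition cum2 (m : glm R) (theta : R) : R :=
  match m with
  | Gaussian => 1
  | Logistic | Probit => expit theta * (1 - expit theta)
  | Poisson => expR theta
  | GammaLog => theta ^- 2
  | NegBin kappa => kappa * expR theta / (1 - expR theta) ^+ 2
  end.

Definition dlink (m : glm R) (eta : R) : R :=
  match m with
  | Gaussian | Logistic | Poisson => 1
  | Probit => npdf eta / (Phi eta * (1 - Phi eta))
  | GammaLog => expR (- eta)
  | NegBin kappa => kappa / (kappa + expR eta)
  end.

Lemma is_derive_cum m (theta : R) : natural_domain m theta ->
  is_derive theta 1 (cumulant m) (cum1 m theta) /\
  is_derive theta 1 (cum1 m) (cum2 m theta).
Proof.
case: m => [||||| kappa] /= dom.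
- by split; apply: is_derive_eq; rewrite /GRing.scale /=; field.
- split; last exact: is_derive_expit.
  have h := is_derive1_ln (expR1D_gt0 theta).
  by apply: is_derive_eq; rewrite /expit; ring.
- by split; exact: is_derive_expR.
- split; last exact: is_derive_expit.
  have h := is_derive1_ln (expR1D_gt0 theta).
  by apply: is_derive_eq; rewrite /expit; ring.
- have t0 : 0 < - theta by rewrite oppr_gt0.
  have tn : theta != 0 by rewrite lt_eqF.
  have h := is_derive1_ln t0; have h' := is_derive_inv tn.
  by split; apply: is_derive_eq; rewrite /GRing.scale /=; field.
- have e1 : expR theta < 1 by rewrite expR_lt1.
  have p0 : 0 < 1 - expR theta by rewrite subr_gt0.
  have n0 : 1 - expR theta != 0 by rewrite gt_eqF.
  have h := is_derive1_ln p0; have h' := is_derive_inv n0.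
  by split; apply: is_derive_eq; rewrite /GRing.scale /=; field.
Qed.

Lemma link_domain m (eta : R) : model_ok m -> natural_domain m (link m eta).
Proof.
case: m => //= [_|kappa k0]; first by rewrite oppr_lt0 expR_gt0.
have e0 := expR_gt0 eta.
rewrite subr_lt0 -{1}[eta]expRK ltr_ln ?posrE ?expR_gt0 ?addr_gt0 //.
by rewrite ltrDr.
Qed.

Lemma expR_link_negbin (kappa eta : R) : 0 < kappa ->
  expR (link (NegBin kappa) eta) = expR eta / (kappa + expR eta).
Proof.
move=> k0 /=; rewrite expRD expRN lnK // posrE addr_gt0 ?expR_gt0 //.
Qed.

Lemma is_derive_link m (eta : R) : model_ok m ->
  is_derive eta 1 (link m) (dlink m eta).
Proof.
case: m => [||||| kappa] /= ok.
- exact: is_derive_id.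
- exact: is_derive_id.
- exact: is_derive_id.
- have p0 := Phi_gt0 eta; have p1 : 0 < 1 - Phi eta by rewrite subr_gt0 Phi_lt1.
  have r0 : 0 < Phi eta / (1 - Phi eta) by rewrite divr_gt0.
  have n1 : 1 - Phi eta != 0 by rewrite gt_eqF.
  have n0 : Phi eta != 0 by rewrite gt_eqF.
  have h := is_derive1_ln r0; have h' := is_derive_inv n1.
  by apply: is_derive_eq; rewrite /GRing.scale /=; field; rewrite n0 n1.
- by apply: is_derive_eq; rewrite /GRing.scale /=; ring.
- have p0 : 0 < kappa + expR eta by rewrite addr_gt0 ?expR_gt0.
  have n0 : kappa + expR eta != 0 by rewrite gt_eqF.
  have h := is_derive1_ln p0.
  by apply: is_derive_eq; rewrite /GRing.scale /=; field.
Qed.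

Lemma fisher_weightE m (t eta : R) : model_ok m ->
  fisher_weight m t eta = cum2 m (link m eta) * dlink m eta ^+ 2 / t.
Proof.
move=> ok; rewrite /fisher_weight; congr (_ * _ ^+ 2 / _); last first.
  by rewrite derive1E; have [_ ->] := is_derive_link eta ok.
have dom := link_domain eta ok; set theta := link m eta in dom *.
have E : {near theta, derive1 (cumulant m) =1 cum1 m}.
  have N : \forall u \near theta, natural_domain m u.
    by case: (m) dom => /= [_|_|_|_|h|? h]; near=> u => //;
       near: u; exact: lt_nbhsl.
  near=> u; have /is_derive_cum[[_ du] _] : natural_domain m u by near: u.
  by rewrite derive1E.
rewrite /= derive1E (near_eq_derive _ E) ?oner_eq0 //.
by have [_ [_ ->]] := is_derive_cum dom.
Unshelve. all: by end_near. Qed.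

(** Score and observed information of one observation in its linear predictor,
    in simplified closed form: score and info are plus the first and minus the
    second derivative of obs_loglik. *)
Definition score (m : glm R) (t eta y : R) : R :=
  match m with
  | Gaussian => (y - eta) / t
  | Logistic => (y - expit eta) / t
  | Poisson => (y - expR eta) / t
  | Probit => (y * imills eta - (1 - y) * imills (- eta)) / t
  | GammaLog => (y * expR (- eta) - 1) / t
  | NegBin kappa => (y - (y + kappa) * (expR eta / (kappa + expR eta))) / t
  end.

Definition info (m : glm R) (t eta y : R) : R :=
  match m with
  | Gaussian => 1 / t
  | Logistic => expit eta * (1 - expit eta) / t
  | Poisson => expR eta / t
  | Probit => (y * probit_curv eta + (1 - y) * probit_curv (- eta)) / t
  | GammaLog => y * expR (- eta) / t
  | NegBin kappa =>
      (y + kappa) * (kappa * expR eta / (kappa + expR eta) ^+ 2) / t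
  end.

Definition obs_loglik (m : glm R) (k : R -> R -> R) (t y eta : R) : R :=
  (y * link m eta - cumulant m (link m eta)) / t + k y t.

Lemma is_derive_score m (t y eta : R) : model_ok m ->
  is_derive eta 1 (fun eta => score m t eta y) (- info m t eta y).
Proof.
case: m => [||||| kappa] /= ok.
- by apply: is_derive_eq; rewrite /GRing.scale /=; ring.
- have h := is_derive_expit eta.
  by apply: is_derive_eq; rewrite /GRing.scale /=; ring.
- by apply: is_derive_eq; rewrite /GRing.scale /=; ring.
- have h := is_derive_imills eta; have h' := is_derive_imills (- eta).
  by apply: is_derive_eq; rewrite /GRing.scale /= /probit_curv; ring.
- by apply: is_derive_eq; rewrite /GRing.scale /=; ring.
- have n0 : kappa + expR eta != 0 by rewrite gt_eqF // addr_gt0 ?expR_gt0.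
  have h := is_derive_inv n0.
  apply: is_derive_eq; rewrite /GRing.scale /=.
  set e := expR eta in n0 *; set s := t^-1.
  by field.
Qed.

Lemma score_linear m (t y eta : R) : model_ok m ->
  score m t eta y = (y - cum1 m (link m eta)) * dlink m eta / t.
Proof.
case: m => [||||| kappa] /= ok; rewrite ?mulr1 //.
- have p0 := Phi_gt0 eta; have p1 : 0 < 1 - Phi eta by rewrite subr_gt0 Phi_lt1.
  have n1 : 1 - Phi eta != 0 by rewrite gt_eqF.
  have n0 : Phi eta != 0 by rewrite gt_eqF.
  rewrite /imills npdf_sym PhiN /expit lnK ?posrE ?divr_gt0 //.
  congr (_ / _); field; rewrite n0 n1 /=.
  rewrite (_ : 1 - Phi eta + Phi eta = 1) ?oner_eq0 //; ring.
- congr (_ / _); rewrite invrN opprK expRN invrK mulrBl divff //.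
  by rewrite gt_eqF // expR_gt0.
- congr (_ / _); rewrite expR_link_negbin //.
  have e0 := expR_gt0 eta; have p0 : 0 < kappa + expR eta by rewrite addr_gt0.
  field; rewrite gt_eqF // addrK gt_eqF //.
Qed.

Lemma is_derive_obs_loglik m k (t y eta : R) : model_ok m ->
  is_derive eta 1 (obs_loglik m k t y) (score m t eta y).
Proof.
move=> ok; rewrite score_linear //.
have h := is_derive_link eta ok.
have [h' _] := is_derive_cum (link_domain eta ok).
by rewrite /obs_loglik; apply: is_derive_eq; rewrite /GRing.scale /=; ring.
Qed.

Lemma info_ge0 m (t y eta : R) : model_ok m -> 0 < t -> sample_space m y ->
  0 <= info m t eta y.
Proof.
case: m => [||||| kappa] /= ok t0 sy.
- by rewrite divr_ge0 // ltW.
- by rewrite divr_ge0 ?(ltW t0) // ltW // expit_var_gt0.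
- by rewrite divr_ge0 ?expR_ge0 ?(ltW t0).
- rewrite divr_ge0 ?(ltW t0) //.
  by case: sy => ->; rewrite ?subr0 ?subrr ?mul0r ?mul1r ?addr0 ?add0r probit_curv_ge0.
- by rewrite divr_ge0 ?(ltW t0) // mulr_ge0 ?expR_ge0 // ltW.
- case: sy => j ->; have k0 := ltW ok.
  rewrite divr_ge0 ?(ltW t0) // mulr_ge0 ?addr_ge0 ?ler0n //.
  by rewrite divr_ge0 ?sqr_ge0 // mulr_ge0 ?expR_ge0.
Qed.

End ModelCalculus.

(** * Cumulant generating function of the score *)

Section CumulantBounds.
Context {R : realType}.

(** Every natural parameter is attained, so that the densities of a family
    integrate to one at every natural parameter: this is what determines the
    moment generating function of the score. *)
Lemma link_onto m (theta : R) : model_ok m -> natural_domain m theta ->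
  exists eta, link m eta = theta.
Proof.
case: m => [||||| kappa] /= ok dom; try by exists theta.
- have [|eta E] := @Phi_surj R (expit theta).
    by rewrite expit_gt0 expit_lt1.
  exists eta; rewrite E (_ : expit theta / (1 - expit theta) = expR theta) ?expRK //.
  have h := expR1D_gt0 theta; rewrite /expit; field.
  by rewrite gt_eqF // addrK oner_eq0.
- by exists (- ln (- theta)); rewrite opprK lnK ?opprK // posrE oppr_gt0.
- have q0 := expR_gt0 theta.
  have q1 : 0 < 1 - expR theta by rewrite subr_gt0 expR_lt1.
  have q2 : 0 < kappa * expR theta / (1 - expR theta).
    by rewrite divr_gt0 // mulr_gt0.
  exists (ln (kappa * expR theta / (1 - expR theta))).
  rewrite lnK ?posrE // -ln_div ?posrE ?addr_gt0 //.
  rewrite -[RHS]expRK; congr ln; field.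
  by rewrite (gt_eqF q1) /= mulrBr mulr1 subrK gt_eqF.
Qed.

(** Majorizing the second derivative of the cumulant function along a segment by
    W / (1 - a s) ^ 3, the second derivative of W s ^ 2 / (2 (1 - a s)). *)
Lemma cumulant_taylor m (theta x W a : R) : 0 <= a < 1 ->
  (forall s : R, 0 <= s <= 1 -> natural_domain m (theta + s * x) /\
     cum2 m (theta + s * x) * x ^+ 2 <= W / (1 - a * s) ^+ 3) ->
  cumulant m (theta + x) - cumulant m theta - x * cum1 m theta
    <= W / (2 * (1 - a)).
Proof.
move=> /andP[a0 a1] H.
pose k (s : R) := W * s ^+ 2 / (2 * (1 - a * s)) -
  (cumulant m (theta + s * x) - cumulant m theta - s * x * cum1 m theta).
pose k1 (s : R) := W * (2 * s - a * s ^+ 2) / (2 * (1 - a * s) ^+ 2) -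
  (cum1 m (theta + s * x) * x - x * cum1 m theta).
pose k2 (s : R) := W / (1 - a * s) ^+ 3 - cum2 m (theta + s * x) * x ^+ 2.
have : 0 <= k (0 + 1).
  apply: (@second_order_ge0 R k k1 k2) => [s sI||].
  - rewrite add0r mulr1; have [dom le2] := H s sI; case/andP: sI => s0 s1.
    have as1 : 0 < 1 - a * s.
      by rewrite subr_gt0 (le_lt_trans _ a1) // ler_piMr.
    have n1 : 1 - a * s != 0 by rewrite gt_eqF.
    have n2 : 2 * (1 - a * s) != 0 by rewrite mulf_neq0.
    have n3 : 2 * (1 - a * s) ^+ 2 != 0 by rewrite mulf_neq0 ?expf_neq0.
    have [d1 d2] := is_derive_cum dom.
    have h2 := is_derive_inv n2; have h3 := is_derive_inv n3.
    split; last by rewrite /k2 subr_ge0.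
      by rewrite /k /k1; apply: is_derive_eq; rewrite /GRing.scale /=; field.
    by rewrite /k1 /k2; apply: is_derive_eq; rewrite /GRing.scale /=; field.
  - by rewrite /k mul0r addr0 expr0n /= mulr0 !mul0r !subrr.
  - by rewrite /k1 mul0r addr0 expr0n /= !mulr0 subrr mulr0 mul0r mulrC !subrr.
by rewrite add0r /k expr1n !mulr1 !mul1r subr_ge0.
Qed.

Definition eta_ok (m : glm R) (L eta : R) : Prop :=
  match m with Probit => `|eta| <= L | _ => True end.

(** Scale, in units of the canonical parameter, on which the cumulant function
    may change its curvature. *)
Definition curv_const (m : glm R) (L : R) : R :=
  match m with
  | Gaussian => 0
  | Probit => npdf 0 / Phi (- L) ^+ 2
  | _ => 1
  end.

Lemma curv_const_ge0 m (L : R) : 0 <= curv_const m L.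
Proof.
by case: m => //=; rewrite ?ler01 // divr_ge0 ?sqr_ge0 // ltW // npdf_gt0.
Qed.

Lemma Phi_compl_ge (L eta : R) : `|eta| <= L ->
  Phi (- L) <= Phi eta /\ Phi (- L) <= 1 - Phi eta.
Proof.
rewrite ler_norml => /andP[h1 h2]; rewrite -PhiN; split; apply: Phi_le => //.
by rewrite lerN2.
Qed.

Lemma dlink_ge0 m (eta : R) : model_ok m -> 0 <= dlink m eta.
Proof.
case: m => //= [_|kappa k0].
- by rewrite divr_ge0 ?mulr_ge0 ?Phi_ge0 ?subr_ge0 ?Phi_le1 // ltW // npdf_gt0.
- by rewrite divr_ge0 ?addr_ge0 ?expR_ge0 // ltW.
Qed.

Lemma dlink_probit_le (L eta : R) : `|eta| <= L ->
  dlink Probit eta <= curv_const Probit L.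
Proof.
move=> /Phi_compl_ge[h1 h2] /=; have pL := Phi_gt0 (- L).
have p1 := lt_le_trans pL h1; have p2 := lt_le_trans pL h2.
apply: ler_pM; rewrite ?npdf_le0 ?(ltW (npdf_gt0 _)) //.
  by rewrite invr_ge0 mulr_ge0 // ltW.
rewrite lef_pV2 ?posrE ?exprn_gt0 ?mulr_gt0 //.
by rewrite expr2 ler_pM // ltW.
Qed.

Lemma cum2_logit_shift (theta x : R) :
  cum2 Logistic (theta + x) <= expR `|x| * cum2 Logistic theta.
Proof.
have := @self_concordant_le R (cum2 Logistic) _ theta (theta + x)
  (@is_derive_expit_var R) (@expit_var_self_concordant R).
by rewrite (addrC theta) addrK.
Qed.

(** The logistic and Poisson variance functions dominate their derivative, so that
    a step x changes them by a factor exp |x| at most; the same cumulant serves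
    the probit model, where the step is bounded by curv_const times |s|. For the
    Gamma and negative-binomial models the variance function is computed at the
    shifted parameter, whose distance to the boundary of the natural domain
    shrinks by a factor of at least 1 - |s|. *)
Lemma cum2_shift m (L eta s : R) : model_ok m -> eta_ok m L eta ->
  curv_const m L * `|s| < 1 ->
  natural_domain m (link m eta + s * dlink m eta) /\
  cum2 m (link m eta + s * dlink m eta)
    <= cum2 m (link m eta) / (1 - curv_const m L * `|s|) ^+ 3.
Proof.
case: m => [||||| kappa] /= ok ek.
- by rewrite mul0r subr0 expr1n divr1.
- rewrite mul1r mulr1 => s1; split=> //.
  apply: (le_trans (cum2_logit_shift _ _)); rewrite mulrC.
  by rewrite ler_wpM2l ?(ltW (expit_var_gt0 _)) // expR_le_inv3 // normr_ge0.
- rewrite mul1r mulr1 => s1; split=> //.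
  rewrite expRD ler_wpM2l ?expR_ge0 //.
  apply: (@le_trans _ _ (expR `|s|)); first by rewrite ler_expR ler_norm.
  by rewrite expR_le_inv3 // normr_ge0.
- move=> s1; split=> //; set x := s * _.
  have xs : `|x| <= curv_const Probit L * `|s|.
    rewrite /x normrM mulrC ler_wpM2r // ger0_norm; first exact: dlink_probit_le.
    exact: (@dlink_ge0 Probit).
  apply: (le_trans (cum2_logit_shift _ _)); rewrite mulrC.
  rewrite ler_wpM2l ?(ltW (expit_var_gt0 _)) //.
  apply: (@le_trans _ _ (expR (curv_const Probit L * `|s|))).
    by rewrite ler_expR.
  by rewrite expR_le_inv3 // s1 andbT mulr_ge0 // (@curv_const_ge0 Probit).
- rewrite mul1r => s1; have e0 := expR_gt0 (- eta).
  have s1' : 0 < 1 - s by rewrite subr_gt0 (le_lt_trans (ler_norm _)).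
  rewrite (_ : - expR (- eta) + _ = - (expR (- eta) * (1 - s))); last by ring.
  split; first by rewrite oppr_lt0 mulr_gt0.
  rewrite !sqrrN exprMn invfM ler_wpM2l ?invr_ge0 ?sqr_ge0 //.
  by apply: inv_cube_ge => //; [rewrite normr_ge0|rewrite lerB // ler_norm].
- rewrite mul1r => s1.
  have ke0 : 0 < kappa + expR eta by rewrite addr_gt0 ?expR_gt0.
  pose q := expR (link (NegBin kappa) eta).
  have qE : q = expR eta / (kappa + expR eta) by exact: expR_link_negbin.
  have dE : kappa / (kappa + expR eta) = 1 - q by rewrite qE; field; rewrite gt_eqF.
  have q0 : 0 < q by exact: expR_gt0.
  have d0 : 0 < 1 - q by rewrite -dE divr_gt0.
  rewrite dE -/(link (NegBin kappa) eta) expRD -/q.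
  set x := s * (1 - q).
  have s1' : 0 < 1 - `|s| by rewrite subr_gt0.
  have xs : `|x| <= `|s| by rewrite normrM (gtr0_norm d0) ler_piMr // gerBl ltW.
  have x1 : `|x| < 1 by exact: le_lt_trans s1.
  have x1' : 0 < 1 - x by rewrite subr_gt0 (le_lt_trans (ler_norm _)).
  (* the shifted denominator stays within a factor 1 - |s| of the original one *)
  have ex : expR x <= (1 - x)^-1.
    rewrite -[expR x]invrK lef_pV2 ?posrE ?invr_gt0 ?expR_gt0 // -expRN.
    exact: expR_ge1Dx.
  have key : expR x * (1 - q) ^+ 2 * (1 - `|s|) ^+ 2 <= (1 - q * expR x) ^+ 2
       /\ 0 < 1 - q * expR x.
    have [s0|s0] := leP 0 s.
      have x0 : 0 <= x by rewrite mulr_ge0 // ltW.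
      rewrite ger0_norm // in s1 s1' *.
      have lo : (1 - q) * (1 - s) / (1 - x) <= 1 - q * expR x.
        apply: (@le_trans _ _ (1 - q * (1 - x)^-1)).
          rewrite le_eqVlt; apply/orP; left; apply/eqP; rewrite /x.
          by field; rewrite gt_eqF.
        by rewrite lerB // ler_wpM2l // ltW.
      have lo0 : 0 < (1 - q) * (1 - s) / (1 - x) by rewrite divr_gt0 ?mulr_gt0.
      split; last exact: lt_le_trans lo.
      apply: (@le_trans _ _ (((1 - q) * (1 - s) / (1 - x)) ^+ 2)); last first.
        by rewrite ler_sqr ?nnegrE ?(ltW lo0) // ltW // (lt_le_trans lo0).
      rewrite -mulrA [leRHS](_ : _ =
        (1 - x) ^- 2 * ((1 - q) ^+ 2 * (1 - s) ^+ 2)); last first.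
        by field; rewrite gt_eqF.
      apply: ler_wpM2r; first by apply: mulr_ge0; exact: sqr_ge0.
      apply: (le_trans ex); rewrite lef_pV2 ?posrE ?exprn_gt0 //.
      by rewrite expr2 ler_piMr ?(ltW x1') // gerBl.
    have x0 : x <= 0 by rewrite mulr_le0_ge0 // ltW.
    have ex1 : expR x <= 1 by rewrite -expR0 ler_expR.
    have lo : 1 - q <= 1 - q * expR x by rewrite lerB // ler_piMr // ltW.
    split; last exact: lt_le_trans lo.
    apply: (@le_trans _ _ ((1 - q) ^+ 2)).
      rewrite -mulrA mulrCA ler_piMr ?sqr_ge0 // mulr_ile1 ?expR_ge0 ?sqr_ge0 //.
      by rewrite exprn_ile1 ?(ltW s1') // gerBl.
    by rewrite ler_sqr ?nnegrE ?(ltW d0) // ltW // (lt_le_trans d0).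
  case: key => key k0; split.
    by rewrite -expR_lt1 expRD -/q; move: k0; rewrite subr_gt0.
  rewrite -!mulrA ler_wpM2l ?(ltW ok) // ler_wpM2l ?(ltW q0) //.
  have n1 : 0 < (1 - `|s|) ^+ 2 by rewrite exprn_gt0.
  have n2 : 0 < (1 - q) ^+ 2 by rewrite exprn_gt0.
  rewrite ler_pdivrMr ?exprn_gt0 //.
  apply: (@le_trans _ _ ((1 - q) ^- 2 * (1 - `|s|) ^- 2 * (1 - q * expR x) ^+ 2)).
    rewrite -invfM -ler_pdivrMl ?invr_gt0 ?mulr_gt0 // invrK mulrC mulrA.
    exact: key.
  rewrite ler_wpM2r ?sqr_ge0 // ler_wpM2l ?invr_ge0 ?sqr_ge0 //.
  by apply: inv_cube_ge; rewrite ?normr_ge0.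
Qed.

(** The left-hand side is the cumulant generating function of the score at s; the
    growth of the curvature is exactly what the Bernstein form on the right
    allows. *)
Lemma cgf_score_le m (L t eta s : R) : model_ok m -> eta_ok m L eta -> 0 < t ->
  curv_const m L * `|s| < 1 ->
  (cumulant m (link m eta + s * dlink m eta) - cumulant m (link m eta)
     - s * dlink m eta * cum1 m (link m eta)) / t
  <= fisher_weight m t eta * s ^+ 2 / (2 * (1 - curv_const m L * `|s|)).
Proof.
move=> ok ek t0 s1; rewrite fisher_weightE //.
have c0 := curv_const_ge0 m L.
rewrite [leRHS](_ : _ = cum2 m (link m eta) * (s * dlink m eta) ^+ 2 /
  (2 * (1 - curv_const m L * `|s|)) / t); last first.
  by field; rewrite !gt_eqF // subr_gt0.
rewrite ler_pM2r ?invr_gt0 //; apply: cumulant_taylor.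
  by rewrite s1 mulr_ge0.
move=> r /andP[r0 r1]; have rs : curv_const m L * `|r * s| = curv_const m L * `|s| * r.
  by rewrite normrM (ger0_norm r0); ring.
have [|dom le2] := @cum2_shift m L eta (r * s) ok ek.
  by rewrite rs (le_lt_trans _ s1) // ler_piMr // mulr_ge0.
rewrite mulrA; split=> //.
rewrite [leRHS]mulrAC ler_wpM2r ?sqr_ge0 //.
by rewrite -rs.
Qed.

End CumulantBounds.

(** * Regularity of the observed information *)

Section ModelBounds.
Context {R : realType}.

Lemma measurable_score m (t eta : R) : measurable_fun setT (score m t eta).
Proof.
case: m => [||||| kappa] /=; apply: measurable_funM => //.
- exact: measurable_funB.
- exact: measurable_funB.
- exact: measurable_funB.
- by apply: measurable_funB; apply: measurable_funM => //; exact: measurable_funB.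
- by apply: measurable_funB => //; exact: measurable_funM.
- apply: measurable_funB => //; apply: measurable_funM => //.
  exact: measurable_funD.
Qed.

Lemma measurable_info m (t eta : R) : measurable_fun setT (info m t eta).
Proof.
case: m => [||||| kappa] /=; apply: measurable_funM => //.
- by apply: measurable_funD; apply: measurable_funM => //; exact: measurable_funB.
- exact: measurable_funM.
- by apply: measurable_funM => //; exact: measurable_funD.
Qed.

Section Law.
Variables (m : glm R) (nu : {measure set R -> \bar R}) (k : R -> R -> R) (t : R).
Hypotheses (ok : model_ok m) (t0 : 0 < t) (dens : density_family m nu k t).

Lemma measurable_glm_density eta : measurable_fun setT (glm_density m k t eta).
Proof.
have [_ mk _] := dens; apply: measurableT_comp => //.
apply: measurable_funD => //; apply: measurable_funM => //.
by apply: measurable_funB => //; exact: measurable_funM.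
Qed.

Lemma glm_density_ge0 eta y : 0 <= glm_density m k t eta y.
Proof. exact: expR_ge0. Qed.

(** Tilting the density of one observation by an exponential of its score stays
    in the family: the tilted density is the one at the linear predictor whose
    canonical parameter is shifted. *)
Lemma mgf_score eta s : natural_domain m (link m eta + s * dlink m eta) ->
  (\int[nu]_y (expR (s * score m t eta y) * glm_density m k t eta y)%:E =
   (expR ((cumulant m (link m eta + s * dlink m eta) - cumulant m (link m eta)
     - s * dlink m eta * cum1 m (link m eta)) / t))%:E)%E.
Proof.
move=> dom; have [eta1 E1] := link_onto ok dom; rewrite -E1.
set C := (X in (expR X)%:E).
have E y : (expR (s * score m t eta y) * glm_density m k t eta y)%:E =
    ((expR C)%:E * (glm_density m k t eta1 y)%:E)%E.
  rewrite -EFinM /glm_density -!expRD.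
  apply: (congr1 (fun z : R => (expR z)%:E)).
  have {E1} : s * dlink m eta = link m eta1 - link m eta.
    by rewrite E1 addrC addKr.
  rewrite (score_linear _ _ _ ok) /C.
  move: (cum1 m (link m eta)) (cumulant m (link m eta1)) => c1 b1.
  move: (cumulant m (link m eta)) (k y t) => b0 ky.
  move: (dlink m eta) (link m eta) (link m eta1) => dl th0 th1 sE.
  have -> : th1 = th0 + s * dl by rewrite sE addrC subrK.
  by field; exact: lt0r_neq0.
under eq_integral => y _ do rewrite E.
rewrite ge0_integralZl_EFin ?expR_ge0 //.
- by have [_ _ ->] := dens; rewrite mule1.
- by move=> y _; rewrite lee_fin glm_density_ge0.
- by apply/measurable_EFinP; exact: measurable_glm_density.
Qed.

End Law.

Definition obs_restriction (m : glm R) (tmin tmax L t eta : R) : Prop :=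
  match m with
  | Gaussian | GammaLog => tmin <= t <= tmax
  | Logistic | Poisson => t = 1
  | Probit => t = 1 /\ `|eta| <= L
  | NegBin kappa => 0 < kappa /\ t = 1
  end.

(** Models whose observed information has exponential rather than Gaussian
    tails. *)
Definition heavy_info (m : glm R) : bool :=
  match m with GammaLog | NegBin _ => true | _ => false end.

Definition rel_info (m : glm R) (t eta y : R) : R :=
  info m t eta y / fisher_weight m t eta - 1.

(** What the analysis needs to know about one observation: the observed
    information is Lipschitz in the linear predictor relative to its size, and
    its relative fluctuation has a moment generating function of Bernstein
    type. *)
Definition info_regular (m : glm R) (cl K cB cW t eta : R) : Prop :=
  [/\ 0 < fisher_weight m t eta, cB * fisher_weight m t eta <= cW,
      forall y e1 e2, sample_space m y -> `|e1 - eta| <= 1 -> `|e2 - eta| <= 1 ->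
        `|info m t e2 y - info m t e1 y| <=
          cl * `|e2 - e1| * (fisher_weight m t eta + info m t eta y) &
      forall nu k, density_family m nu k t ->
      forall s, cB * `|s| <= 1 ->
        exists2 M, (\int[nu]_y (expR (s * rel_info m t eta y) *
                      glm_density m k t eta y)%:E = M%:E)%E &
          M <= expR (K * s ^+ 2)].

Lemma mgf_of_rel_info m (K t eta s a : R) nu k : model_ok m -> 0 < t ->
  density_family m nu k t ->
  (forall y, s * rel_info m t eta y = a * score m t eta y) ->
  natural_domain m (link m eta + a * dlink m eta) ->
  (cumulant m (link m eta + a * dlink m eta) - cumulant m (link m eta)
     - a * dlink m eta * cum1 m (link m eta)) / t <= K * s ^+ 2 ->
  exists2 M, (\int[nu]_y (expR (s * rel_info m t eta y) *
                glm_density m k t eta y)%:E = M%:E)%E & M <= expR (K * s ^+ 2).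
Proof.
move=> ok t0 dens E dom le.
have := mgf_score ok t0 dens dom.
under eq_integral => y _ do rewrite -E.
by move=> ->; eexists; first by []; rewrite ler_expR.
Qed.

Lemma mgf_rel_info0 m (K t eta s : R) nu k : model_ok m -> 0 < t -> 0 <= K ->
  density_family m nu k t -> (forall y, rel_info m t eta y = 0) ->
  exists2 M, (\int[nu]_y (expR (s * rel_info m t eta y) *
                glm_density m k t eta y)%:E = M%:E)%E & M <= expR (K * s ^+ 2).
Proof.
move=> ok t0 K0 dens E; apply: (@mgf_of_rel_info m K t eta s 0) => //.
- by move=> y; rewrite E mulr0 mul0r.
- by rewrite mul0r addr0; exact: link_domain.
- by rewrite !mul0r addr0 subrr subr0 mul0r mulr_ge0 ?sqr_ge0.
Qed.

Lemma info_regular_const m (cl K t eta : R) : model_ok m -> 0 < t ->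
  0 <= K -> 0 < fisher_weight m t eta ->
  (forall y, info m t eta y = fisher_weight m t eta) ->
  (forall y e1 e2, sample_space m y -> `|e1 - eta| <= 1 -> `|e2 - eta| <= 1 ->
        `|info m t e2 y - info m t e1 y| <=
          cl * `|e2 - e1| * (fisher_weight m t eta + info m t eta y)) ->
  info_regular m cl K 0 0 t eta.
Proof.
move=> ok t0 K0 w0 iw lip; split => //; first by rewrite mul0r.
move=> nu k dens s _; apply: mgf_rel_info0 => // y.
by rewrite /rel_info iw divff ?subrr // gt_eqF.
Qed.

(** For the Gamma and negative-binomial models the tail of the relative information is inherited
    from the score, of which it is a multiple b. *)
Lemma info_regular_heavy m (b bmax cW t eta : R) : model_ok m -> 0 < t ->
  0 < b <= bmax -> curv_const m 0 = 1 -> eta_ok m 0 eta ->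
  0 < fisher_weight m t eta -> fisher_weight m t eta * b <= 1 ->
  2 * bmax * fisher_weight m t eta <= cW ->
  (forall y, rel_info m t eta y = b * score m t eta y) ->
  (forall y e1 e2, sample_space m y -> `|e1 - eta| <= 1 -> `|e2 - eta| <= 1 ->
        `|info m t e2 y - info m t e1 y| <=
          expR 1 * `|e2 - e1| * (fisher_weight m t eta + info m t eta y)) ->
  info_regular m (expR 1) bmax (2 * bmax) cW t eta.
Proof.
move=> ok t0 /andP[b0 bb] c1 ek w0 wb wc rel lip; split=> // nu k dens s sb.
have bm0 : 0 < bmax := lt_le_trans b0 bb.
have bs : `|s * b| <= 2^-1.
  rewrite normrM (gtr0_norm b0); apply: (@le_trans _ _ (`|s| * bmax)).
    by rewrite ler_wpM2l.
  by move: sb; lra.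
have cs : curv_const m 0 * `|s * b| < 1 by rewrite c1 mul1r; lra.
apply: (@mgf_of_rel_info m bmax t eta s (s * b)) => //.
- by move=> y; rewrite rel mulrA.
- by have [] := cum2_shift ok ek cs.
apply: (le_trans (cgf_score_le ok ek t0 cs)); rewrite c1 mul1r.
have d0 : 0 < 2 * (1 - `|s * b|) by rewrite mulr_gt0 // subr_gt0; lra.
rewrite ler_pdivrMr //.
apply: (@le_trans _ _ (b * s ^+ 2)).
  rewrite (_ : _ * (s * b) ^+ 2 = fisher_weight m t eta * b * (b * s ^+ 2)); last by ring.
  by rewrite ler_piMl // mulr_ge0 ?sqr_ge0 // ltW.
apply: (@le_trans _ _ (bmax * s ^+ 2)); first by rewrite ler_wpM2r ?sqr_ge0.
have e1 : 1 <= 2 * (1 - `|s * b|) by lra.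
by rewrite ler_peMr // (mulr_ge0 (ltW bm0) (sqr_ge0 _)).
Qed.

Lemma self_concordant_info m (t eta w : R) (h h1 : R -> R) y : 0 <= w ->
  (forall e, info m t e y = h e) ->
  (forall e : R, is_derive e 1 h (h1 e)) -> (forall e, `|h1 e| <= h e) ->
  forall e1 e2, `|e1 - eta| <= 1 -> `|e2 - eta| <= 1 ->
  `|info m t e2 y - info m t e1 y| <=
     expR 1 * `|e2 - e1| * (w + info m t eta y).
Proof.
move=> w0 ih hd hh e1 e2 H1 H2; rewrite !ih.
apply: (le_trans (self_concordant_lipschitz hd hh H1 H2)).
rewrite -mulrA (mulrC (h eta)) mulrA ler_wpM2l ?mulr_ge0 ?expR_ge0 //.
by rewrite lerDr.
Qed.

(** In the Gaussian, logistic and Poisson models the observed information does not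
    depend on the response, and the weights are constant or self-concordant. For
    the probit model everything is bounded because the linear predictors are. In
    the Gamma and negative-binomial models the information is affine in the
    response, with a relative fluctuation proportional to the score. *)
Lemma model_bounds m (tmin tmax L : R) : model_ok m -> 0 < tmin ->
  exists cl K cB cW : R,
  [/\ [/\ 0 <= cl, 0 <= K, 0 <= cB & 0 <= cW],
      ~~ heavy_info m -> cB = 0,
      m = Gaussian -> cl = 0 &
      forall t eta, 0 < t -> obs_restriction m tmin tmax L t eta ->
        info_regular m cl K cB cW t eta /\
        (m = Gaussian -> forall y, info m t eta y = fisher_weight m t eta)].
Proof.
case: m => [||||| kappa] ok tm0.
- exists 0, 0, 0, 0; split=> // t eta t0 _.
  have wE : fisher_weight Gaussian t eta = 1 / t.
    by rewrite fisher_weightE //= expr1n mulr1.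
  split=> [|_ y]; last by rewrite wE.
  apply: info_regular_const => //; rewrite ?wE ?divr_gt0 //.
  by move=> y e1 e2 _ _ _ /=; rewrite subrr normr0 !mul0r.
- exists (expR 1), 0, 0, 0; split=> //.
  move=> t eta t0 -> {t t0}; split=> // .
  have wE : fisher_weight Logistic 1 eta = expit eta * (1 - expit eta).
    by rewrite fisher_weightE //= expr1n mulr1 divr1.
  apply: info_regular_const => //; rewrite ?wE ?expit_var_gt0 //.
    by move=> y /=; rewrite divr1.
  move=> y e1 e2 _; apply: (@self_concordant_info Logistic 1 eta _ _ _ y
    (ltW (expit_var_gt0 eta)) _ (@is_derive_expit_var R)
    (@expit_var_self_concordant R)) => e /=; by rewrite divr1.
- exists (expR 1), 0, 0, 0; split=> //.
  move=> t eta t0 -> {t t0}; split=> // .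
  have wE : fisher_weight Poisson 1 eta = expR eta.
    by rewrite fisher_weightE //= expr1n mulr1 divr1.
  apply: info_regular_const => //; rewrite ?wE ?expR_gt0 //.
    by move=> y /=; rewrite divr1.
  move=> y e1 e2 _; apply: (@self_concordant_info Poisson 1 eta _ expR expR y
    (expR_ge0 eta)) => e /=; first by rewrite divr1.
  by rewrite ger0_norm ?expR_ge0.
- pose L' := `|L|; have L'0 : 0 <= L' by exact: normr_ge0.
  have L0 : 0 <= L' + 1 by rewrite addr_ge0.
  have [K1 K10 K1P] := probit_curv1_bounded L0.
  pose wmin := npdf L' ^+ 2; have wm0 : 0 < wmin by rewrite exprn_gt0 // npdf_gt0.
  pose l := npdf 0 / Phi (- L').
  have l0 : 0 <= l by rewrite divr_ge0 ?Phi_ge0 ?(ltW (npdf_gt0 _)).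
  pose KA := l * (l + L'); have KA0 : 0 <= KA by rewrite mulr_ge0 // addr_ge0.
  exists (K1 / wmin), ((KA / wmin) ^+ 2 / 2), 0, 0; split=> //.
    by split=> //; rewrite divr_ge0 ?sqr_ge0 // ltW.
  move=> t eta t0 [-> etaL]; split=> // {t t0}.
  have {}etaL : `|eta| <= L' by rewrite (le_trans etaL) // ler_norm.
  have p0 := Phi_gt0 eta; have p1 : 0 < 1 - Phi eta by rewrite subr_gt0 Phi_lt1.
  have n1 : 1 - Phi eta != 0 by rewrite gt_eqF.
  have n0 : Phi eta != 0 by rewrite gt_eqF.
  have f0 := npdf_gt0 eta; have fn : npdf eta != 0 by rewrite gt_eqF.
  have wE : fisher_weight Probit 1 eta = npdf eta ^+ 2 / (Phi eta * (1 - Phi eta)).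
    rewrite fisher_weightE //= /expit lnK ?posrE ?divr_gt0 //.
    by field; rewrite n0 n1 subrK oner_eq0.
  have w0 : 0 < fisher_weight Probit 1 eta.
    by rewrite wE divr_gt0 ?exprn_gt0 ?mulr_gt0.
  have wmw : wmin <= fisher_weight Probit 1 eta.
    rewrite wE ler_pdivlMr ?mulr_gt0 //.
    apply: (@le_trans _ _ wmin).
      rewrite ler_piMr ?(ltW wm0) // mulr_ile1 ?(ltW p0) ?(ltW p1) ?Phi_le1 //.
      by rewrite gerBl ltW.
    rewrite ler_sqr ?nnegrE ?(ltW (npdf_gt0 _)) // !npdfE.
    rewrite ler_pM2l ?normal_peak_gt0 ?oner_eq0 // ler_expR.
    rewrite ler_pM2r ?invr_gt0 // lerN2 -(real_normK (num_real eta)).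
    by rewrite ler_sqr ?nnegrE.
  have curvKA x : `|x| <= L' -> probit_curv x <= KA.
    move=> xL; have il := imills_le xL.
    apply: ler_pM; rewrite ?(ltW (imills_gt0 _)) ?imillsD_ge0 // lerD //.
    exact: le_trans (ler_norm x) xL.
  have etaNL : `|- eta| <= L' by rewrite normrN.
  split=> //; first by rewrite mul0r.
    move=> y e1 e2 sy H1 H2.
    have i0 : 0 <= info Probit 1 eta y by exact: info_ge0.
    apply: (@le_trans _ _ (K1 * `|e2 - e1|)); last first.
      rewrite [leRHS]mulrAC ler_wpM2r //.
      rewrite mulrAC ler_pdivlMr // ler_wpM2l //.
      by rewrite (le_trans wmw) // lerDl.
    have bnd (e : R) : `|e - eta| <= 1 -> `|e| <= L' + 1.
      move=> he; rewrite -(subrK eta e) (le_trans (ler_normD _ _)) //.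
      by rewrite addrC lerD.
    have seg (s : R) : 0 <= s <= 1 -> `|e1 + s * (e2 - e1)| <= L' + 1.
      move=> /andP[s0 s1]; have s1' : 0 <= 1 - s by rewrite subr_ge0.
      rewrite (_ : _ + _ = (1 - s) * e1 + s * e2); last by ring.
      apply: (le_trans (ler_normD _ _)); rewrite !normrM (ger0_norm s0) (ger0_norm s1').
      have := ler_wpM2l s1' (bnd _ H1); have := ler_wpM2l s0 (bnd _ H2); lra.
    case: sy => -> /=; rewrite !divr1 ?mul0r ?subr0 ?subrr ?mul1r ?mul0r ?addr0 ?add0r.
      apply: (@lipschitz_le R (fun e => probit_curv (- e))
        (fun e => - probit_curv1 (- e))) => s sI; split.
        have h := is_derive_probit_curv (- (e1 + s * (e2 - e1))).
        by apply: is_derive_eq; rewrite /GRing.scale /=; ring.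
      by rewrite normrN; apply: K1P; rewrite normrN; exact: seg.
    apply: (@lipschitz_le R probit_curv probit_curv1) => s sI; split.
      exact: is_derive_probit_curv.
    by apply: K1P; exact: seg.
  move=> nu k dens s _.
  pose r := (probit_curv eta - probit_curv (- eta)) / fisher_weight Probit 1 eta.
  have d0 : 0 < dlink Probit eta by rewrite /= divr_gt0 // mulr_gt0.
  have relE y : rel_info Probit 1 eta y = r / dlink Probit eta * score Probit 1 eta y.
    rewrite /rel_info /r wE /= /probit_curv /imills !npdf_sym PhiN.
    by field; rewrite n0 n1 fn.
  apply: (@mgf_of_rel_info Probit _ 1 eta s (s * (r / dlink Probit eta))) => //.
    by move=> y; rewrite relE mulrA.
  rewrite divr1 (_ : s * (r / dlink Probit eta) * dlink Probit eta = s * r); last first.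
    by field; rewrite gt_eqF.
  have rK : r ^+ 2 <= (KA / wmin) ^+ 2.
    have [c1 c2] := (curvKA _ etaL, curvKA _ etaNL).
    have c3 := probit_curv_ge0 eta; have c4 := probit_curv_ge0 (- eta).
    rewrite -(real_normK (num_real r)) ler_sqr ?nnegrE ?divr_ge0 ?(ltW wm0) //.
    have wi : 0 <= (fisher_weight Probit 1 eta)^-1 by rewrite invr_ge0 ltW.
    rewrite /r normrM (ger0_norm wi); apply: ler_pM => //.
      by rewrite ler_norml; apply/andP; split; lra.
    by rewrite lef_pV2 ?posrE.
  apply: (@le_trans _ _ ((s * r) ^+ 2 / (2 * (1 - 0)))).
    apply: cumulant_taylor; first by rewrite lexx ltr01.
    move=> u _; split=> //; rewrite mul0r subr0 expr1n divr1.
    rewrite ler_piMl ?sqr_ge0 //=.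
    rewrite mulr_ile1 ?(ltW (expit_gt0 _)) ?(ltW (expit_lt1 _)) ?subr_ge0 //.
      exact/ltW/expit_lt1.
    by rewrite gerBl ltW // expit_gt0.
  rewrite subr0 mulr1 exprMn [leRHS]mulrAC ler_wpM2r ?invr_ge0 //.
  by rewrite mulrC ler_wpM2r ?sqr_ge0.
- pose tm := Num.max tmin tmax.
  have tm1 : tmin <= tm by rewrite le_max lexx.
  have tm2 : 0 < tm := lt_le_trans tm0 tm1.
  exists (expR 1), tm, (2 * tm), (2 * tm / tmin); split=> //.
    by split; rewrite ?expR_ge0 ?divr_ge0 ?mulr_ge0 ?(ltW tm2) ?(ltW tm0).
  move=> t eta t0 /andP[t1 t2]; split=> //.
  have e0 := expR_gt0 (- eta); have tn : t != 0 by rewrite gt_eqF.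
  have wE : fisher_weight GammaLog t eta = t^-1.
    rewrite fisher_weightE //= sqrrN mulVf ?mul1r //.
    by rewrite sqrf_eq0 gt_eqF.
  apply: (@info_regular_heavy GammaLog t tm) => //; rewrite ?wE ?invr_gt0 //.
  - by rewrite t0 le_max t2 orbT.
  - by rewrite mulVf.
  - rewrite ler_wpM2l ?mulr_ge0 ?(ltW tm2) // lef_pV2 //.
  - by move=> y; rewrite /rel_info wE /=; field.
  move=> y e1 e2 sy; have ti : 0 <= t^-1 by rewrite invr_ge0 ltW.
  apply: (@self_concordant_info GammaLog t eta t^-1 (fun e => y * expR (- e) / t)
    (fun e => - (y * expR (- e) / t)) y ti) => // e.
    by apply: is_derive_eq; rewrite /GRing.scale /=; ring.
  by rewrite normrN ger0_norm // mulr_ge0 // mulr_ge0 ?expR_ge0 // ltW.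
- have k0 : 0 < kappa by [].
  have ki : 0 <= kappa^-1 by rewrite invr_ge0 ltW.
  exists (expR 1), kappa^-1, (2 * kappa^-1), 2; split=> //.
    by split; rewrite ?expR_ge0 ?mulr_ge0.
  move=> t eta t0 [_ ->] {t t0}; split=> //.
  have e0 := expR_gt0 eta; have d0 : 0 < kappa + expR eta by rewrite addr_gt0.
  have dn : kappa + expR eta != 0 by rewrite gt_eqF.
  have kn : kappa != 0 by rewrite gt_eqF.
  have wE : fisher_weight (NegBin kappa) 1 eta = kappa * expR eta / (kappa + expR eta).
    rewrite fisher_weightE // /cum2 expR_link_negbin //= divr1.
    by field; rewrite dn addrK kn.
  apply: (@info_regular_heavy (NegBin kappa) kappa^-1 kappa^-1) => //.
  - by rewrite invr_gt0 k0 lexx.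
  - by rewrite wE divr_gt0 ?mulr_gt0.
  - rewrite wE (_ : _ * kappa^-1 = expR eta / (kappa + expR eta)); last first.
      by field; rewrite dn kn.
    by rewrite ler_pdivrMr // mul1r lerDr ltW.
  - rewrite wE (_ : _ * _ = 2 * (expR eta / (kappa + expR eta))); last first.
      by field; rewrite dn kn.
    rewrite -[leRHS]mulr1 ler_wpM2l // ler_pdivrMr // mul1r lerDr ltW //.
  - move=> y; rewrite /rel_info wE /=; field.
    by rewrite dn kn gt_eqF.
  move=> y e1 e2 [j ->].
  have w0 : 0 <= fisher_weight (NegBin kappa) 1 eta.
    by rewrite wE divr_ge0 ?mulr_ge0 ?(ltW k0) ?(ltW e0) ?(ltW d0).
  have jk : 0 <= j%:R + kappa by rewrite addr_ge0 ?ler0n ?(ltW k0).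
  apply: (@self_concordant_info (NegBin kappa) 1 eta _
    (fun e => (j%:R + kappa) * (kappa * expR e / (kappa + expR e) ^+ 2))
    (fun e => (j%:R + kappa) * (kappa * expR e * (kappa - expR e) /
       (kappa + expR e) ^+ 3)) j%:R w0) => e.
  - by rewrite /= divr1.
  - have de : kappa + expR e != 0 by rewrite gt_eqF // addr_gt0 ?expR_gt0.
    have dee : (kappa + expR e) ^+ 2 != 0 by rewrite expf_neq0.
    have h := is_derive_inv dee.
    by apply: is_derive_eq; rewrite /GRing.scale /=; field.
  have ee := expR_gt0 e; have de : 0 < kappa + expR e by rewrite addr_gt0.
  have den : kappa + expR e != 0 by rewrite gt_eqF.
  rewrite (_ : _ * (_ / _ ^+ 3) = (j%:R + kappa) *
    (kappa * expR e / (kappa + expR e) ^+ 2) *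
    ((kappa - expR e) / (kappa + expR e))); last by field.
  have h0 : 0 <= (j%:R + kappa) * (kappa * expR e / (kappa + expR e) ^+ 2).
    apply: mulr_ge0 => //; apply: divr_ge0; last exact: sqr_ge0.
    by apply: mulr_ge0; exact: ltW.
  rewrite normrM (ger0_norm h0) ler_piMr // normrM normfV (gtr0_norm de).
  rewrite ler_pdivrMr // mul1r ler_norml; apply/andP; split; lra.
Qed.

End ModelBounds.

(** * Nets for quadratic and cubic forms *)

Section Net.
Context {R : realType}.

(** A grid of mesh 1 / N in the cube [-1, 1] ^ q; its points are indexed by a
    finite type for the sake of union bounds. *)
Definition gridpt q N (g : {ffun 'I_q -> 'I_(2 * N).+1}) : 'cV[R]_q :=
  \col_i (((g i)%:R - N%:R) / N%:R).

Lemma grid_cover q Q (u : 'cV[R]_q) : (q <= Q)%N -> (0 < Q)%N ->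
  enorm u <= 1 ->
  exists g : {ffun 'I_q -> 'I_(2 * (4 * Q)).+1}, enorm (u - gridpt g) <= 4^-1.
Proof.
move=> qQ Q0 u1; pose N := (4 * Q)%N.
have N0 : (0 : R) < N%:R by rewrite ltr0n muln_gt0.
have ui i : 0 <= (u i 0 + 1) * N%:R <= (2 * N)%:R.
  have := le_trans (ler_coord_enorm u i) u1; rewrite ler_norml => /andP[h1 h2].
  rewrite mulr_ge0 ?(ltW N0) //=; last by lra.
  by rewrite natrM ler_wpM2r ?(ltW N0) //; lra.
have jP i : exists j : 'I_(2 * N).+1,
    `|u i 0 - (j%:R - N%:R) / N%:R| <= N%:R^-1.
  have /andP[h1 h2] := ui i; have /andP[t1 t2] := truncn_itv h1.
  set j := Num.Def.trunc _ in t1 t2.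
  have jN : (j < (2 * N).+1)%N by rewrite ltnS -(ler_nat R) (le_trans t1).
  exists (Ordinal jN) => /=.
  rewrite (_ : _ - _ = ((u i 0 + 1) * N%:R - j%:R) / N%:R); last first.
    by field; exact: lt0r_neq0.
  rewrite normrM normfV (gtr0_norm N0) ler_piMl ?invr_ge0 ?(ltW N0) //.
  rewrite ler_norml; move: t2; rewrite -natr1 => t2; apply/andP; split; lra.
pose g := [ffun i => xchoose (jP i)]; exists g.
have : forall i, `|(u - gridpt g) i 0| <= N%:R^-1.
  by move=> i; rewrite !mxE ffunE; exact: xchooseP (jP i).
move=> /(enorm_le_bound (ltW _)) -/(_ _); rewrite ?invr_gt0 // => /(_ N0) h.
apply: (le_trans h); rewrite ler_pdivrMr // /N natrM mulrA mulVf ?mul1r ?pnatr_eq0 //.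
rewrite -(@ler_sqr R) ?nnegrE ?sqrtr_ge0 ?ler0n // sqr_sqrtr ?ler0n //.
rewrite -natrX ler_nat (leq_trans qQ) // -{1}(expn1 Q) leq_pexp2l //.
Qed.

Lemma enorm_normalize q (u : 'cV[R]_q) : u != 0 ->
  enorm ((enorm u)^-1 *: u) = 1.
Proof.
rewrite -enorm_gt0 => u0; rewrite enormZ gtr0_norm ?invr_gt0 //.
by rewrite mulVf // gt_eqF.
Qed.

Lemma norm_near_ball q (u g : 'cV[R]_q) :
  enorm u <= 1 -> enorm (u - g) <= 4^-1 -> enorm g <= 5 / 4.
Proof.
move=> u1 ug; rewrite (_ : g = u - (u - g)); last by rewrite opprB addrC subrK.
by apply: (le_trans (enormD _ _)); rewrite enormN; lra.
Qed.

(** At a maximizer u of the absolute form over the unit ball, with nearest grid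
    point g, the form at u is that at g plus the polar form at u - g and u + g,
    which is at most 9 / 16 of the maximum. *)
Lemma quad_form_net q Q (A : 'M[R]_q) (tau : R) :
  (q <= Q)%N -> (0 < Q)%N -> A^T = A ->
  (forall g : {ffun 'I_q -> 'I_(2 * (4 * Q)).+1}, enorm (gridpt g) <= 5 / 4 ->
     `|dotv (gridpt g) (A *m gridpt g)| <= tau) ->
  forall u, `|dotv u (A *m u)| <= 3 * tau * dotv u u.
Proof.
move=> qQ Q0 sA H.
pose f (u : 'cV[R]_q) := `|dotv u (A *m u)|.
have fc : continuous f.
  move=> u; apply: (@continuous_comp _ _ _ (fun u => dotv u (A *m u)) Num.norm).
    exact: continuous_dotv2.
  exact: norm_continuous.
have [||v vD vmax] := @compact_EVT_max _ R f _ _ (@compact_enorm_ball R q 1).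
- by exists 0; rewrite /= enorm0.
- exact: continuous_subspaceT.
have v1 : enorm v <= 1 by rewrite inE in vD.
have {}vmax u : `|dotv u (A *m u)| <= f v * dotv u u.
  have [->|u0] := eqVneq u 0; first by rewrite dot0v normr0 dotv0 mulr0.
  have uu : 0 < enorm u by rewrite enorm_gt0.
  have := vmax ((enorm u)^-1 *: u); rewrite inE /= enorm_normalize // => /(_ (lexx _)).
  rewrite {1}/f -scalemxAr dotvZl dotvZr mulrA -expr2 normrM ger0_norm ?sqr_ge0 //.
  by rewrite exprVn mulrC ler_pdivrMr ?exprn_gt0 // sqr_enorm.
have off := sym_form_bound sA vmax.
have [g vg] := grid_cover qQ Q0 v1; have g1 := norm_near_ball v1 vg.
have e : dotv v (A *m v) = dotv (gridpt g) (A *m gridpt g) +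
    dotv (v - gridpt g) (A *m (v + gridpt g)).
  rewrite mulmxDr dotvDr !(dotvC (v - _)) !dotvBr !(dotvC (A *m _)).
  by rewrite (dotv_sym _ v sA); ring.
have fv0 : 0 <= f v by exact: normr_ge0.
have h : f v <= tau + 9 / 16 * f v.
  rewrite {1}/f e (le_trans (ler_normD _ _)) // lerD ?H //.
  apply: (le_trans (cauchy_schwarz _ _)).
  apply: (@le_trans _ _ (4^-1 * (f v * (9 / 4)))); last by lra.
  apply: ler_pM; rewrite ?enorm_ge0 //.
  apply: (le_trans (off _)); rewrite ler_wpM2l //.
  by apply: (le_trans (enormD _ _)); lra.
move=> u; apply: (le_trans (vmax u)); rewrite ler_wpM2r ?dotvv_ge0 //; lra.
Qed.

Lemma cube_normD (a b : R) :
  `|a + b| ^+ 3 <= 4 * (`|a| ^+ 3 + `|b| ^+ 3).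
Proof.
apply: (@le_trans _ _ ((`|a| + `|b|) ^+ 3)).
  by rewrite lerXn2r ?nnegrE ?addr_ge0 // ler_normD.
have a0 := normr_ge0 a; have b0 := normr_ge0 b.
set x := `|a| in a0 *; set y := `|b| in b0 *.
rewrite -subr_ge0 (_ : _ - _ = 3 * ((x + y) * (x - y) ^+ 2)); last by ring.
by rewrite mulr_ge0 // mulr_ge0 ?addr_ge0 ?sqr_ge0.
Qed.

(** By convexity of the cube the value at a maximizer v is at most four times the
    sum of the values at its nearest grid point g and at v - g, and the latter
    is at most 1 / 64 of the maximum. *)
Lemma cubic_form_net n q Q (x : 'I_n -> 'cV[R]_q) (W : 'I_n -> R) (tau : R) :
  (q <= Q)%N -> (0 < Q)%N -> (forall i, 0 <= W i) ->
  (forall g : {ffun 'I_q -> 'I_(2 * (4 * Q)).+1}, enorm (gridpt g) <= 5 / 4 ->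
     \sum_i W i * `|dotv (x i) (gridpt g)| ^+ 3 <= tau) ->
  forall u, \sum_i W i * `|dotv (x i) u| ^+ 3 <= 5 * tau * enorm u ^+ 3.
Proof.
move=> qQ Q0 W0 H.
pose f (u : 'cV[R]_q) := \sum_i W i * `|dotv (x i) u| ^+ 3.
have f0 u : 0 <= f u.
  by apply: sumr_ge0 => i _; rewrite mulr_ge0 // exprn_ge0.
have fZ a u : f (a *: u) = `|a| ^+ 3 * f u.
  rewrite /f big_distrr /=; apply: eq_bigr => i _.
  by rewrite dotvZr normrM exprMn; ring.
have cc : continuous (fun t : R => `|t| ^+ 3).
  have nc : continuous (fun t : R => `|t|) by exact: norm_continuous.
  by move=> t; apply: (continuousM (nc t) (continuousM (nc t) (nc t))).
have fc : continuous f.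
  apply: continuous_sumr => i v; apply: (@continuous_comp _ _ _ (dotv (x i))
    (fun t => W i * `|t| ^+ 3)); first exact: continuous_dotv.
  apply: continuousM; first exact: cst_continuous.
  exact: cc.
have [||v vD vmax] := @compact_EVT_max _ R f _ _ (@compact_enorm_ball R q 1).
- by exists 0; rewrite /= enorm0.
- exact: continuous_subspaceT.
have v1 : enorm v <= 1 by rewrite inE in vD.
have {}vmax u : f u <= f v * enorm u ^+ 3.
  have [->|u0] := eqVneq u 0.
    rewrite enorm0 expr0n mulr0 /f big1 // => i _.
    by rewrite dotv0 normr0 expr0n mulr0.
  have uu : 0 < enorm u by rewrite enorm_gt0.
  have := vmax ((enorm u)^-1 *: u); rewrite inE /= enorm_normalize // => /(_ (lexx _)).
  rewrite fZ ger0_norm ?invr_ge0 ?(ltW uu) // exprVn mulrC.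
  by rewrite ler_pdivrMr ?exprn_gt0.
have [g vg] := grid_cover qQ Q0 v1; have g1 := norm_near_ball v1 vg.
have h : f v <= 4 * (tau + (4^-1) ^+ 3 * f v).
  apply: (@le_trans _ _ (4 * (f (gridpt g) + f (v - gridpt g)))).
    rewrite /f -big_split big_distrr /=; apply: ler_sum => i _.
    rewrite -mulrDr [leRHS]mulrCA ler_wpM2l //.
    have vE : v = gridpt g + (v - gridpt g) by rewrite addrC subrK.
    by rewrite {1}vE dotvDr; exact: cube_normD.
  rewrite ler_wpM2l // lerD ?H // (le_trans (vmax _)) // mulrC ler_wpM2r //.
  by rewrite lerXn2r ?nnegrE ?enorm_ge0 ?invr_ge0.
move=> u; apply: (le_trans (vmax u)); rewrite ler_wpM2r ?exprn_ge0 ?enorm_ge0 //.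
have : (4^-1) ^+ 3 = 64^-1 :> R by rewrite exprVn -natrX.
move: h => /[swap] ->; have := f0 v; lra.
Qed.

End Net.

(** * Deterministic analysis near the truth *)

Section PerturbedInformation.
Context {R : realType} (n q : nat) (x : 'I_n -> 'cV[R]_q) (b0 : 'cV[R]_q).
Variables (g g1 a : 'I_n -> R -> R) (w V : 'I_n -> R) (mu theta zeta nuV r : R).

Let e i := dotv (x i) b0.
Let F := gram x w.
Let nF u := enorm (sqrtmx F *m u).
Let J v := gram x (fun i => a i (dotv (x i) v)).

Hypothesis pF : posdef F.
Hypothesis V0 : forall i, 0 <= V i.
Hypothesis lipV : forall i t1 t2, `|t1 - e i| <= 1 -> `|t2 - e i| <= 1 ->
  `|a i t2 - a i t1| <= `|t2 - t1| * V i.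
Hypothesis mu0 : 0 <= mu.
Hypothesis theta0 : 0 <= theta.
Hypothesis zeta0 : 0 <= zeta.
Hypothesis cubic : forall u, \sum_i V i * `|dotv (x i) u| ^+ 3 <= mu * nF u ^+ 3.
Hypothesis quad :
  forall u, `|\sum_i (a i (e i) - w i) * dotv (x i) u ^+ 2| <= theta * nF u ^+ 2.
Hypothesis supx : forall i u, `|dotv (x i) u| <= zeta * nF u.
Hypothesis zr : zeta * r <= 1.

Let nFE u : nF u ^+ 2 = dotv u (F *m u).
Proof. by rewrite /nF enorm_sqrtmx //; exact: posdef_psd. Qed.

Let nF0 u : 0 <= nF u. Proof. exact: enorm_ge0. Qed.

Let nFD u v : nF (u + v) <= nF u + nF v.
Proof. by rewrite /nF mulmxDr enormD. Qed.

(** Hoelder's inequality with exponents 3 and 3 / 2, in the crude form needed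
    here: after normalization, c d ^ 2 <= c ^ 3 + d ^ 3. *)
Lemma trilinear_bound h u :
  \sum_i V i * `|dotv (x i) h| * dotv (x i) u ^+ 2 <= 2 * mu * nF h * nF u ^+ 2.
Proof.
have zero (c : 'I_n -> R) : (forall i, c i = 0) ->
    \sum_i c i <= 2 * mu * nF h * nF u ^+ 2.
  by move=> c0; rewrite big1 // mulr_ge0 ?exprn_ge0 // !mulr_ge0.
have [h0|h0] := eqVneq (nF h) 0.
  apply: zero => i; have := supx i h; rewrite h0 mulr0 normr_le0 => /eqP ->.
  by rewrite normr0 mulr0 mul0r.
have [u0|u0] := eqVneq (nF u) 0.
  apply: zero => i; have := supx i u; rewrite u0 mulr0 normr_le0 => /eqP ->.
  by rewrite expr0n mulr0.
have hp : 0 < nF h by rewrite lt_def h0 nF0.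
have up : 0 < nF u by rewrite lt_def u0 nF0.
have key (c d : R) : 0 <= c -> 0 <= d -> c * d ^+ 2 <= c ^+ 3 + d ^+ 3.
  move=> c0 d0; have [cd|dc] := leP c d.
    rewrite ler_wpDl ?exprn_ge0 // [leRHS]exprS.
    by rewrite ler_wpM2r ?sqr_ge0.
  rewrite ler_wpDr ?exprn_ge0 // [leRHS]exprS ler_wpM2l //.
  by rewrite ler_sqr ?nnegrE // ltW.
apply: (@le_trans _ _ (nF h * nF u ^+ 2 * (\sum_i (V i * `|dotv (x i) h| ^+ 3) / nF h ^+ 3
    + \sum_i (V i * `|dotv (x i) u| ^+ 3) / nF u ^+ 3))).
  rewrite -big_split big_distrr /=; apply: ler_sum => i _.
  have := key (`|dotv (x i) h| / nF h) (`|dotv (x i) u| / nF u)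
    (divr_ge0 (normr_ge0 _) (nF0 _)) (divr_ge0 (normr_ge0 _) (nF0 _)).
  rewrite -(real_normK (num_real (dotv (x i) u))).
  move: (`|dotv (x i) h|) (`|dotv (x i) u|) => c d H.
  have VV : 0 <= V i * (nF h * nF u ^+ 2) by rewrite !mulr_ge0 ?exprn_ge0.
  have := ler_wpM2l VV H.
  rewrite (_ : V i * (nF h * nF u ^+ 2) * (c / nF h * (d / nF u) ^+ 2) =
     V i * c * d ^+ 2); last by field; rewrite h0 u0.
  move=> /le_trans; apply; rewrite le_eqVlt; apply/orP; left; apply/eqP.
  by rewrite !exprMn !exprVn; ring.
rewrite -!mulr_suml (_ : 2 * mu * _ * _ = nF h * nF u ^+ 2 * (mu + mu)); last by ring.
rewrite ler_wpM2l ?mulr_ge0 ?exprn_ge0 // lerD // ler_pdivrMr ?exprn_gt0 //.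
Qed.

Lemma info_diff_form v1 v2 u : nF (v1 - b0) <= r -> nF (v2 - b0) <= r ->
  `|dotv u ((J v2 - J v1) *m u)| <= 2 * mu * nF (v2 - v1) * nF u ^+ 2.
Proof.
move=> h1 h2; rewrite /J gramB gram_quad.
apply: le_trans (trilinear_bound (v2 - v1) u).
apply: (le_trans (ler_norm_sum _ _ _)); apply: ler_sum => i _.
rewrite normrM (ger0_norm (sqr_ge0 _)) ler_wpM2r ?sqr_ge0 // mulrC.
have near v : nF (v - b0) <= r -> `|dotv (x i) v - e i| <= 1.
  move=> hv; rewrite /e -dotvBr (le_trans (supx _ _)) //.
  by apply: le_trans zr; rewrite ler_wpM2l.
by rewrite dotvBr; apply: lipV; exact: near.
Qed.

Lemma info_form h u : nF h <= r ->
  `|dotv u ((J (b0 + h) - F) *m u)| <= (2 * mu * nF h + theta) * nF u ^+ 2.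
Proof.
move=> hr; have -> : J (b0 + h) - F = (J (b0 + h) - J b0) + (J b0 - F).
  by rewrite addrA subrK.
rewrite mulmxDl dotvDr (le_trans (ler_normD _ _)) // mulrDl lerD //.
  have r0 : 0 <= r by apply: le_trans hr.
  have := @info_diff_form b0 (b0 + h) u.
  rewrite subrr addrAC subrr add0r {1}/nF mulmx0 enorm0; exact.
by rewrite /J /F gramB gram_quad; exact: quad.
Qed.

(** The change of the observed information over the ball is measured by the cubic
    form and costs 2 mu r; its fluctuation at the truth costs theta. *)
Lemma opnorm_info h : nF h <= r ->
  opnorm (invsqrtmx F *m (J (b0 + h) - F) *m invsqrtmx F) <= 2 * mu * r + theta.
Proof.
move=> hr; have r0 : 0 <= r by apply: le_trans hr.
apply: opnorm_conj_le => //.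
- by rewrite linearB /= !gram_sym.
- by rewrite addr_ge0 // !mulr_ge0.
move=> u; rewrite -nFE (le_trans (info_form u hr)) // ler_wpM2r ?exprn_ge0 //.
by rewrite lerD2r ler_wpM2l // mulr_ge0.
Qed.

Section Estimator.
Variable rho : R.
Hypothesis gd : forall i (t : R), is_derive t 1 (g i) (g1 i t).
Hypothesis g1d : forall i (t : R), is_derive t 1 (g1 i) (- a i t).
Hypothesis a0 : forall i t, 0 <= a i t.
Hypothesis rho0 : 0 < rho.
Hypothesis rho_r : rho <= r / 2.
Hypothesis small : 2 * mu * r + theta <= 4^-1.
Hypothesis Vquad : forall u, \sum_i V i * dotv (x i) u ^+ 2 <= nuV * nF u ^+ 2.
Hypothesis zrho : zeta * rho * nuV <= 4^-1.
Hypothesis score_le :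
  forall u, \sum_i g1 i (e i) * dotv (x i) u <= rho / 5 * nF u.

Let f v := \sum_i g i (dotv (x i) v).

Let r0 : 0 < r. Proof. by move: rho0 rho_r; lra. Qed.

(** In coordinates whitened by F the curvature stays above one half on the ball of
    radius rho, and the score is at most rho / 5 there. *)
Lemma maximizer_in_ball : exists2 v, nF (v - b0) <= rho & unique_maximizer f v.
Proof.
have [sB BS SB BF] := invsqrtmxP pF.
pose z i := invsqrtmx F *m x i.
have zE i h : dotv (z i) h = dotv (x i) (invsqrtmx F *m h).
  by rewrite dotv_mx sB.
have nB h : nF (invsqrtmx F *m h) = enorm h by rewrite /nF mulmxA SB mul1mx.
have nB2 h : nF (invsqrtmx F *m h) ^+ 2 = dotv h h by rewrite nB sqr_enorm.
pose m i := a i (e i) - zeta * rho * V i.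
have [||||h hr hmax] := @unique_maximizer_ball R n q z g g1 a e m rho
    (zeta * rho) gd g1d a0 rho0.
- move=> h hr i; rewrite zE (le_trans (supx _ _)) // nB ler_wpM2l //.
- move=> i t te; rewrite /m lerBlDr -lerBlDl.
  have zr1 : zeta * rho <= 1.
    apply: le_trans zr; rewrite ler_wpM2l //; move: rho_r r0; lra.
  have := @lipV i (e i) t; rewrite subrr normr0 ler01 => /(_ isT).
  move=> /(_ (le_trans te zr1)) h; rewrite distrC in h.
  apply: (le_trans (ler_norm _)); apply: (le_trans h).
  by rewrite ler_wpM2r.
- move=> u; set v := invsqrtmx F *m u.
  have -> : \sum_i m i * dotv (z i) u ^+ 2 =
      \sum_i (a i (e i) - w i) * dotv (x i) v ^+ 2 + dotv v (F *m v)
      - zeta * rho * \sum_i V i * dotv (x i) v ^+ 2.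
    rewrite /F gram_quad big_distrr -big_split -sumrB /=.
    by apply: eq_bigr => i _; rewrite zE -/v /m; ring.
  rewrite -nFE -(nB2 u) -/v.
  have h1 := quad v; rewrite ler_norml in h1; case/andP: h1 => h1 _.
  have zz : 0 <= zeta * rho by rewrite mulr_ge0 // ltW.
  have h2 := ler_wpM2l zz (Vquad v).
  have h3 : zeta * rho * (nuV * nF v ^+ 2) <= 4^-1 * nF v ^+ 2.
    by rewrite mulrA ler_wpM2r ?exprn_ge0.
  have h4 : theta * nF v ^+ 2 <= 4^-1 * nF v ^+ 2.
    rewrite ler_wpM2r ?exprn_ge0 //; apply: le_trans small.
    by rewrite lerDr !mulr_ge0 // ltW.
  by move: h1 h2 h3 h4; set A := \sum_i _; set B := \sum_i _; set N := nF v ^+ 2; lra.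
- move=> u; have := score_le (invsqrtmx F *m u); rewrite nB.
  by under eq_bigr => i _ do rewrite -zE.
exists (b0 + invsqrtmx F *m h).
  by rewrite addrAC subrr add0r nB ltW.
have fE u : f u = \sum_i g i (e i + dotv (z i) (sqrtmx F *m (u - b0))).
  apply: eq_bigr => i _; rewrite zE mulmxA BS mul1mx -dotvDr.
  by rewrite addrC subrK.
move=> v vE; rewrite !fE addrAC subrr add0r mulmxA SB mul1mx; apply: hmax.
apply: contra_neq vE => <-.
by rewrite mulmxA BS mul1mx addrC subrK.
Qed.

Variable v : 'cV[R]_q.
Hypothesis vrho : nF (v - b0) <= rho.

Let Jlow u : nF u ^+ 2 / 2 <= dotv u (J v *m u).
Proof.
have vr : nF (v - b0) <= r by apply: le_trans vrho _; move: rho_r r0; lra.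
have := info_form u vr; rewrite (addrC b0) subrK mulmxBl dotvBr -nFE ler_norml.
move=> /andP[h _].
have : (2 * mu * nF (v - b0) + theta) * nF u ^+ 2 <= 4^-1 * nF u ^+ 2.
  rewrite ler_wpM2r ?exprn_ge0 //; apply: le_trans small.
  by rewrite lerD2r ler_wpM2l // mulr_ge0.
have : 0 <= nF u ^+ 2 by rewrite exprn_ge0.
by move: h; set N := nF u ^+ 2; lra.
Qed.

Lemma posdef_info : posdef (J v).
Proof.
split; first exact: gram_sym.
move=> u u0; apply: lt_le_trans (Jlow u).
by rewrite divr_gt0 // nFE; case: pF => _; apply.
Qed.

(** At v the observed information dominates F / 2, so that norms and forms
    measured by F can be measured by J at the cost of a constant. *)
Lemma opnorm_info_diff u : 0 < enorm (sqrtmx (J v) *m u) ->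
  enorm (sqrtmx (J v) *m u) <= r / 4 ->
  opnorm (invsqrtmx (J v) *m (J (v + u) - J v) *m invsqrtmx (J v))
    / enorm (sqrtmx (J v) *m u) <= 8 * mu.
Proof.
have pJ := posdef_info; set N := enorm _ => N0 Nr.
have NE : N ^+ 2 = dotv u (J v *m u) by rewrite /N enorm_sqrtmx //; exact: posdef_psd.
have uN : nF u <= 2 * N.
  rewrite -ler_sqr ?nnegrE ?mulr_ge0 ?(ltW N0) //.
  have := Jlow u; rewrite -NE exprMn; have : 0 <= N ^+ 2 by rewrite exprn_ge0 // ltW.
  lra.
rewrite ler_pdivrMr //; apply: opnorm_conj_le => //.
- by rewrite linearB /= !gram_sym.
- by rewrite !mulr_ge0 // ltW.
move=> t; have h1 : nF (v - b0) <= r by apply: le_trans vrho _; move: rho_r r0; lra.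
have h2 : nF (v + u - b0) <= r.
  rewrite addrAC (le_trans (nFD _ _)) //; move: vrho rho_r uN Nr; lra.
apply: (le_trans (info_diff_form t h1 h2)); rewrite addrAC subrr add0r.
have Jt := Jlow t.
apply: (@le_trans _ _ (2 * mu * (2 * N) * (2 * dotv t (J v *m t)))); last first.
  by rewrite le_eqVlt; apply/orP; left; apply/eqP; ring.
apply: ler_pM; rewrite ?exprn_ge0 //.
- by rewrite !mulr_ge0.
- by rewrite ler_wpM2l // mulr_ge0.
by move: Jt; lra.
Qed.

End Estimator.

End PerturbedInformation.

(** * From the model to weighted Gram matrices *)

Section Bridge.
Context {R : realType}.
Variables (m : glm R) (k : R -> R -> R) (n p : nat).
Variables (X : 'M[R]_(n, p)) (tau : 'I_n -> R).
Hypothesis ok : model_ok m.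

Definition predictor (S : {set 'I_p}) (i : 'I_n) : 'cV[R]_#|S| :=
  subvec S (row i X)^T.

Lemma predictorE S i l : predictor S i l 0 = X i (enum_val l).
Proof. by rewrite !mxE. Qed.

Lemma linpred_pad (S : {set 'I_p}) v i :
  linpred X (pad v) i = dotv (predictor S i) v.
Proof.
rewrite /linpred /pad mulmx_sumr summxE dotvE; apply: eq_bigr => l _.
by rewrite -scalemxAr mxE -colE mxE predictorE mulrC.
Qed.

Lemma pad_subvec (S : {set 'I_p}) (beta : 'cV[R]_p) : supp beta \subset S ->
  pad (subvec S beta) = beta.
Proof.
move=> sub; apply/matrixP => j j0; rewrite (ord1 j0) /pad summxE.
have [jS|jS] := boolP (j \in S).
  rewrite (bigD1 (enum_rank_in jS j)) //= !mxE enum_rankK_in // !eqxx mulr1.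
  rewrite big1 ?addr0 // => l lj; rewrite !mxE.
  case: eqP => [jl|_]; last by rewrite mulr0.
  by case/eqP: lj; apply: enum_val_inj; rewrite enum_rankK_in.
rewrite big1 => [|l _].
  apply/esym/eqP; apply: contraNT jS => bj.
  by have := fintype.subsetP sub j; rewrite inE; apply.
rewrite !mxE; case: eqP => [jl|_]; last by rewrite mulr0.
by move: jS; rewrite jl enum_valP.
Qed.

Lemma linpred_subvec (S : {set 'I_p}) beta i : supp beta \subset S ->
  dotv (predictor S i) (subvec S beta) = linpred X beta i.
Proof. by move=> sub; rewrite -linpred_pad pad_subvec. Qed.

Lemma loglikS_sum (S : {set 'I_p}) y :
  @loglikS R m k n p X tau S y =
  fun v => \sum_i obs_loglik m k (tau i) (y i) (dotv (predictor S i) v).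
Proof.
apply/funext => v; rewrite /loglikS /loglik; apply: eq_bigr => i _.
by rewrite linpred_pad.
Qed.

Lemma obs_infoE (S : {set 'I_p}) y v : obs_info m k X tau y v =
  gram (predictor S) (fun i => info m (tau i) (dotv (predictor S i) v) (y i)).
Proof.
rewrite /obs_info loglikS_sum.
rewrite (@hessian_sum R n #|S| (predictor S)
  (fun i => obs_loglik m k (tau i) (y i)) (fun i eta => score m (tau i) eta (y i))
  (fun i eta => info m (tau i) eta (y i))
  (fun i t => is_derive_obs_loglik k (tau i) (y i) t ok)
  (fun i t => is_derive_score (tau i) (y i) t ok)).
by rewrite opprK.
Qed.

Lemma fisherSE beta (S : {set 'I_p}) :
  fisherS m X tau beta S = gram (predictor S) (weight m X tau beta).
Proof.
apply/matrixP => a b; rewrite !mxE; apply: eq_bigr => i _.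
rewrite !predictorE !mxE (bigD1 i) //= !mxE eqxx mulr1n big1 ?addr0; last first.
  by move=> j ji; rewrite !mxE (negPf ji) mulr0n mulr0.
by rewrite (mulrC (X i _)).
Qed.

Lemma linpred_row beta i : dotv (row i X)^T beta = linpred X beta i.
Proof. by rewrite /linpred /dotv trmxK -row_mul mxE. Qed.

Lemma gradient_loglik y beta j : gradient (loglik m k X tau y) beta j 0 =
  \sum_i score m (tau i) (linpred X beta i) (y i) * X i j.
Proof.
have E : loglik m k X tau y = fun b =>
    \sum_i obs_loglik m k (tau i) (y i) (dotv (row i X)^T b).
  apply/funext => b; rewrite /loglik; apply: eq_bigr => i _.
  by rewrite linpred_row.
rewrite E (@gradient_sum R n p (fun i => (row i X)^T)
  (fun i => obs_loglik m k (tau i) (y i)) (fun i eta => score m (tau i) eta (y i))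
  (fun i t => is_derive_obs_loglik k (tau i) (y i) t ok)).
  rewrite mxE; apply: eq_bigr => i _; rewrite !mxE.
  by rewrite linpred_row.
Qed.

Lemma dotv_score (S : {set 'I_p}) y beta u (B : 'M[R]_#|S|) :
  dotv u (B *m subvec S (gradient (loglik m k X tau y) beta)) =
  \sum_i score m (tau i) (linpred X beta i) (y i) * dotv (B *m predictor S i) u.
Proof.
rewrite (_ : subvec S _ =
    \sum_i score m (tau i) (linpred X beta i) (y i) *: predictor S i); last first.
  apply/matrixP => a b; rewrite (ord1 b) mxE gradient_loglik summxE.
  by apply: eq_bigr => i _; rewrite [in RHS]mxE predictorE.
rewrite mulmx_sumr /dotv mulmx_sumr summxE; apply: eq_bigr => i _.
rewrite -!scalemxAr mxE; congr (_ * _).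
by rewrite -!/(dotv _ _) dotvC.
Qed.

Lemma concave_loglikS (S : {set 'I_p}) y : (forall i, 0 < tau i) ->
  (forall i, sample_space m (y i)) ->
  concave (@loglikS R m k n p X tau S y).
Proof.
move=> t0 sy; rewrite loglikS_sum.
apply: (@concave_sum R n _ (predictor S) (fun i => obs_loglik m k (tau i) (y i))
  (fun i eta => score m (tau i) eta (y i)) (fun i eta => info m (tau i) eta (y i))).
- by move=> i t; exact: is_derive_obs_loglik.
- by move=> i t; exact: is_derive_score.
by move=> i t; exact: info_ge0.
Qed.

End Bridge.

Lemma fisher_weight_ge0 {R : realType} m (t eta : R) : model_ok m -> 0 < t ->
  0 <= fisher_weight m t eta.
Proof.
move=> ok t0; rewrite fisher_weightE // divr_ge0 ?(ltW t0) //.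
apply: mulr_ge0; last exact: sqr_ge0.
move: (link m eta) (link_domain eta ok) => theta.
case: m ok => /= [||||| kappa] ok dom.
- exact: ler01.
- exact/ltW/expit_var_gt0.
- exact: expR_ge0.
- exact/ltW/expit_var_gt0.
- by rewrite invr_ge0 sqr_ge0.
- by rewrite divr_ge0 ?sqr_ge0 // mulr_ge0 ?expR_ge0 // ltW.
Qed.

Section Law.
Context {R : realType} (m : glm R) (nu : {measure set R -> \bar R}).
Variables (k : R -> R -> R) (n p : nat) (X : 'M[R]_(n, p)) (tau : 'I_n -> R).
Variables (beta0 : 'cV[R]_p) (d : measure_display) (T : measurableType d).
Variables (P : probability T R) (Y : 'I_n -> {RV P >-> R}).
Hypothesis ok : model_ok m.
Hypothesis tau0 : forall i, 0 < tau i.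
Hypothesis dens : forall i, density_family m nu k (tau i).
Hypothesis law : glm_law m nu k X tau beta0 Y.

Lemma ge0_integral_law i (h : R -> R) : measurable_fun setT h ->
  (forall y, 0 <= h y) ->
  (\int[P]_w (h (Y i w))%:E =
   \int[nu]_y (h y * glm_density m k (tau i) (linpred X beta0 i) y)%:E)%E.
Proof.
move=> mh h0; have [_ lawY] := law.
rewrite -(@ge0_integral_density_image R _ _ nu (distribution P (Y i)) id
  (glm_density m k (tau i) (linpred X beta0 i)) h) //.
- have mEh : measurable_fun setT (EFin \o h) by exact/measurable_EFinP.
  by rewrite ge0_integral_distribution // => y; rewrite lee_fin.
- exact: measurable_glm_density (dens i) _.
- by move=> y; exact: glm_density_ge0.
move=> A mA; apply: (etrans (lawY i A mA)); rewrite [LHS]integral_mkcond.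
apply: eq_integral => y _; rewrite patchE indicE /=.
by case: ifP => _; rewrite ?mul1r ?mul0r.
Qed.

Lemma sample_space_ae : exists A : set T, [/\ measurable A, P A = 1%E &
  forall w, A w -> forall i, sample_space m (Y i w)].
Proof.
have N i : exists N : set R, [/\ measurable N, ~` sample_space m `<=` N &
    P (Y i @^-1` N) = 0%E].
  have [[N [mN N0 sN]] _ _] := dens i.
  exists N; split => //; have [_ lawY] := law.
  have := lawY i N mN; rewrite /distribution /pushforward => ->.
  apply: null_set_integral => //.
  by apply/measurable_EFinP/measurable_funTS; exact: measurable_glm_density.
pose NN i := projT1 (cid (N i)).
have NNP i : [/\ measurable (NN i), ~` sample_space m `<=` NN i &
    P (Y i @^-1` NN i) = 0%E] := projT2 (cid (N i)).
have mY i : measurable (Y i @^-1` NN i).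
  by have [mN _ _] := NNP i; rewrite -[_ @^-1` _]setTI; exact: measurable_funP.
exists (\bigcap_(i in [set` [set: 'I_n]%SET]) (Y i @^-1` (~` NN i))); split.
- apply: fin_bigcap_measurable => // i _; rewrite preimage_setC.
  exact: measurableC (mY i).
- have [ind _] := law; rewrite ind => [|i]; last first.
    by have [mN _ _] := NNP i; exact: measurableC.
  rewrite big1 // => i _; rewrite preimage_setC (probability_setC _ (mY i)).
  by have [_ _ ->] := NNP i; rewrite sube0.
move=> w Aw i; have [_ sN _] := NNP i; apply: contrapT => h.
by have := Aw i; rewrite /= inE => /(_ isT); apply; apply: sN.
Qed.

(** By independence the cumulant generating functions of the scores add up. *)
Lemma mgf_scores (L D : R) (c : 'I_n -> R) :
  (forall i, eta_ok m L (linpred X beta0 i)) ->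
  (forall i, curv_const m L * `|c i| <= D) -> D < 1 ->
  exists2 M, (\int[P]_w (expR (\sum_i c i *
      score m (tau i) (linpred X beta0 i) (Y i w))%R)%:E = M%:E)%E &
    0 < M /\ M <= expR ((\sum_i weight m X tau beta0 i * c i ^+ 2) / (2 * (1 - D))).
Proof.
move=> ek cD D1; have [ind _] := law.
pose h i y := c i * score m (tau i) (linpred X beta0 i) y.
have mh i : measurable_fun setT (expR \o h i).
  apply: measurableT_comp => //; apply: measurable_funM => //.
  exact: measurable_score.
have cs i : curv_const m L * `|c i| < 1 by exact: le_lt_trans (cD i) D1.
pose M i := expR ((cumulant m (link m (linpred X beta0 i) + c i * dlink m (linpred X beta0 i))
  - cumulant m (link m (linpred X beta0 i))
  - c i * dlink m (linpred X beta0 i) * cum1 m (link m (linpred X beta0 i))) / tau i).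
have hM i : (\int[P]_w ((expR \o h i) (Y i w))%:E = (M i)%:E)%E.
  rewrite ge0_integral_law //; last by move=> y; exact: expR_ge0.
  apply: (mgf_score ok (tau0 i) (dens i)).
  by have [] := cum2_shift ok (ek i) (cs i).
have := integral_prod_independent ind mh (fun i y => expR_ge0 _) hM.
under eq_integral => w _ do rewrite /= -expR_sum.
move=> E; exists (\prod_i M i) => //; split.
  by apply: prodr_gt0 => i _; exact: expR_gt0.
rewrite /M -expR_sum ler_expR mulr_suml; apply: ler_sum => i _.
apply: (le_trans (cgf_score_le ok (ek i) (tau0 i) (cs i))).
have D0 : 0 < 2 * (1 - D) by rewrite mulr_gt0 // subr_gt0.
have D0' : 0 < 2 * (1 - curv_const m L * `|c i|) by rewrite mulr_gt0 // subr_gt0.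
have w0 : 0 <= fisher_weight m (tau i) (linpred X beta0 i) * c i ^+ 2.
  by rewrite mulr_ge0 ?sqr_ge0 // fisher_weight_ge0.
rewrite ler_wpM2l // lef_pV2 ?posrE // ler_pM2l // lerB //; exact: cD.
Qed.

Let lin_scale (lam : R) (c s : 'I_n -> R) :
  \sum_i lam * c i * s i = lam * \sum_i c i * s i.
Proof. by rewrite big_distrr /=; apply: eq_bigr => i _; rewrite mulrA. Qed.

(** With the curvature terms at most one half, the cumulant bound is at most twice
    the Gaussian one. *)
Lemma score_tail (L lam t V : R) (c : 'I_n -> R) :
  (forall i, eta_ok m L (linpred X beta0 i)) -> 0 < lam ->
  (forall i, curv_const m L * `|lam * c i| <= 2^-1) ->
  \sum_i weight m X tau beta0 i * c i ^+ 2 <= V ->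
  (P [set w | (t < \sum_i c i * score m (tau i) (linpred X beta0 i) (Y i w))%R]
    <= (expR (lam ^+ 2 * V - lam * t))%:E)%E.
Proof.
move=> ek lam0 cD cV; have [ind _] := law.
rewrite (_ : [set w | _] = [set w | (lam * t < \sum_i lam * c i *
    score m (tau i) (linpred X beta0 i) (Y i w))%R]); last first.
  apply/seteqP; split => w /=; rewrite (lin_scale lam c) ltr_pM2l //.
pose h i y := lam * c i * score m (tau i) (linpred X beta0 i) y.
apply: (@chernoff_independent R d T P n Y ind h
  (fun i => weight m X tau beta0 i * (lam * c i) ^+ 2)).
- by move=> i; apply: measurable_funM => //; exact: measurable_score.
- move=> i; have cs : curv_const m L * `|lam * c i| < 1.
    by apply: le_lt_trans (cD i) _; rewrite invf_lt1 // ltr1n.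
  have mh : measurable_fun setT (expR \o h i).
    apply: measurableT_comp => //; apply: measurable_funM => //.
    exact: measurable_score.
  have := ge0_integral_law i mh (fun y => expR_ge0 _).
  have [dom _] := cum2_shift ok (ek i) cs.
  rewrite (mgf_score ok (tau0 i) (dens i) dom) => E; eexists; first exact: E.
  rewrite ler_expR; apply: (le_trans (cgf_score_le ok (ek i) (tau0 i) cs)).
  have w0 : 0 <= weight m X tau beta0 i * (lam * c i) ^+ 2.
    by rewrite mulr_ge0 ?sqr_ge0 // fisher_weight_ge0.
  rewrite -[leRHS]mulr1 ler_wpM2l // invf_le1 ?mulr_gt0 ?subr_gt0 //.
  by have := cD i; lra.
rewrite lerD2r; under eq_bigr => i _ do rewrite exprMn mulrCA.
by rewrite -big_distrr /= ler_wpM2l // sqr_ge0.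
Qed.

Lemma rel_info_tail (cl K cB cW lam t V : R) (c : 'I_n -> R) :
  (forall i, info_regular m cl K cB cW (tau i) (linpred X beta0 i)) ->
  0 < lam -> 0 <= K -> (forall i, cB * `|lam * c i| <= 1) ->
  \sum_i c i ^+ 2 <= V ->
  (P [set w | (t < \sum_i c i * rel_info m (tau i) (linpred X beta0 i) (Y i w))%R]
    <= (expR (K * lam ^+ 2 * V - lam * t))%:E)%E.
Proof.
move=> reg lam0 K0 cD cV; have [ind _] := law.
rewrite (_ : [set w | _] = [set w | (lam * t < \sum_i lam * c i *
    rel_info m (tau i) (linpred X beta0 i) (Y i w))%R]); last first.
  apply/seteqP; split => w /=; rewrite (lin_scale lam c) ltr_pM2l //.
pose h i y := lam * c i * rel_info m (tau i) (linpred X beta0 i) y.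
have mh i : measurable_fun setT (h i).
  apply: measurable_funM => //; apply: measurable_funB => //.
  by apply: measurable_funM => //; exact: measurable_info.
apply: (@chernoff_independent R d T P n Y ind h (fun i => K * (lam * c i) ^+ 2)) => //.
- move=> i; have mE : measurable_fun setT (expR \o h i) by exact: measurableT_comp.
  have [_ _ _ mgf] := reg i.
  have [M ME MK] := mgf nu k (dens i) (lam * c i) (cD i).
  exists M => //; apply: etrans ME.
  exact: (ge0_integral_law i mE (fun y => expR_ge0 _)).
rewrite lerD2r; under eq_bigr => i _ do rewrite exprMn mulrA.
by rewrite -big_distrr /= ler_wpM2l // mulr_ge0 ?sqr_ge0.
Qed.

End Law.

(** * Union bounds and counting *)

Section UnionBound.
Context {R : realType} d (T : measurableType d) (P : probability T R).

Lemma union_bound (I : finType) (bad : I -> set T) (b : I -> R) (B : R) :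
  (forall j, measurable (bad j)) -> (forall j, (P (bad j) <= (b j)%:E)%E) ->
  \sum_j b j <= B ->
  exists A : set T, [/\ measurable A, ((1 - B)%:E <= P A)%E &
    forall w, A w -> forall j, ~ bad j w].
Proof.
move=> mb Pb bB; pose U := \big[setU/set0]_j bad j.
have mU : measurable U by apply: bigsetU_measurable => j _.
have PU (s : seq I) : (P (\big[setU/set0]_(j <- s) bad j) <= (\sum_(j <- s) b j)%:E)%E.
  elim: s => [|j s IH]; first by rewrite !big_nil measure0.
  rewrite !big_cons EFinD; apply: (le_trans (measureU2 _ _ _)).
  - exact: mb.
  - by apply: bigsetU_measurable => ? _.
  exact: (leeD (Pb j) IH).
exists (~` U); split; first exact: measurableC.
  rewrite probability_setC // EFinB leeB // (le_trans (PU _)) // lee_fin //.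
move=> w Uw j bj; apply: Uw; rewrite /U (bigD1 j) //=; by left.
Qed.

Lemma probability_inter_ge (A B : set T) (a b : R) :
  measurable A -> measurable B ->
  ((1 - a)%:E <= P A)%E -> ((1 - b)%:E <= P B)%E ->
  ((1 - (a + b))%:E <= P (A `&` B))%E.
Proof.
move=> mA mB PA PB.
have fA := fin_num_measure P A mA; have fB := fin_num_measure P B mB.
have mI : measurable (A `&` B) by exact: measurableI.
have fI := fin_num_measure P _ mI.
have : (P (~` (A `&` B)) <= P (~` A) + P (~` B))%E.
  by rewrite setCI; apply: measureU2; exact: measurableC.
rewrite !probability_setC //.
move: PA PB; rewrite -(fineK fA) -(fineK fB) -(fineK fI).
rewrite -!EFinB -EFinD !lee_fin; lra.
Qed.

Lemma measurable_gt_set (f : T -> R) (t : R) : measurable_fun setT f ->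
  measurable [set w | t < f w].
Proof.
move=> mf; rewrite (_ : [set _ | _] = setT `&` f @^-1` `]t, +oo[).
  exact: mf.
by apply/seteqP; split => w /=; rewrite in_itv /= andbT // => -[].
Qed.

End UnionBound.

Section Counting.

(** A set of at most q elements is listed by q slots, each holding an element or
    nothing. *)
Lemma card_small_sets p q :
  (#|[set S : {set 'I_p} | (#|S| <= q)%N]%SET| <= p.+1 ^ q)%N.
Proof.
pose dec (f : {ffun 'I_q -> option 'I_p}) : {set 'I_p} :=
  [set j | Some j \in codom f]%SET.
have sub : [set S : {set 'I_p} | (#|S| <= q)%N]%SET \subset
    [set dec f | f : {ffun 'I_q -> option 'I_p}]%SET.
  apply/fintype.subsetP => S; rewrite inE => Sq; apply/imsetP.
  pose f := [ffun k : 'I_q => omap enum_val (insub (val k) : option 'I_#|S|)].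
  exists f => //; apply/setP => j; rewrite inE.
  apply/idP/codomP => [jS|[k]].
    have kq : (enum_rank_in jS j < q)%N by exact: leq_trans (ltn_ord _) Sq.
    exists (Ordinal kq); rewrite ffunE /= insubT //=.
    move=> lt; apply: (congr1 Some); apply: (etrans (esym (enum_rankK_in jS jS))).
    by apply: (congr1 enum_val); apply: val_inj.
  rewrite ffunE; case: insubP => //= u _ _ [->]; exact: enum_valP.
apply: (leq_trans (subset_leq_card sub)); apply: (leq_trans (leq_imset_card _ _)).
by rewrite card_ffun card_option !card_ord.
Qed.

End Counting.

(** * Design conditions for one support *)

Section Design.
Context {R : realType} (m : glm R) (n p : nat) (X : 'M[R]_(n, p)).
Variables (tau : 'I_n -> R) (beta0 : 'cV[R]_p) (cF CF KX C : R) (S : {set 'I_p}).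
Hypothesis n0 : (0 < n)%N.
Hypothesis cF0 : 0 < cF.
Hypothesis cFCF : cF <= CF.
Hypothesis S0 : (0 < #|S|)%N.

Let F := fisherS m X tau beta0 S.
Let x := predictor X S.
Let w := weight m X tau beta0.
Let nF u := enorm (sqrtmx F *m u).

Hypothesis rmin : cF <= rho_min (n%:R^-1 *: F).
Hypothesis rmax : rho_max (n%:R^-1 *: F) <= CF.
Hypothesis XK : forall i j, `|X i j| <= KX.

Let nR : (0 : R) < n%:R. Proof. by rewrite ltr0n. Qed.

Let cFn : 0 < cF * n%:R. Proof. exact: mulr_gt0. Qed.

Let FT : F^T = F. Proof. by rewrite /F fisherSE gram_sym. Qed.

Let nFT : (n%:R^-1 *: F)^T = n%:R^-1 *: F. Proof. by rewrite linearZ /= FT. Qed.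

Let formE u : dotv u (F *m u) = n%:R * dotv u (n%:R^-1 *: F *m u).
Proof. by rewrite -scalemxAl dotvZr mulVKf // gt_eqF. Qed.

Lemma fisher_form_ge u : cF * n%:R * dotv u u <= dotv u (F *m u).
Proof.
rewrite formE -mulrA mulrCA ler_pM2l //.
apply: le_trans (rho_min_le u S0 nFT).
by rewrite ler_wpM2r ?dotvv_ge0.
Qed.

Lemma fisher_form_le u : dotv u (F *m u) <= CF * n%:R * dotv u u.
Proof.
rewrite formE -mulrA mulrCA ler_pM2l //.
apply: (le_trans (rho_max_ge u S0 nFT)).
by rewrite ler_wpM2r ?dotvv_ge0.
Qed.

Lemma posdef_fisher : posdef F.
Proof.
split=> // v v0; apply: lt_le_trans (fisher_form_ge v).
by rewrite mulr_gt0 // dotvv_gt0.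
Qed.

Let pF := posdef_fisher.

Lemma fisher_norm_ge u : Num.sqrt (cF * n%:R) * enorm u <= nF u.
Proof.
rewrite -ler_sqr ?nnegrE ?mulr_ge0 ?sqrtr_ge0 ?enorm_ge0 //.
rewrite enorm_sqrtmx; last exact: posdef_psd.
by rewrite exprMn sqr_sqrtr ?(ltW cFn) // sqr_enorm fisher_form_ge.
Qed.

Lemma fisher_norm_le u : nF u <= Num.sqrt (CF * n%:R) * enorm u.
Proof.
rewrite -ler_sqr ?nnegrE ?mulr_ge0 ?sqrtr_ge0 ?enorm_ge0 //.
rewrite enorm_sqrtmx; last exact: posdef_psd.
have CFn : 0 <= CF * n%:R by rewrite mulr_ge0 ?(ltW nR) // (le_trans (ltW cF0)).
by rewrite exprMn sqr_sqrtr // sqr_enorm fisher_form_le.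
Qed.

Lemma predictor_le Q i u : (#|S| <= Q)%N ->
  `|dotv (x i) u| <= KX * Num.sqrt Q%:R * enorm u.
Proof.
move=> SQ; apply: (le_trans (cauchy_schwarz _ _)).
rewrite ler_wpM2r ?enorm_ge0 //.
have KX0 : 0 <= KX.
  have /card_gt0P[j _] := S0; exact: le_trans (normr_ge0 _) (XK i j).
have h := @enorm_le_bound R #|S| (x i) KX KX0.
apply: (le_trans (h _)) => [l|]; first by rewrite /x predictorE.
by rewrite mulrC ler_wpM2l // ler_sqrt ?ler_nat.
Qed.

Lemma predictor_fisher_le Q i u : (#|S| <= Q)%N ->
  `|dotv (x i) u| <= KX * Num.sqrt (Q%:R / (cF * n%:R)) * nF u.
Proof.
move=> SQ; apply: (le_trans (predictor_le i u SQ)).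
have KX0 : 0 <= KX.
  have /card_gt0P[j _] := S0; exact: le_trans (normr_ge0 _) (XK i j).
rewrite -!mulrA ler_wpM2l // sqrtrM ?ler0n // -mulrA ler_wpM2l ?sqrtr_ge0 //.
by rewrite sqrtrV ?(ltW cFn) // ler_pdivlMl ?sqrtr_gt0 // fisher_norm_ge.
Qed.

Hypothesis moments : forall u : 'cV[R]_#|S|, enorm u = 1 ->
  \sum_i w i * `|dotv (zvec m X tau beta0 S i) u| ^+ 3 <= C / Num.sqrt n%:R /\
  \sum_i w i ^+ 2 * dotv (zvec m X tau beta0 S i) u ^+ 4 <= C / n%:R.

(** The moment conditions for standardized predictors and unit vectors, made
    homogeneous in the norm of the Fisher information. *)
Lemma moment_bounds u :
  \sum_i w i * `|dotv (x i) u| ^+ 3 <= C / Num.sqrt n%:R * nF u ^+ 3 /\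
  \sum_i w i ^+ 2 * dotv (x i) u ^+ 4 <= C / n%:R * nF u ^+ 4.
Proof.
have [N0|N0] := eqVneq (nF u) 0.
  have u0 : enorm u = 0.
    apply/eqP; rewrite eq_le enorm_ge0 andbT -(@pmulr_rle0 _ (Num.sqrt (cF * n%:R))).
      by rewrite -N0 fisher_norm_ge.
    by rewrite sqrtr_gt0.
  have -> : u = 0 by apply/eqP; rewrite -[_ == 0]negbK -enorm_gt0 u0 ltxx.
  rewrite /nF mulmx0 enorm0 !expr0n !mulr0.
  by split; rewrite big1 // => i _; rewrite dotv0 ?normr0 expr0n mulr0.
have N1 : 0 < nF u by rewrite lt_def N0 enorm_ge0.
have [sB BS SB _] := invsqrtmxP pF.
pose v := (nF u)^-1 *: (sqrtmx F *m u).
have v1 : enorm v = 1 by rewrite enormZ gtr0_norm ?invr_gt0 // mulVf.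
have zE i : dotv (zvec m X tau beta0 S i) v = (nF u)^-1 * dotv (x i) u.
  by rewrite /v dotvZr /zvec dotvC dotv_mx sB mulmxA BS mul1mx dotvC.
have [H H0] := moments v1; split.
  rewrite mulrC -ler_pdivrMl ?exprn_gt0 // -exprVn big_distrr /=.
  apply: le_trans H; apply: ler_sum => i _.
  by rewrite zE normrM exprMn mulrCA gtr0_norm ?invr_gt0.
rewrite mulrC -ler_pdivrMl ?exprn_gt0 // -exprVn big_distrr /=.
apply: le_trans H0; apply: ler_sum => i _.
rewrite zE; move: (w i) (dotv (x i) u) ((nF u)^-1) => a b c.
by rewrite exprMn (mulrCA (c ^+ 4)).
Qed.

End Design.

Section ScoreCumulants.
Context {R : realType} (m : glm R) (nu : {measure set R -> \bar R}).
Variables (k : R -> R -> R) (n p : nat) (X : 'M[R]_(n, p)) (tau : 'I_n -> R).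
Variables (beta0 : 'cV[R]_p) (d : measure_display) (T : measurableType d).
Variables (P : probability T R) (Y : 'I_n -> {RV P >-> R}).
Variables (cF KX L : R) (Q : nat) (S : {set 'I_p}).
Hypothesis ok : model_ok m.
Hypothesis tau0 : forall i, 0 < tau i.
Hypothesis dens : forall i, density_family m nu k (tau i).
Hypothesis law : glm_law m nu k X tau beta0 Y.
Hypothesis ek : forall i, eta_ok m L (linpred X beta0 i).
Hypothesis n0 : (0 < n)%N.
Hypothesis cF0 : 0 < cF.
Hypothesis S0 : (0 < #|S|)%N.
Hypothesis SQ : (#|S| <= Q)%N.
Hypothesis rmin : cF <= rho_min (n%:R^-1 *: fisherS m X tau beta0 S).
Hypothesis XK : forall i j, `|X i j| <= KX.

(** In standardized coordinates the weighted squares of the coefficients sum to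
    one, while each coefficient is at most of order (q / n) ^ (1 / 2): the
    former is the variance and the latter the Bernstein scale. *)
Lemma cgf_standardized_score (D lambda : R) u :
  D = curv_const m L * (KX * Num.sqrt (Q%:R / (cF * n%:R))) ->
  enorm u = 1 -> `|lambda| * D < 1 ->
  (lne ('E_P [fun omega => expR (lambda * dotv u
     (invsqrtmx (fisherS m X tau beta0 S) *m
       subvec S (gradient (loglik m k X tau (fun i => Y i omega)) beta0)))%R])
   <= (lambda ^+ 2 / (2 * (1 - `|lambda| * D)))%:E)%E.
Proof.
move=> DE u1 lD.
have pF := posdef_fisher n0 cF0 S0 rmin.
have [sB BS SB BF] := invsqrtmxP pF.
pose B := invsqrtmx (fisherS m X tau beta0 S).
have zE i : dotv (B *m predictor X S i) u = dotv (predictor X S i) (B *m u).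
  by rewrite [RHS]dotv_mx /B sB.
pose c i := lambda * dotv (B *m predictor X S i) u.
have cD i : curv_const m L * `|c i| <= `|lambda| * D.
  rewrite /c normrM mulrCA DE ler_wpM2l // ler_wpM2l ?curv_const_ge0 // zE.
  apply: (le_trans (predictor_fisher_le n0 cF0 S0 rmin XK i (B *m u) SQ)).
  by rewrite /B mulmxA SB mul1mx u1 mulr1.
have [M ME [M0 MD]] := mgf_scores ok tau0 dens law ek cD lD.
have -> : ('E_P [fun omega => expR (lambda * dotv u (B *m
       subvec S (gradient (loglik m k X tau (fun i => Y i omega)) beta0)))%R] = M%:E)%E.
  rewrite -ME unlock; apply: eq_integral => w _; rewrite dotv_score // big_distrr /=.
  congr (expR _)%:E; apply: eq_bigr => i _; rewrite /c; ring.
rewrite lne_EFin // lee_fin -(expRK (_ / _)) ler_ln ?posrE ?expR_gt0 //.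
apply: (le_trans MD); rewrite ler_expR ler_wpM2r //.
  by rewrite invr_ge0 mulr_ge0 // subr_ge0 ltW.
rewrite (_ : \sum_i _ = lambda ^+ 2) //.
have := BF u; rewrite -sqr_enorm u1 expr1n {2}fisherSE gram_quad => E.
rewrite -[RHS]mulr1 -E big_distrr /=; apply: eq_bigr => i _.
by rewrite /c zE exprMn mulrCA.
Qed.

End ScoreCumulants.

(** * Concentration of the observed information *)

Section InformationEvent.
Context {R : realType} (m : glm R) (nu : {measure set R -> \bar R}).
Variables (k : R -> R -> R) (n p : nat) (X : 'M[R]_(n, p)) (tau : 'I_n -> R).
Variables (beta0 : 'cV[R]_p) (d : measure_display) (T : measurableType d).
Variables (P : probability T R) (Y : 'I_n -> {RV P >-> R}).
Variables (cl K cB cW B V M e lam2 lam3 : R) (Q : nat) (S : {set 'I_p}).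
Hypothesis ok : model_ok m.
Hypothesis tau0 : forall i, 0 < tau i.
Hypothesis dens : forall i, density_family m nu k (tau i).
Hypothesis law : glm_law m nu k X tau beta0 Y.
Hypothesis SQ : (#|S| <= Q)%N.
Hypothesis Q0 : (0 < Q)%N.
Hypothesis K0 : 0 <= K.
Hypothesis cB0 : 0 <= cB.
Hypothesis lam20 : 0 < lam2.
Hypothesis lam30 : 0 < lam3.
Hypothesis lam2B : cW * B ^+ 2 * lam2 <= 1.
Hypothesis lam3B : cW * B ^+ 3 * lam3 <= 1.
Hypothesis reg :
  forall i, info_regular m cl K cB cW (tau i) (linpred X beta0 i).

Let x := predictor X S.
Let w := weight m X tau beta0.
Let inf i omega := info m (tau i) (linpred X beta0 i) (Y i omega).
Let rel i omega := rel_info m (tau i) (linpred X beta0 i) (Y i omega).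

Hypothesis xB : forall i g, enorm g <= 5 / 4 -> `|dotv (x i) g| <= B.
Hypothesis mom3 : forall g, enorm g <= 5 / 4 ->
  \sum_i w i * `|dotv (x i) g| ^+ 3 <= M.
Hypothesis mom4 : forall g, enorm g <= 5 / 4 ->
  \sum_i w i ^+ 2 * dotv (x i) g ^+ 4 <= V.

Let t2 := K * lam2 * V + e / lam2.
Let t3 := K * lam3 * (B ^+ 2 * V) + e / lam3.

Let w0 i : 0 < w i. Proof. by have [] := reg i. Qed.

Let infE i omega : inf i omega = w i + w i * rel i omega.
Proof.
have h := w0 i; rewrite /inf /rel /rel_info -/(w i) mulrBr mulr1 addrC subrK.
by rewrite mulrC divfK // gt_eqF.
Qed.

Let mrel c t : measurable [set omega | t < \sum_i (c i : R) * rel i omega].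
Proof.
apply: measurable_gt_set; apply: measurable_sum => i.
apply: measurable_funM => //; apply: measurable_funB => //.
apply: measurable_funM => //.
apply: (measurableT_comp (measurable_info _ _ _)) => //.
Qed.

Let tail lam b c W : 0 < lam -> cW * b * lam <= 1 ->
  (forall i, `|c i| <= w i * b) -> \sum_i c i ^+ 2 <= W ->
  (P [set omega | (K * lam * W + e / lam < \sum_i c i * rel i omega)%R]
    <= (expR (- e))%:E)%E.
Proof.
move=> lam0 lamb cb cW2.
have -> : - e = K * lam ^+ 2 * W - lam * (K * lam * W + e / lam).
  by field; rewrite gt_eqF.
apply: (rel_info_tail dens law _ reg) => // i.
have [_ h _ _] := reg i; apply: le_trans lamb.
rewrite normrM (gtr0_norm lam0) mulrCA mulrC ler_wpM2r ?(ltW lam0) //.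
apply: (@le_trans _ _ (cB * (w i * b))); first by rewrite ler_wpM2l.
have b0 : 0 <= b.
  by rewrite -(@pmulr_rge0 _ (w i)) //; exact: le_trans (normr_ge0 _) (cb i).
by rewrite mulrA ler_wpM2r.
Qed.

(** Bernstein's inequality holds at each point of a grid, and the net lemmas
    extend it to the whole space. *)
Lemma information_event : exists A : set T, [/\ measurable A,
  ((1 - ((8 * Q).+1 ^ #|S|)%:R * (3 * expR (- e)))%:E <= P A)%E &
  forall omega, A omega -> (forall i, sample_space m (Y i omega)) ->
    (forall u, `|\sum_i (inf i omega - w i) * dotv (x i) u ^+ 2| <=
       3 * t2 * dotv u u) /\
    (forall u, \sum_i inf i omega * `|dotv (x i) u| ^+ 3 <=
       5 * (M + t3) * enorm u ^+ 3)].
Proof.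
pose G := {ffun 'I_#|S| -> 'I_(2 * (4 * Q)).+1}.
pose q2 (g : G) i := w i * dotv (x i) (gridpt g) ^+ 2.
pose q3 (g : G) i := w i * `|dotv (x i) (gridpt g)| ^+ 3.
pose bad (g : G) := if enorm (gridpt g : 'cV[R]_#|S|) <= 5 / 4 then
  [set omega | t2 < \sum_i q2 g i * rel i omega] `|`
  [set omega | t2 < \sum_i - q2 g i * rel i omega] `|`
  [set omega | t3 < \sum_i q3 g i * rel i omega] else set0.
have mbad g : measurable (bad g).
  rewrite /bad; case: ifP => _ //; apply: measurableU; last exact: mrel.
  by apply: measurableU; exact: mrel.
have q2B g i : enorm (gridpt g : 'cV[R]_#|S|) <= 5 / 4 -> `|q2 g i| <= w i * B ^+ 2.
  move=> /xB h; rewrite /q2 ger0_norm; last first.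
    by apply: mulr_ge0; [exact/ltW/w0|exact: sqr_ge0].
  rewrite ler_pM2l; last exact: w0.
  rewrite -(real_normK (num_real (dotv _ _))) ler_sqr ?nnegrE //.
  exact: le_trans (normr_ge0 _) (h i).
have q3B g i : enorm (gridpt g : 'cV[R]_#|S|) <= 5 / 4 -> `|q3 g i| <= w i * B ^+ 3.
  move=> /xB h; rewrite /q3 ger0_norm; last first.
    by apply: mulr_ge0; [exact/ltW/w0|exact: exprn_ge0].
  rewrite ler_pM2l; last exact: w0.
  by apply: lerXn2r; rewrite ?nnegrE //; exact: le_trans (normr_ge0 _) (h i).
have q2V g : enorm (gridpt g : 'cV[R]_#|S|) <= 5 / 4 -> \sum_i q2 g i ^+ 2 <= V.
  move=> /mom4; apply: le_trans; apply: ler_sum => i _.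
  by rewrite /q2; move: (w i) (dotv _ _) => a b; rewrite exprMn -exprM.
have q3V g : enorm (gridpt g : 'cV[R]_#|S|) <= 5 / 4 ->
    \sum_i q3 g i ^+ 2 <= B ^+ 2 * V.
  move=> hg; have B0 := sqr_ge0 B.
  apply: le_trans (ler_wpM2l B0 (mom4 hg)); rewrite big_distrr /=.
  apply: ler_sum => i _; have := xB i hg; rewrite /q3.
  rewrite -(real_normK (num_real (w i))).
  move: (w i) (dotv _ _) => a b hb.
  rewrite (_ : b ^+ 4 = `|b| ^+ 4); last by rewrite -normrX ger0_norm // exprn_even_ge0.
  rewrite (_ : (_ * _) ^+ 2 = `|b| ^+ 2 * (a ^+ 2 * `|b| ^+ 4)); last by ring.
  rewrite real_normK ?num_real // ler_wpM2r //.
    by rewrite mulr_ge0 ?sqr_ge0 ?exprn_ge0.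
  by rewrite ler_sqr ?nnegrE // (le_trans (normr_ge0 _) hb).
have Pbad g : (P (bad g) <= (3 * expR (- e))%:E)%E.
  rewrite /bad; case: ifP => hg; last first.
    by rewrite measure0 lee_fin mulr_ge0 ?expR_ge0.
  have h1 := tail lam20 lam2B (fun i => q2B g i hg) (q2V g hg).
  have h2 : (P [set omega | (t2 < \sum_i - q2 g i * rel i omega)%R] <=
      (expR (- e))%:E)%E.
    apply: (tail lam20 lam2B) => [i|]; first by rewrite normrN; exact: q2B.
    by under eq_bigr => i _ do rewrite sqrrN; exact: q2V.
  have h3 := tail lam30 lam3B (fun i => q3B g i hg) (q3V g hg).
  have := leeD (leeD h1 h2) h3.
  rewrite -!EFinD (_ : _ + _ + _ = 3 * expR (- e)); last by ring.
  apply: le_trans; apply: (le_trans (measureU2 _ _ _)); [|exact: mrel|].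
    by apply: measurableU; exact: mrel.
  by apply: leeD => //; apply: measureU2; exact: mrel.
have [|A [mA PA Agood]] := union_bound (B := ((8 * Q).+1 ^ #|S|)%:R * (3 * expR (- e)))
  mbad Pbad.
  rewrite sumr_const card_ffun !card_ord -[X in X <= _]mulr_natl.
  by rewrite (_ : (2 * (4 * Q) = 8 * Q)%N) // mulnA.
exists A; split=> // omega Aomega sY.
have good g : enorm (gridpt g : 'cV[R]_#|S|) <= 5 / 4 ->
    `|\sum_i q2 g i * rel i omega| <= t2 /\ \sum_i q3 g i * rel i omega <= t3.
  move=> hg; have := Agood _ Aomega g; rewrite /bad hg => nb; split; last first.
    by rewrite leNgt; apply/negP => h; apply: nb; right.
  rewrite ler_norml; apply/andP; split; rewrite leNgt; apply/negP => h; apply: nb.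
    left; right => /=; under eq_bigr => i _ do rewrite mulNr.
    by rewrite sumrN ltrNr.
  by left; left.
split.
  have E u : \sum_i (inf i omega - w i) * dotv (x i) u ^+ 2 =
      dotv u (gram x (fun i => w i * rel i omega) *m u).
    rewrite gram_quad; apply: eq_bigr => i _.
    by rewrite infE addrAC subrr add0r.
  move=> u; rewrite E; apply: (quad_form_net SQ Q0); first exact: gram_sym.
  move=> g hg; rewrite gram_quad.
  under eq_bigr => i _ do rewrite mulrAC.
  by have [] := good g hg.
apply: (cubic_form_net SQ Q0) => [i|g hg]; first exact: info_ge0.
have -> : \sum_i inf i omega * `|dotv (x i) (gridpt g)| ^+ 3 =
    \sum_i w i * `|dotv (x i) (gridpt g)| ^+ 3 + \sum_i q3 g i * rel i omega.
  rewrite -big_split /=; apply: eq_bigr => i _; rewrite infE /q3.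
  by move: (w i) (rel _ _) (dotv _ _) => a b c; ring.
by apply: lerD; [exact: mom3|have [] := good g hg].
Qed.

End InformationEvent.

(** * Concentration of the score *)

Section ScoreEvent.
Context {R : realType} (m : glm R) (nu : {measure set R -> \bar R}).
Variables (k : R -> R -> R) (n p : nat) (X : 'M[R]_(n, p)) (tau : 'I_n -> R).
Variables (beta0 : 'cV[R]_p) (d : measure_display) (T : measurableType d).
Variables (P : probability T R) (Y : 'I_n -> {RV P >-> R}).
Variables (L zeta e : R) (S : {set 'I_p}).
Hypothesis ok : model_ok m.
Hypothesis tau0 : forall i, 0 < tau i.
Hypothesis dens : forall i, density_family m nu k (tau i).
Hypothesis law : glm_law m nu k X tau beta0 Y.
Hypothesis ek : forall i, eta_ok m L (linpred X beta0 i).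

Let F := fisherS m X tau beta0 S.
Let x := predictor X S.
Let nF u := enorm (sqrtmx F *m u).
Let sc i omega := score m (tau i) (linpred X beta0 i) (Y i omega).

Hypothesis pF : posdef F.
Hypothesis supx : forall i u, `|dotv (x i) u| <= zeta * nF u.
Hypothesis e0 : 0 < e.
Hypothesis small : curv_const m L * (Num.sqrt e * zeta) <= 2^-1.

(** Each standardized coordinate has unit variance, and is below 3 e ^ (1 / 2) in
    absolute value outside an event of probability at most 2 exp (- 2 e). *)
Lemma score_event : exists A : set T, [/\ measurable A,
  ((1 - #|S|%:R * (2 * expR (- (2 * e))))%:E <= P A)%E &
  forall omega, A omega -> forall u,
    \sum_i sc i omega * dotv (x i) u <= 3 * Num.sqrt (#|S|%:R * e) * nF u].
Proof.
have [sB BS SB BF] := invsqrtmxP pF.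
pose E l : 'cV[R]_#|S| := delta_mx l 0.
have E1 l : dotv (E l) (E l) = 1 by rewrite dotv_delta mxE !eqxx.
pose c l i := dotv (x i) (invsqrtmx F *m E l).
have cle l i : `|c l i| <= zeta.
  apply: (le_trans (supx _ _)).
  by rewrite /nF mulmxA SB mul1mx enorm_dotv E1 sqrtr1 mulr1.
have cV l : \sum_i weight m X tau beta0 i * c l i ^+ 2 <= 1.
  by rewrite -gram_quad -fisherSE BF E1.
have msc a t : measurable [set omega | t < \sum_i (a i : R) * sc i omega].
  apply: measurable_gt_set; apply: measurable_sum => i.
  apply: measurable_funM => //.
  exact: (measurableT_comp (measurable_score _ _ _)).
have se : 0 < Num.sqrt e by rewrite sqrtr_gt0.
have tail (a : 'I_n -> R) : (forall i, `|a i| <= zeta) ->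
    \sum_i weight m X tau beta0 i * a i ^+ 2 <= 1 ->
    (P [set omega | (3 * Num.sqrt e < \sum_i a i * sc i omega)%R]
      <= (expR (- (2 * e)))%:E)%E.
  move=> az aV; rewrite (_ : - (2 * e) = Num.sqrt e ^+ 2 * 1 -
      Num.sqrt e * (3 * Num.sqrt e)); last first.
    by rewrite mulrCA -expr2 sqr_sqrtr ?(ltW e0) //; ring.
  apply: (score_tail ok tau0 dens law _ ek se) => // i.
  apply: le_trans small; rewrite normrM gtr0_norm // ler_wpM2l ?curv_const_ge0 //.
  by rewrite ler_wpM2l ?(ltW se).
pose bad l := [set omega | 3 * Num.sqrt e < \sum_i c l i * sc i omega] `|`
  [set omega | 3 * Num.sqrt e < \sum_i - c l i * sc i omega].
have mbad l : measurable (bad l) by apply: measurableU; exact: msc.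
have Pbad l : (P (bad l) <= (2 * expR (- (2 * e)))%:E)%E.
  have h1 := tail (c l) (cle l) (cV l).
  have h2 : (P [set omega | (3 * Num.sqrt e < \sum_i - c l i * sc i omega)%R]
      <= (expR (- (2 * e)))%:E)%E.
    apply: tail => [i|]; first by rewrite normrN.
    by under eq_bigr => i _ do rewrite sqrrN; exact: cV.
  have := leeD h1 h2; rewrite -EFinD (_ : _ + _ = 2 * expR (- (2 * e))); last by ring.
  by apply: le_trans; apply: measureU2; exact: msc.
have [|A [mA PA Agood]] :=
    union_bound (B := #|S|%:R * (2 * expR (- (2 * e)))) mbad Pbad.
  by rewrite sumr_const card_ord -[X in X <= _]mulr_natl.
exists A; split=> // omega Aomega u; pose v := sqrtmx F *m u.
pose g : 'cV[R]_#|S| := \col_l \sum_i c l i * sc i omega.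
have gle : enorm g <= Num.sqrt #|S|%:R * (3 * Num.sqrt e).
  apply: enorm_le_bound => [|l]; first by rewrite mulr_ge0 ?(ltW se).
  have nb := Agood _ Aomega l; rewrite mxE ler_norml.
  apply/andP; split; rewrite leNgt; apply/negP => h; apply: nb.
    right => /=; under eq_bigr => i _ do rewrite mulNr.
    by rewrite sumrN ltrNr.
  by left.
rewrite (_ : \sum_i _ = dotv g v).
  apply: (le_trans (ler_norm _)); apply: (le_trans (cauchy_schwarz _ _)).
  rewrite ler_wpM2r ?enorm_ge0 // (le_trans gle) //.
  by rewrite sqrtrM ?ler0n // mulrCA mulrA.
rewrite dotvE; under [RHS]eq_bigr => l _ do rewrite mxE big_distrl /=.
rewrite exchange_big /=; apply: eq_bigr => i _.
rewrite (_ : dotv (x i) u = dotv (invsqrtmx F *m x i) v); last first.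
  by rewrite [RHS]dotvC [RHS]dotv_mx sB mulmxA BS mul1mx dotvC.
rewrite dotvE big_distrr /=; apply: eq_bigr => l _.
rewrite /c dotv_mx sB dotv_delta.
by move: (sc _ _) (v _ _) => a b; ring.
Qed.

End ScoreEvent.

(** * Uniformity over supports *)

Section UnionOverSupports.
Context {R : realType} (m : glm R) (nu : {measure set R -> \bar R}).
Variables (k : R -> R -> R) (n p : nat) (X : 'M[R]_(n, p)) (tau : 'I_n -> R).
Variables (beta0 : 'cV[R]_p) (d : measure_display) (T : measurableType d).
Variables (P : probability T R) (Y : 'I_n -> {RV P >-> R}).
Variables (K0 : nat) (cl K cB cW cF CF KX C sr lr br : R).

Let q := sstar K0 beta0.

Hypothesis ok : model_ok m.
Hypothesis tau0 : forall i, 0 < tau i.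
Hypothesis dens : forall i, density_family m nu k (tau i).
Hypothesis law : glm_law m nu k X tau beta0 Y.
Hypothesis reg :
  forall i, info_regular m cl K cB cW (tau i) (linpred X beta0 i).
Hypothesis gaussian_info : m = Gaussian -> cl = 0 /\
  forall i y, info m (tau i) (linpred X beta0 i) y = weight m X tau beta0 i.
Hypothesis cl0 : 0 <= cl.
Hypothesis Kge0 : 0 <= K.
Hypothesis cB0 : 0 <= cB.
Hypothesis cW0 : 0 <= cW.
Hypothesis n0 : (0 < n)%N.
Hypothesis s1 : (0 < #|supp beta0|)%N.
Hypothesis cF0 : 0 < cF.
Hypothesis cFCF : cF <= CF.
Hypothesis KX0 : 0 <= KX.
Hypothesis C0 : 0 <= C.
Hypothesis qp : (8 * q < p)%N.
Hypothesis spectrum : forall S, S \in Splus K0 beta0 ->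
  cF <= rho_min (n%:R^-1 *: fisherS m X tau beta0 S) /\
  rho_max (n%:R^-1 *: fisherS m X tau beta0 S) <= CF.
Hypothesis XK : forall i j, `|X i j| <= KX.
Hypothesis moments : m <> Gaussian -> forall S, S \in Splus K0 beta0 ->
  forall u : 'cV[R]_#|S|, enorm u = 1 ->
  \sum_i weight m X tau beta0 i * `|dotv (zvec m X tau beta0 S i) u| ^+ 3
    <= C / Num.sqrt n%:R /\
  \sum_i weight m X tau beta0 i ^+ 2 * dotv (zvec m X tau beta0 S i) u ^+ 4
    <= C / n%:R.
Hypothesis sr0 : 0 < sr.
Hypothesis lr0 : 0 < lr.
Hypothesis br0 : 0 < br.
Hypothesis srE : sr ^+ 2 = #|supp beta0|%:R.
Hypothesis lrE : lr ^+ 2 = ln p%:R.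
Hypothesis brE : br = (Num.sqrt n%:R)^-1.

Let nF S u := enorm (sqrtmx (fisherS m X tau beta0 S) *m u).
Let w := weight m X tau beta0.
Let inf i omega := info m (tau i) (linpred X beta0 i) (Y i omega).

Let kap : R := K0.+1%:R.

Let qE : q%:R = kap * sr ^+ 2.
Proof. by rewrite /q /sstar -mulSnr natrM srE. Qed.

Let q0 : (0 < q)%N.
Proof. by rewrite /q /sstar addn_gt0 s1 orbT. Qed.

Let nE : n%:R = (br ^+ 2)^-1.
Proof. by rewrite brE exprVn invrK sqr_sqrtr. Qed.

Let suppS S : S \in Splus K0 beta0 -> (0 < #|S|)%N /\ (#|S| <= q)%N.
Proof.
rewrite inE => /andP[sub Sq]; split=> //.
exact: leq_trans s1 (subset_leq_card sub).
Qed.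

(** There are at most p ^ (2 q) supports and p ^ q grid points for each, against a
    tail probability of p ^ (- 4 q). *)
Lemma count_supports :
  \sum_(S in Splus K0 beta0) ((8 * q).+1 ^ #|S|)%:R *
     (3 * expR (- (4 * kap * sr ^+ 2 * lr ^+ 2))) <= 3 * p%:R^-1 :> R.
Proof.
have p0 : (0 : R) < p%:R by rewrite ltr0n (leq_ltn_trans _ qp).
have p1 : (1 < p)%N.
  by apply: leq_trans qp; rewrite ltnS muln_gt0 q0.
have p2 : (p.+1 <= p ^ 2)%N.
  rewrite -mulnn (leq_trans _ (leq_mul p1 (leqnn p))) // mul2n -addnn -addn1.
  by rewrite leq_add2l ltnW.
pose E : R := 3 * expR (- (4 * kap * sr ^+ 2 * lr ^+ 2)).
have E0 : 0 <= E by rewrite mulr_ge0 ?expR_ge0.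
apply: (@le_trans _ _ (\sum_(S in Splus K0 beta0) ((8 * q).+1 ^ q)%:R * E)).
  apply: ler_sum => S /suppS[_ Sq]; rewrite ler_wpM2r // ler_nat.
  exact: leq_pexp2l.
rewrite sumr_const -[X in X <= _]mulr_natl mulrA -natrM.
have cnt : (#|Splus K0 beta0| * (8 * q).+1 ^ q <= p ^ (3 * q))%N.
  rewrite (_ : 3 * q = 2 * q + q)%N; last by rewrite -[X in (_ + X)%N]mul1n -mulnDl.
  rewrite expnD leq_mul // ?leq_exp2r //.
  apply: leq_trans (_ : (p.+1 ^ q <= _)%N); last by rewrite expnM leq_exp2r.
  apply: leq_trans (card_small_sets p q); apply: subset_leq_card.
  by apply/fintype.subsetP => S; rewrite !inE => /andP[].
apply: (@le_trans _ _ ((p ^ (3 * q))%:R * E)); first by rewrite ler_wpM2r // ler_nat.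
rewrite /E mulrCA ler_wpM2l //.
have -> : 4 * kap * sr ^+ 2 * lr ^+ 2 = (4 * q)%:R * ln p%:R.
  by rewrite natrM qE lrE; ring.
rewrite expRN expRM_natl lnK ?posrE // natrX.
rewrite (_ : 4 * q = 3 * q + q)%N; last by rewrite -[X in (_ + X)%N]mul1n -mulnDl.
rewrite exprD invfM mulrA divff ?mul1r ?expf_neq0 ?gt_eqF //.
rewrite lef_pV2 ?posrE ?exprn_gt0 // -natrX ler_nat.
by rewrite -[X in (X <= _)%N]expn1 leq_pexp2l // ltnW.
Qed.

(* B bounds a linear form at a grid point. The Chernoff parameters lam2 and lam3
   are of the order that balances the sub-Gaussian part of the cumulant bound
   with the exponent e, capped by the range where that bound holds. *)
Let B := 2 * KX * Num.sqrt kap * sr.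
Let lam2 := (1 / (br * sr * lr) + cW * B ^+ 2)^-1.
Let lam3 := (1 / (br * lr) + cW * B ^+ 3)^-1.
Let V := 3 * C * CF ^+ 2 / br ^+ 2.
Let M := 2 * C * Num.sqrt CF ^+ 3 / br ^+ 2.
Let e := 4 * kap * sr ^+ 2 * lr ^+ 2.
Let t2 := K * lam2 * V + e / lam2.
Let t3 := K * lam3 * (B ^+ 2 * V) + e / lam3.

(** Relative error of the Fisher information as an approximation of the observed
    information at the truth, when sr, lr and br are the square roots of s0, of
    log p and of 1 / n. *)
Definition quad_rate : R :=
  if m is Gaussian then 0 else 3 * t2 * br ^+ 2 / cF.

(** Lipschitz constant of the observed information in the norm of the Fisher
    information, in the same variables. *)
Definition cubic_rate : R :=
  cl * (C * br + 5 * (M + t3) * br ^+ 3 / Num.sqrt cF ^+ 3).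

Let B0 : 0 <= B.
Proof. by rewrite !mulr_ge0 ?sqrtr_ge0 // ltW. Qed.

Let lam2p : 0 < lam2.
Proof.
rewrite invr_gt0 ltr_pwDl ?divr_gt0 // ?mulr_gt0 //.
by rewrite mulr_ge0 // exprn_ge0.
Qed.

Let lam3p : 0 < lam3.
Proof.
rewrite invr_gt0 ltr_pwDl ?divr_gt0 // ?mulr_gt0 //.
by rewrite mulr_ge0 // exprn_ge0.
Qed.

Let V0 : 0 <= V.
Proof. by rewrite /V divr_ge0 ?sqr_ge0 // mulr_ge0 ?sqr_ge0 // mulr_ge0. Qed.

Let M0 : 0 <= M.
Proof. by rewrite /M divr_ge0 ?sqr_ge0 // mulr_ge0 ?exprn_ge0 ?sqrtr_ge0 // mulr_ge0. Qed.

Let e0 : 0 <= e.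
Proof. by rewrite /e mulr_ge0 ?sqr_ge0 // mulr_ge0 ?sqr_ge0 // mulr_ge0. Qed.

Let t20 : 0 <= t2.
Proof. by rewrite /t2 addr_ge0 ?divr_ge0 ?(ltW lam2p) // mulr_ge0 // mulr_ge0 // ltW. Qed.

Let t30 : 0 <= t3.
Proof.
rewrite /t3 addr_ge0 ?divr_ge0 ?(ltW lam3p) // mulr_ge0 //; last first.
  by rewrite mulr_ge0 // sqr_ge0.
by rewrite mulr_ge0 // ltW.
Qed.

Lemma quad_rate_ge0 : 0 <= quad_rate.
Proof.
have : 0 <= 3 * t2 * br ^+ 2 / cF.
  by rewrite divr_ge0 ?(ltW cF0) // mulr_ge0 ?sqr_ge0 // mulr_ge0.
by rewrite /quad_rate; case: m.
Qed.

Lemma cubic_rate_ge0 : 0 <= cubic_rate.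
Proof.
rewrite mulr_ge0 // addr_ge0 //; first by rewrite mulr_ge0 // ltW.
rewrite divr_ge0 ?exprn_ge0 ?sqrtr_ge0 // mulr_ge0 ?exprn_ge0 ?(ltW br0) //.
by rewrite mulr_ge0 // addr_ge0.
Qed.

Let event S : S \in Splus K0 beta0 -> m <> Gaussian ->
  exists A : set T, [/\ measurable A,
    ((1 - ((8 * q).+1 ^ #|S|)%:R * (3 * expR (- e)))%:E <= P A)%E &
    forall omega, A omega -> (forall i, sample_space m (Y i omega)) ->
    (forall u, `|\sum_i (inf i omega - w i) * dotv (predictor X S i) u ^+ 2| <=
       3 * t2 * dotv u u) /\
    (forall u, \sum_i inf i omega * `|dotv (predictor X S i) u| ^+ 3 <=
       5 * (M + t3) * enorm u ^+ 3)].
Proof.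
move=> SS mg; have [S0 Sq] := suppS SS; have [smin smax] := spectrum SS.
have CF0 : 0 <= CF := le_trans (ltW cF0) cFCF.
have nr : Num.sqrt n%:R = br^-1 by rewrite brE invrK.
have cn : Num.sqrt (CF * n%:R) = Num.sqrt CF / br by rewrite sqrtrM // nr.
have nFg (g : 'cV[R]_#|S|) : enorm g <= 5 / 4 -> nF g <= Num.sqrt CF / br * (5 / 4).
  move=> hg; apply: (le_trans (fisher_norm_le n0 cF0 cFCF S0 smin smax g)).
  by rewrite cn ler_wpM2l // divr_ge0 ?sqrtr_ge0 // ltW.
have nFg0 (g : 'cV[R]_#|S|) : 0 <= nF g by exact: enorm_ge0.
have frac (a b : R) : 0 < a -> 0 <= b -> b * (1 / a + b)^-1 <= 1.
  move=> a0 b0; have a1 : 0 < 1 / a by rewrite divr_gt0.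
  rewrite ler_pdivrMr; last exact: ltr_pwDl.
  by move: a1; lra.
apply: (information_event e ok tau0 dens law Sq q0 Kge0 cB0 lam2p lam3p _ _ reg).
- by apply: frac; rewrite ?mulr_gt0 // mulr_ge0 // exprn_ge0.
- by apply: frac; rewrite ?mulr_gt0 // mulr_ge0 // exprn_ge0.
- move=> i g hg; apply: (le_trans (predictor_le S0 XK i g Sq)).
  rewrite qE sqrtrM // sqrtr_sqr gtr0_norm // /B.
  have h : 0 <= KX * (Num.sqrt kap * sr).
    by rewrite mulr_ge0 // mulr_ge0 ?sqrtr_ge0 // ltW.
  rewrite (_ : 2 * _ * _ * _ = 2 * (KX * (Num.sqrt kap * sr))); last by ring.
  have := ler_wpM2l h hg; move: h.
  by move: (KX * (Num.sqrt kap * sr)) => t; lra.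
- move=> g hg; have [h _] := moment_bounds n0 cF0 S0 smin (moments mg SS) g.
  apply: (le_trans h); rewrite nr invrK.
  apply: (@le_trans _ _ (C * br * (Num.sqrt CF / br * (5 / 4)) ^+ 3)).
    rewrite ler_wpM2l //; first by rewrite mulr_ge0 // ltW.
    apply: lerXn2r; rewrite ?nnegrE; [exact: nFg0| |exact: nFg].
    by rewrite mulr_ge0 // divr_ge0 ?sqrtr_ge0 // ltW.
  rewrite /M; move: (Num.sqrt CF) (sqrtr_ge0 CF) => c c0.
  rewrite (_ : _ * _ = 125 / 64 * (C * c ^+ 3 / br ^+ 2)); last first.
    by field; rewrite gt_eqF.
  have : 0 <= C * c ^+ 3 / br ^+ 2.
    by rewrite divr_ge0 ?sqr_ge0 // mulr_ge0 // exprn_ge0.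
  rewrite (_ : 2 * C * _ / _ = 2 * (C * c ^+ 3 / br ^+ 2)); last by rewrite !mulrA.
  by move: (C * c ^+ 3 / br ^+ 2) => t; lra.
- move=> g hg; have [_ h] := moment_bounds n0 cF0 S0 smin (moments mg SS) g.
  apply: (le_trans h); rewrite nE invrK.
  apply: (@le_trans _ _ (C * br ^+ 2 * (Num.sqrt CF / br * (5 / 4)) ^+ 4)).
    rewrite ler_wpM2l //; first by rewrite mulr_ge0 // sqr_ge0.
    apply: lerXn2r; rewrite ?nnegrE; [exact: nFg0| |exact: nFg].
    by rewrite mulr_ge0 // divr_ge0 ?sqrtr_ge0 // ltW.
  rewrite /V -[X in _ <= 3 * C * X ^+ 2 / _](sqr_sqrtr CF0).
  move: (Num.sqrt CF) (sqrtr_ge0 CF) => c c0.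
  rewrite (_ : _ * _ = 625 / 256 * (C * c ^+ 4 / br ^+ 2)); last first.
    by field; rewrite gt_eqF.
  have : 0 <= C * c ^+ 4 / br ^+ 2.
    by rewrite divr_ge0 ?sqr_ge0 // mulr_ge0 // exprn_ge0.
  rewrite -exprM (_ : 3 * C * _ / _ = 3 * (C * c ^+ 4 / br ^+ 2)); last by rewrite !mulrA.
  by move: (C * c ^+ 4 / br ^+ 2) => t; lra.
Qed.

Lemma information_events : exists A : set T, [/\ measurable A,
  ((1 - 3 * p%:R^-1)%:E <= P A)%E &
  forall omega, A omega -> (forall i, sample_space m (Y i omega)) ->
  forall S, S \in Splus K0 beta0 -> forall u : 'cV[R]_#|S|,
    `|\sum_i (inf i omega - w i) * dotv (predictor X S i) u ^+ 2| <=
      quad_rate * nF u ^+ 2 /\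
    \sum_i cl * (w i + inf i omega) * `|dotv (predictor X S i) u| ^+ 3 <=
      cubic_rate * nF u ^+ 3].
Proof.
have [mg|mg] : m = Gaussian \/ m <> Gaussian.
  by case: (m) => [||||| kappa]; [left|right|right|right|right|right].
  have [c0 iw] := gaussian_info mg.
  exists setT; split=> //.
    by rewrite probability_setT lee_fin gerBl mulr_ge0.
  move=> omega _ _ S _ u; split.
    rewrite big1 ?normr0 => [|i _]; last by rewrite /inf iw subrr mul0r.
    by rewrite mulr_ge0 ?sqr_ge0 // quad_rate_ge0.
  rewrite /cubic_rate c0 !mul0r big1 // => i _; by rewrite !mul0r.
have ev S : exists A : set T, S \in Splus K0 beta0 -> [/\ measurable A,
    ((1 - ((8 * q).+1 ^ #|S|)%:R * (3 * expR (- e)))%:E <= P A)%E &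
    forall omega, A omega -> (forall i, sample_space m (Y i omega)) ->
    (forall u, `|\sum_i (inf i omega - w i) * dotv (predictor X S i) u ^+ 2| <=
       3 * t2 * dotv u u) /\
    (forall u, \sum_i inf i omega * `|dotv (predictor X S i) u| ^+ 3 <=
       5 * (M + t3) * enorm u ^+ 3)].
  have [SS|_] := boolP (S \in Splus K0 beta0); last by exists setT.
  by have [A hA] := event SS mg; exists A.
pose AS S := projT1 (cid (ev S)); have ASP S := projT2 (cid (ev S)).
pose bad S := if S \in Splus K0 beta0 then ~` AS S else set0.
pose b S : R := if S \in Splus K0 beta0 then
  ((8 * q).+1 ^ #|S|)%:R * (3 * expR (- e)) else 0.
have [|||A [mA PA Agood]] := @union_bound R _ T P _ bad b (3 * p%:R^-1).
- move=> S; rewrite /bad; case: ifP => // SS; apply: measurableC.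
  by have [] := ASP S SS.
- move=> S; rewrite /bad /b; case: ifP => SS; last by rewrite measure0.
  have [mA PA _] := ASP S SS; rewrite probability_setC //.
  move: PA; rewrite -/(AS S) -(fineK (fin_num_measure P _ mA)).
  by rewrite -EFinB !lee_fin; lra.
- by rewrite -big_mkcond; exact: count_supports.
exists A; split=> // omega Aomega sY S SS u.
have [mAS _ gAS] := ASP S SS.
have AO : AS S omega.
  by have := Agood _ Aomega S; rewrite /bad SS => h; apply: contrapT.
have [h2 h3] := gAS _ AO sY.
have [S0 Sq] := suppS SS; have [smin smax] := spectrum SS.
have nr : Num.sqrt n%:R = br^-1 by rewrite brE invrK.
have cn : Num.sqrt (cF * n%:R) = Num.sqrt cF / br by rewrite sqrtrM ?(ltW cF0) // nr.
have scF : 0 < Num.sqrt cF by rewrite sqrtr_gt0.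
have uF : enorm u <= br / Num.sqrt cF * nF u.
  rewrite -[_ / _]invf_div -cn ler_pdivlMl; last by rewrite cn divr_gt0.
  exact: (fisher_norm_ge n0 cF0 S0 smin u).
have u0 := enorm_ge0 u; have nF0 : 0 <= nF u by exact: enorm_ge0.
split.
  apply: (le_trans (h2 u)).
  have -> : quad_rate = 3 * t2 * (br / Num.sqrt cF) ^+ 2.
    rewrite expr_div_n sqr_sqrtr ?(ltW cF0) // mulrA.
    by move: mg; rewrite /quad_rate; case: (m) => // -[].
  rewrite -[leRHS]mulrA -exprMn -sqr_enorm ler_wpM2l ?mulr_ge0 //.
  by rewrite ler_sqr ?nnegrE // (le_trans u0).
have [m3 _] := moment_bounds n0 cF0 S0 smin (moments mg SS) u.
have -> : \sum_i cl * (w i + inf i omega) * `|dotv (predictor X S i) u| ^+ 3 =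
    cl * (\sum_i w i * `|dotv (predictor X S i) u| ^+ 3 +
          \sum_i inf i omega * `|dotv (predictor X S i) u| ^+ 3).
  rewrite -big_split big_distrr /=; apply: eq_bigr => i _.
  by move: (w i) (inf i omega) (dotv _ _) => a a' c; ring.
rewrite /cubic_rate -mulrA ler_wpM2l // mulrDl lerD //.
  by move: m3; rewrite nr invrK.
apply: (le_trans (h3 u)).
rewrite (_ : _ / _ * _ = 5 * (M + t3) * (br / Num.sqrt cF * nF u) ^+ 3); last first.
  by rewrite -/(nF u); move: (nF u) (M + t3) => a c; field; rewrite gt_eqF.
rewrite ler_wpM2l //; first by rewrite mulr_ge0 // addr_ge0.
by apply: lerXn2r; rewrite ?nnegrE // (le_trans u0).
Qed.

End UnionOverSupports.

(** * Analysis of one sample *)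

Section SampleAnalysis.
Context {R : realType} (m : glm R) (k : R -> R -> R) (n p : nat).
Variables (X : 'M[R]_(n, p)) (tau : 'I_n -> R) (beta0 : 'cV[R]_p).
Variables (cl K cB cW theta mu zeta r rho : R) (S : {set 'I_p}) (y : 'I_n -> R).

Let F := fisherS m X tau beta0 S.
Let nF u := enorm (sqrtmx F *m u).
Let w := weight m X tau beta0.
Let inf i := info m (tau i) (linpred X beta0 i) (y i).

Hypothesis ok : model_ok m.
Hypothesis tau0 : forall i, 0 < tau i.
Hypothesis sY : forall i, sample_space m (y i).
Hypothesis reg :
  forall i, info_regular m cl K cB cW (tau i) (linpred X beta0 i).
Hypothesis subS : supp beta0 \subset S.
Hypothesis pF : posdef F.
Hypothesis cl0 : 0 <= cl.
Hypothesis theta0 : 0 <= theta.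
Hypothesis mu0 : 0 <= mu.
Hypothesis zeta0 : 0 <= zeta.
Hypothesis supx : forall i u, `|dotv (predictor X S i) u| <= zeta * nF u.
Hypothesis quad : forall u,
  `|\sum_i (inf i - w i) * dotv (predictor X S i) u ^+ 2| <= theta * nF u ^+ 2.
Hypothesis cubic : forall u,
  \sum_i cl * (w i + inf i) * `|dotv (predictor X S i) u| ^+ 3 <= mu * nF u ^+ 3.
Hypothesis zr : zeta * r <= 1.

Let b0 := subvec S beta0.
Let V i := cl * (w i + inf i).

Let eE i : dotv (predictor X S i) b0 = linpred X beta0 i.
Proof. exact: linpred_subvec. Qed.

Let w0 i : 0 <= w i. Proof. exact: fisher_weight_ge0. Qed.

Let inf0 i : 0 <= inf i. Proof. exact: info_ge0. Qed.

Let V0 i : 0 <= V i. Proof. by rewrite mulr_ge0 // addr_ge0. Qed.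

Let lipV i (t1 t2 : R) : `|t1 - dotv (predictor X S i) b0| <= 1 ->
  `|t2 - dotv (predictor X S i) b0| <= 1 ->
  `|info m (tau i) t2 (y i) - info m (tau i) t1 (y i)| <= `|t2 - t1| * V i.
Proof.
rewrite eE => h1 h2; have [_ _ lip _] := reg i.
by rewrite /V mulrA (mulrC `|_|); exact: lip.
Qed.

Let FE : F = gram (predictor X S) w. Proof. exact: fisherSE. Qed.

Let pG : posdef (gram (predictor X S) w). Proof. by rewrite -FE. Qed.

Let quadG u : `|\sum_i (info m (tau i) (dotv (predictor X S i) b0) (y i) - w i) *
    dotv (predictor X S i) u ^+ 2|
  <= theta * enorm (sqrtmx (gram (predictor X S) w) *m u) ^+ 2.
Proof.
rewrite -FE; apply: le_trans (quad u).
by under eq_bigr => i _ do rewrite eE.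
Qed.

Let cubicG u : \sum_i V i * `|dotv (predictor X S i) u| ^+ 3
  <= mu * enorm (sqrtmx (gram (predictor X S) w) *m u) ^+ 3.
Proof. by rewrite -FE; exact: cubic. Qed.

Let supxG i u : `|dotv (predictor X S i) u|
  <= zeta * enorm (sqrtmx (gram (predictor X S) w) *m u).
Proof. by rewrite -FE; exact: supx. Qed.

Lemma obs_info_near_fisher h : nF h <= r ->
  opnorm (invsqrtmx F *m (obs_info m k X tau y (b0 + h) - F) *m invsqrtmx F)
    <= 2 * mu * r + theta.
Proof.
rewrite /nF obs_infoE // FE.
exact: (opnorm_info (a := fun i t => info m (tau i) t (y i)) pG V0 lipV mu0 theta0
  zeta0 cubicG quadG supxG zr).
Qed.

Hypothesis rho0 : 0 < rho.
Hypothesis rho_r : rho <= r / 2.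
Hypothesis small : 2 * mu * r + theta <= 4^-1.
Hypothesis zrho : zeta * rho * (3 * cl) <= 4^-1.
Hypothesis score_le : forall u,
  \sum_i score m (tau i) (linpred X beta0 i) (y i) * dotv (predictor X S i) u
    <= rho / 5 * nF u.

Let Vquad u : \sum_i V i * dotv (predictor X S i) u ^+ 2 <=
  3 * cl * enorm (sqrtmx (gram (predictor X S) w) *m u) ^+ 2.
Proof.
rewrite -FE -/(nF u); have := quad u; rewrite ler_norml => /andP[_ h].
have FQ : nF u ^+ 2 = \sum_i w i * dotv (predictor X S i) u ^+ 2.
  by rewrite /nF enorm_sqrtmx ?FE ?gram_quad //; exact: posdef_psd.
have -> : \sum_i V i * dotv (predictor X S i) u ^+ 2 =
    cl * (2 * nF u ^+ 2 +
      \sum_i (inf i - w i) * dotv (predictor X S i) u ^+ 2).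
  rewrite FQ !big_distrr -big_split big_distrr /=; apply: eq_bigr => i _.
  by rewrite /V; move: (w i) (inf i) (dotv _ _) => a b c; ring.
rewrite (mulrC 3) -mulrA ler_wpM2l //.
have t1 : theta * nF u ^+ 2 <= nF u ^+ 2.
  rewrite ler_piMl ?sqr_ge0 //.
  have : 0 <= 2 * mu * r by rewrite !mulr_ge0 //; move: rho_r rho0; lra.
  by move: small; lra.
by move: h t1; set N := nF u ^+ 2; set G := \sum_i _; lra.
Qed.

(** The regular maximizer is unique, hence it is the one found near the truth. *)
Lemma mle_info_lipschitz u :
  let J := mle_info m k X tau S y in
  0 < enorm (sqrtmx J *m u) -> enorm (sqrtmx J *m u) <= r / 4 ->
  opnorm (invsqrtmx J *m (obs_info m k X tau y (mle m k X tau S y + u) - J)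
    *m invsqrtmx J) / enorm (sqrtmx J *m u) <= 8 * mu.
Proof.
have scoreG v : \sum_i score m (tau i) (dotv (predictor X S i) b0) (y i) *
      dotv (predictor X S i) v
    <= rho / 5 * enorm (sqrtmx (gram (predictor X S) w) *m v).
  rewrite -FE; apply: le_trans (score_le v).
  by under eq_bigr => i _ do rewrite eE.
have [v vrho vmax] := maximizer_in_ball pG V0 lipV mu0 zeta0 quadG supxG zr
  (fun i t => is_derive_obs_loglik k (tau i) (y i) t ok)
  (fun i t => is_derive_score (tau i) (y i) t ok)
  (fun i t => info_ge0 t ok (tau0 i) (sY i)) rho0 rho_r small Vquad zrho scoreG.
have pJ := posdef_info (a := fun i t => info m (tau i) t (y i)) pG V0 lipV mu0 zeta0 cubicG quadG supxG zr rho0 rho_r small vrho.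
have regv : regular_mle m k X tau y v.
  by split; [rewrite loglikS_sum|rewrite obs_infoE].
have mleE : mle m k X tau S y = v.
  rewrite /mle; case: xgetP => [v' _ [vmax' _]|h]; last by case: (h v).
  apply/eqP; apply/negPn/negP => vv; have [vmax2 _] := regv.
  by have := lt_trans (vmax2 _ vv) (vmax' v _); rewrite ltxx eq_sym vv => /(_ isT).
have -> : mle_info m k X tau S y = obs_info m k X tau y v.
  by rewrite /mle_info mleE; case: asboolP => // h; case: h; exists v.
rewrite mleE !obs_infoE // => J N0 Nr.
exact: (opnorm_info_diff (a := fun i t => info m (tau i) t (y i)) pG V0 lipV mu0 zeta0 cubicG quadG supxG zr rho0 rho_r small
  vrho N0 Nr).
Qed.

End SampleAnalysis.

(** * The finite-sample event *)

Section FiniteSample.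
Context {R : realType} (m : glm R) (nu : {measure set R -> \bar R}).
Variables (k : R -> R -> R) (n p : nat) (X : 'M[R]_(n, p)) (tau : 'I_n -> R).
Variables (beta0 : 'cV[R]_p) (d : measure_display) (T : measurableType d).
Variables (P : probability T R) (Y : 'I_n -> {RV P >-> R}).
Variables (K0 : nat) (cl K cB cW cF CF KX C sr lr br : R).

Let q := sstar K0 beta0.

Hypothesis ok : model_ok m.
Hypothesis tau0 : forall i, 0 < tau i.
Hypothesis dens : forall i, density_family m nu k (tau i).
Hypothesis law : glm_law m nu k X tau beta0 Y.
Hypothesis reg :
  forall i, info_regular m cl K cB cW (tau i) (linpred X beta0 i).
Hypothesis gaussian_info : m = Gaussian -> cl = 0 /\
  forall i y, info m (tau i) (linpred X beta0 i) y = weight m X tau beta0 i.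
Hypothesis cl0 : 0 <= cl.
Hypothesis Kge0 : 0 <= K.
Hypothesis cB0 : 0 <= cB.
Hypothesis cW0 : 0 <= cW.
Hypothesis n0 : (0 < n)%N.
Hypothesis s1 : (0 < #|supp beta0|)%N.
Hypothesis cF0 : 0 < cF.
Hypothesis cFCF : cF <= CF.
Hypothesis KX0 : 0 <= KX.
Hypothesis C0 : 0 <= C.
Hypothesis qp : (8 * q < p)%N.
Hypothesis spectrum : forall S, S \in Splus K0 beta0 ->
  cF <= rho_min (n%:R^-1 *: fisherS m X tau beta0 S) /\
  rho_max (n%:R^-1 *: fisherS m X tau beta0 S) <= CF.
Hypothesis XK : forall i j, `|X i j| <= KX.
Hypothesis moments : m <> Gaussian -> forall S, S \in Splus K0 beta0 ->
  forall u : 'cV[R]_#|S|, enorm u = 1 ->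
  \sum_i weight m X tau beta0 i * `|dotv (zvec m X tau beta0 S i) u| ^+ 3
    <= C / Num.sqrt n%:R /\
  \sum_i weight m X tau beta0 i ^+ 2 * dotv (zvec m X tau beta0 S i) u ^+ 4
    <= C / n%:R.
Hypothesis sr0 : 0 < sr.
Hypothesis lr0 : 0 < lr.
Hypothesis br0 : 0 < br.
Hypothesis srE : sr ^+ 2 = #|supp beta0|%:R.
Hypothesis lrE : lr ^+ 2 = ln p%:R.
Hypothesis brE : br = (Num.sqrt n%:R)^-1.

Variables (L r : R).
Let kap : R := K0.+1%:R.
Let zeta := KX * Num.sqrt (kap / cF) * (sr * br).
Let theta := quad_rate m K0 K cW cF CF KX C sr lr br.
Let mu := cubic_rate K0 cl K cW cF CF KX C sr lr br.

Hypothesis ek : forall i, eta_ok m L (linpred X beta0 i).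
Hypothesis r_large : 30 * (sr * lr) <= r.
Hypothesis zr : zeta * r <= 1.
Hypothesis small : 2 * mu * r + theta <= 4^-1.
Hypothesis zrho : zeta * (15 * (sr * lr)) * (3 * cl) <= 4^-1.
Hypothesis curv_small : curv_const m L * (lr * zeta) <= 2^-1.

Let SS0 : supp beta0 \in Splus K0 beta0.
Proof. by rewrite inE fintype.subxx /sstar leq_addl. Qed.

Let p0 : (0 : R) < p%:R.
Proof. by rewrite ltr0n (leq_ltn_trans _ qp). Qed.

Let zetaE : zeta = KX * Num.sqrt (q%:R / (cF * n%:R)).
Proof.
rewrite /zeta /q /sstar -mulSnr natrM -/kap -srE -mulrA; congr (_ * _).
have -> : kap * sr ^+ 2 / (cF * n%:R) = kap / cF * (sr * br) ^+ 2.
  rewrite exprMn brE exprVn sqr_sqrtr //; field.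
  have nR : (0 : R) < n%:R by rewrite ltr0n.
  by rewrite !gt_eqF.
rewrite [in RHS]sqrtrM; last by rewrite divr_ge0 // ltW.
by rewrite sqrtr_sqr gtr0_norm // mulr_gt0.
Qed.

Let suppS S : S \in Splus K0 beta0 ->
  [/\ (0 < #|S|)%N, (#|S| <= q)%N & supp beta0 \subset S].
Proof.
rewrite inE => /andP[sub Sq]; split=> //.
exact: leq_trans s1 (subset_leq_card sub).
Qed.

Let pF S : S \in Splus K0 beta0 -> posdef (fisherS m X tau beta0 S).
Proof.
move=> SS; have [S0 _ _] := suppS SS; have [smin _] := spectrum SS.
exact: (posdef_fisher n0 cF0 S0 smin).
Qed.

Let supx S i u : S \in Splus K0 beta0 -> `|dotv (predictor X S i) u| <=
  zeta * enorm (sqrtmx (fisherS m X tau beta0 S) *m u).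
Proof.
move=> SS; have [S0 Sq _] := suppS SS; have [smin _] := spectrum SS.
by rewrite zetaE; exact: (predictor_fisher_le n0 cF0 S0 smin XK i u Sq).
Qed.

(** The score, information and sample-space events combined: everything needed
    for the local behaviour of the log likelihood holds with probability
    1 - 5 / p. *)
Lemma finite_sample : exists A : set T, [/\ measurable A,
  ((1 - 5 * p%:R^-1)%:E <= P A)%E &
  forall omega, A omega -> let y i := Y i omega in
  (forall S, S \in Splus K0 beta0 -> forall h : 'cV[R]_#|S|,
     enorm (sqrtmx (fisherS m X tau beta0 S) *m h) <= r ->
     opnorm (invsqrtmx (fisherS m X tau beta0 S) *m
        (obs_info m k X tau y (subvec S beta0 + h) - fisherS m X tau beta0 S)
        *m invsqrtmx (fisherS m X tau beta0 S)) <= 2 * mu * r + theta) /\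
  let S0 := supp beta0 in
  let J := mle_info m k X tau S0 y in
  forall u : 'cV[R]_#|S0|,
    0 < enorm (sqrtmx J *m u) -> enorm (sqrtmx J *m u) <= r / 4 ->
    opnorm (invsqrtmx J *m (obs_info m k X tau y (mle m k X tau S0 y + u) - J)
      *m invsqrtmx J) / enorm (sqrtmx J *m u) <= 8 * mu].
Proof.
have [A0 [mA0 PA0 sA0]] := sample_space_ae dens law.
have [A1 [mA1 PA1 hA1]] := information_events ok tau0 dens law reg gaussian_info
  cl0 Kge0 cB0 cW0 n0 s1 cF0 cFCF KX0 C0 qp spectrum XK moments sr0 lr0 br0
  srE lrE brE.
have lE : Num.sqrt (ln p%:R) = lr by rewrite -lrE sqrtr_sqr gtr0_norm.
have lnp0 : 0 < ln p%:R :> R by rewrite -lrE exprn_gt0.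
have cs : curv_const m L * (Num.sqrt (ln p%:R) * zeta) <= 2^-1 by rewrite lE.
have [A2 [mA2 PA2 hA2]] := score_event ok tau0 dens law ek (pF SS0)
  (fun i u => supx i u SS0) lnp0 cs.
have PA2' : ((1 - 2 * p%:R^-1)%:E <= P A2)%E.
  apply: le_trans PA2; rewrite lee_fin lerB // mulrCA ler_wpM2l //.
  rewrite expRN expRM_natl lnK ?posrE // expr2 invfM mulrA ler_piMl //.
  by rewrite ler_pdivrMr // mul1r ler_nat -[leqRHS]card_ord max_card.
have PA0' : ((1 - 0)%:E <= P A0)%E by rewrite PA0 subr0.
have P12 := probability_inter_ge mA1 mA2 PA1 PA2'.
have P012 := probability_inter_ge mA0 (measurableI _ _ mA1 mA2) PA0' P12.
exists (A0 `&` (A1 `&` A2)); split.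
- by apply: measurableI => //; exact: measurableI.
- by apply: le_trans P012; rewrite lee_fin; have := invr_ge0 (p%:R : R); lra.
move=> omega; case=> o0; case=> o1 o2 y.
have sY i : sample_space m (Y i omega) by exact: sA0.
have zeta0 : 0 <= zeta.
  by apply: mulr_ge0; [rewrite mulr_ge0 ?sqrtr_ge0|rewrite mulr_ge0 // ltW].
have theta0 : 0 <= theta := quad_rate_ge0 m K0 CF Kge0 cW0 cF0 KX0 C0 sr0 lr0 br0.
have mu0 : 0 <= mu := cubic_rate_ge0 K0 cF CF cl0 Kge0 cW0 KX0 C0 sr0 lr0 br0.
split=> [S SS h|].
  have [_ _ sub] := suppS SS; have I := hA1 _ o1 sY S SS.
  exact: (obs_info_near_fisher k ok tau0 sY reg sub (pF SS) cl0 theta0 mu0 zeta0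
    (fun i u => supx i u SS) (fun u => proj1 (I u)) (fun u => proj2 (I u)) zr).
have I := hA1 _ o1 sY _ SS0.
(* on the event the score is at most a fifth of this radius *)
have rho0 : 0 < 15 * (sr * lr) by rewrite mulr_gt0 // mulr_gt0.
have rho_r : 15 * (sr * lr) <= r / 2 by move: r_large; lra.
have score_le u : \sum_i score m (tau i) (linpred X beta0 i) (Y i omega) *
      dotv (predictor X (supp beta0) i) u
    <= 15 * (sr * lr) / 5 * enorm (sqrtmx (fisherS m X tau beta0 (supp beta0)) *m u).
  apply: (le_trans (hA2 _ o2 u)); rewrite ler_wpM2r ?enorm_ge0 //.
  by rewrite sqrtrM // lE -srE sqrtr_sqr gtr0_norm //; lra.
move=> S0 J u N0 Nr; exact: (@mle_info_lipschitz _ m k n p X tau beta0 _ _ _ _ _ _ _ _ _ S0 y ok tau0 sY reg (fintype.subxx _) (pF SS0)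
  cl0 mu0 zeta0 (fun i u => supx i u SS0) (fun u => proj1 (I u))
  (fun u => proj2 (I u)) zr rho0 rho_r small zrho score_le u N0 Nr).
Qed.

End FiniteSample.

(** * Rates of the error terms *)

Section Rates.
Context {R : realType} (m : glm R) (K0 : nat) (cl K cW cF CF KX C : R).
Hypothesis cl0 : 0 <= cl.
Hypothesis Kge0 : 0 <= K.
Hypothesis cW0 : 0 <= cW.
Hypothesis cF0 : 0 < cF.
Hypothesis KX0 : 0 <= KX.
Hypothesis C0 : 0 <= C.
Hypothesis light : ~~ heavy_info m -> cW = 0.
Hypothesis gaussian : m = Gaussian -> cl = 0.

Let kap : R := K0.+1%:R.
Let kap0 : 0 < kap. Proof. by rewrite ltr0n. Qed.

Let inv_sum_le (a b : R) : 0 < a -> 0 <= b -> (1 / a + b)^-1 <= a.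
Proof.
move=> a0 b0; have a1 : 0 < a^-1 by rewrite invr_gt0.
rewrite div1r -[X in _ <= X]invrK lef_pV2 ?posrE //; last exact: ltr_pwDl.
by rewrite lerDl.
Qed.

Lemma quad_rate_le : exists2 c : R, 0 <= c & forall sr lr br : R,
  0 < sr -> 0 < lr -> 0 < br -> quad_rate m K0 K cW cF CF KX C sr lr br <=
    c * (sr * lr * br + cW * (sr ^+ 4 * lr ^+ 2 * br ^+ 2)).
Proof.
pose a := 9 * K * C * CF ^+ 2 / cF; pose b := 12 * kap / cF.
pose g := 48 * kap ^+ 2 * KX ^+ 2 / cF.
have a0 : 0 <= a.
  by rewrite /a divr_ge0 ?(ltW cF0) // mulr_ge0 ?sqr_ge0 // mulr_ge0 // mulr_ge0.
have b0 : 0 <= b by rewrite /b divr_ge0 ?(ltW cF0) // mulr_ge0 // ltW.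
have g0 : 0 <= g.
  by rewrite /g divr_ge0 ?(ltW cF0) // mulr_ge0 ?sqr_ge0 // mulr_ge0 // sqr_ge0.
exists (a + b + g) => [|sr lr br s0 l0 r0]; first by rewrite !addr_ge0.
have G0 : 0 <= cW * (sr ^+ 4 * lr ^+ 2 * br ^+ 2).
  by rewrite mulr_ge0 // mulr_ge0 ?sqr_ge0 // mulr_ge0 ?sqr_ge0 // exprn_ge0 // ltW.
have x0 : 0 < br * sr * lr by rewrite mulr_gt0 // mulr_gt0.
have x0' : 0 < sr * lr * br by rewrite mulr_gt0 // mulr_gt0.
pose B := 2 * KX * Num.sqrt kap * sr.
have BE : B ^+ 2 = 4 * KX ^+ 2 * kap * sr ^+ 2.
  by rewrite /B !exprMn sqr_sqrtr ?(ltW kap0) //; ring.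
have B2 : 0 <= cW * B ^+ 2 by rewrite mulr_ge0 // sqr_ge0.
suff : 3 * (K * (1 / (br * sr * lr) + cW * B ^+ 2)^-1 * (3 * C * CF ^+ 2 / br ^+ 2)
    + 4 * kap * sr ^+ 2 * lr ^+ 2 / (1 / (br * sr * lr) + cW * B ^+ 2)^-1)
    * br ^+ 2 / cF <= (a + b + g) * (sr * lr * br + cW * (sr ^+ 4 * lr ^+ 2 * br ^+ 2)).
  rewrite /quad_rate; case: (m) => // _.
  by rewrite mulr_ge0 ?addr_ge0 // ltW.
apply: (@le_trans _ _ (3 * (K * (br * sr * lr) * (3 * C * CF ^+ 2 / br ^+ 2)
    + 4 * kap * sr ^+ 2 * lr ^+ 2 * (1 / (br * sr * lr) + cW * B ^+ 2))
    * br ^+ 2 / cF)).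
  rewrite ler_wpM2r ?invr_ge0 ?(ltW cF0) // ler_wpM2r ?sqr_ge0 // ler_wpM2l //.
  rewrite invrK lerD2r ler_wpM2r //.
    by rewrite divr_ge0 ?sqr_ge0 // mulr_ge0 ?sqr_ge0 // mulr_ge0.
  by rewrite ler_wpM2l // inv_sum_le.
rewrite BE (_ : 3 * _ * _ / _ = (a + b) * (sr * lr * br)
    + g * (cW * (sr ^+ 4 * lr ^+ 2 * br ^+ 2))); last first.
  by rewrite /a /b /g; field; rewrite !gt_eqF.
move: (mulr_ge0 g0 (ltW x0')) (mulr_ge0 a0 G0) (mulr_ge0 b0 G0).
move: (sr * lr * br) (cW * _) => x y; clearbody a b g; lra.
Qed.

Lemma cubic_rate_le : exists2 c : R, 0 <= c & forall sr lr br : R,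
  0 < sr -> 0 < lr -> 0 < br -> cubic_rate K0 cl K cW cF CF KX C sr lr br <=
    c * (br * (1 + sr ^+ 2 * lr * br + cW * (sr ^+ 5 * lr ^+ 2 * br ^+ 2))).
Proof.
pose f := Num.sqrt cF; have f0 : 0 < f by rewrite sqrtr_gt0.
pose cc := Num.sqrt CF; have cc0 : 0 <= cc by rewrite sqrtr_ge0.
pose a := cl * (C + 10 * C * cc ^+ 3 / f ^+ 3).
pose b := cl * (60 * K * KX ^+ 2 * kap * C * CF ^+ 2 + 20 * kap) / f ^+ 3.
pose g := cl * 160 * KX ^+ 3 * kap ^+ 2 * Num.sqrt kap / f ^+ 3.
have if0 : 0 <= (f ^+ 3)^-1 by rewrite invr_ge0 exprn_ge0 // ltW.
have a0 : 0 <= a.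
  rewrite /a mulr_ge0 // addr_ge0 // mulr_ge0 // mulr_ge0 ?exprn_ge0 //.
  by rewrite mulr_ge0.
have b0 : 0 <= b.
  rewrite /b mulr_ge0 // mulr_ge0 // addr_ge0 //; last by rewrite mulr_ge0 // ltW.
  rewrite mulr_ge0 ?sqr_ge0 // mulr_ge0 // mulr_ge0 ?(ltW kap0) //.
  by rewrite mulr_ge0 ?sqr_ge0 // mulr_ge0.
have g0 : 0 <= g.
  rewrite /g mulr_ge0 // mulr_ge0 ?sqrtr_ge0 // mulr_ge0 ?sqr_ge0 //.
  by rewrite mulr_ge0 ?exprn_ge0 // mulr_ge0.
exists (a + b + g) => [|sr lr br s0 l0 r0]; first by rewrite !addr_ge0.
have G0 : 0 <= cW * (sr ^+ 5 * lr ^+ 2 * br ^+ 2).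
  by rewrite mulr_ge0 // mulr_ge0 ?sqr_ge0 // mulr_ge0 ?sqr_ge0 // exprn_ge0 // ltW.
have x0 : 0 < br * lr by rewrite mulr_gt0.
have x0' : 0 < sr ^+ 2 * lr * br by rewrite mulr_gt0 // mulr_gt0 // exprn_gt0.
pose k2 := Num.sqrt kap; have k20 : 0 <= k2 by rewrite sqrtr_ge0.
have kE : kap = k2 ^+ 2 by rewrite sqr_sqrtr // ltW.
pose B := 2 * KX * k2 * sr.
have B0 : 0 <= B by rewrite /B mulr_ge0 ?(ltW s0) // mulr_ge0 // mulr_ge0.
have B3 : 0 <= cW * B ^+ 3 by rewrite mulr_ge0 // exprn_ge0.
rewrite /cubic_rate -/kap -/k2 -/B -/f -/cc.
apply: (@le_trans _ _ (cl * (C * br + 5 * (2 * C * cc ^+ 3 / br ^+ 2 +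
    (K * (br * lr) * (B ^+ 2 * (3 * C * CF ^+ 2 / br ^+ 2))
     + 4 * kap * sr ^+ 2 * lr ^+ 2 * (1 / (br * lr) + cW * B ^+ 3)))
    * br ^+ 3 / f ^+ 3))).
  rewrite ler_wpM2l // lerD2l ler_wpM2r // ler_wpM2r ?exprn_ge0 ?(ltW r0) //.
  rewrite ler_wpM2l // lerD2l invrK lerD2r ler_wpM2r //.
    rewrite mulr_ge0 ?sqr_ge0 // divr_ge0 ?sqr_ge0 // mulr_ge0 ?sqr_ge0 //.
    by rewrite mulr_ge0.
  by rewrite ler_wpM2l // inv_sum_le.
rewrite (_ : cl * _ = br * (a + b * (sr ^+ 2 * lr * br)
    + g * (cW * (sr ^+ 5 * lr ^+ 2 * br ^+ 2)))); last first.
  by rewrite /a /b /g -/k2 /B kE; field; rewrite !gt_eqF.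
rewrite [leRHS]mulrCA ler_wpM2l ?(ltW r0) //.
move: (mulr_ge0 a0 (ltW x0')) (mulr_ge0 a0 G0) (mulr_ge0 b0 G0) (mulr_ge0 g0 (ltW x0')).
move: b0 g0.
move: (sr ^+ 2 * lr * br) (cW * _) => x y; clearbody a b g; lra.
Qed.

(** Every error term is a combination of products of the three rates a1, a2, a3
    below, each at most de ^ 2. The radius r exceeds the statistical error
    sr lr by the factor 1 / de, which costs one factor de and leaves the other. *)
Lemma local_rates : exists2 c : R, 0 <= c & forall sr lr br de : R,
  1 <= sr -> 1 <= lr -> 0 < br -> 0 < de -> de <= 1 ->
  sr ^+ 2 * lr * br <= de ^+ 2 ->
  (m <> Gaussian -> sr ^+ 3 * br / lr <= de ^+ 2) ->
  (heavy_info m -> sr ^+ 6 * br ^+ 2 <= de ^+ 2) ->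
  let zeta := KX * Num.sqrt (kap / cF) * (sr * br) in
  let theta := quad_rate m K0 K cW cF CF KX C sr lr br in
  let mu := cubic_rate K0 cl K cW cF CF KX C sr lr br in
  let r := sr * lr / de in
  [/\ zeta * r <= c * de, lr * zeta <= c * de, zeta * (sr * lr) <= c * de,
      2 * mu * r + theta <= c * de * lr ^+ 2 / (sr ^+ 2 + lr ^+ 2) &
      sr ^+ 2 * mu <= c * de].
Proof.
have [c2 c20 quadE] := quad_rate_le; have [c3 c30 cubicE] := cubic_rate_le.
have [cz czE] : exists cz, cz = KX * Num.sqrt (kap / cF) by eexists.
have cz0 : 0 <= cz by rewrite czE mulr_ge0 // sqrtr_ge0.
have [ce ceE] : exists ce, ce = 2 * (c3 * (4 + 2 * cW)) + c2 * (2 + 2 * cW).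
  by eexists.
have [cs csE] : exists cs, cs = c3 * (2 + cW) by eexists.
have ce0 : 0 <= ce.
  by rewrite ceE addr_ge0 // mulr_ge0 // ?mulr_ge0 // addr_ge0 // mulr_ge0.
have cs0 : 0 <= cs by rewrite csE mulr_ge0 // addr_ge0.
exists (cz + ce + cs); first by rewrite !addr_ge0.
move=> sr lr br de s1 l1 b0 d0 d1 h1 h2 h3 zeta theta mu r.
have s0 : 0 < sr by apply: lt_le_trans s1.
have l0 : 0 < lr by apply: lt_le_trans l1.
have dd : de ^+ 2 <= de by rewrite expr2 ler_piMl // ltW.
have d2 : 0 <= de ^+ 2 by exact: sqr_ge0.
pose a1 := sr ^+ 2 * lr * br; pose a2 := sr ^+ 3 * br / lr.
pose a3 := sr ^+ 6 * br ^+ 2; pose x := sr * lr * br.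
have a10 : 0 <= a1 by rewrite /a1 !mulr_ge0 ?sqr_ge0 // ltW.
have x0 : 0 <= x by rewrite /x mulr_ge0 ?(ltW b0) // mulr_ge0 // ltW.
have a30 : 0 <= a3 by rewrite /a3 mulr_ge0 ?sqr_ge0 // exprn_ge0 // ltW.
have a11 : a1 <= 1 by apply: le_trans h1 (le_trans dd d1).
have xa : x <= a1.
  rewrite /x /a1 ler_wpM2r ?(ltW b0) // ler_wpM2r ?(ltW l0) //.
  by rewrite expr2 ler_peMl // ltW.
have a1d : a1 <= de by apply: le_trans h1 dd.
have a3W : cW * a3 <= cW * de ^+ 2.
  have [hm|lm] := boolP (heavy_info m); first by rewrite ler_wpM2l // h3.
  by rewrite light // !mul0r.
have sq1 : a1 ^+ 2 <= de ^+ 2 by rewrite expr2 (le_trans _ h1) // ler_piMl.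
have bnd (c' t : R) : 0 <= c' -> c' <= cz + ce + cs -> t <= c' * de ->
    t <= (cz + ce + cs) * de.
  by move=> c'0 c'c h; apply: (le_trans h); rewrite ler_wpM2r // ltW.
split.
- apply: (bnd cz) => //; first by rewrite -addrA lerDl addr_ge0.
  rewrite /zeta -czE /r (_ : _ * _ = cz * (a1 / de)); last first.
    by rewrite /a1; field; rewrite gt_eqF.
  by rewrite ler_wpM2l // ler_pdivrMr.
- apply: (bnd cz) => //; first by rewrite -addrA lerDl addr_ge0.
  rewrite /zeta -czE (_ : lr * _ = cz * x); last by rewrite /x; ring.
  by rewrite ler_wpM2l // (le_trans xa).
- apply: (bnd cz) => //; first by rewrite -addrA lerDl addr_ge0.
  rewrite /zeta -czE (_ : _ * _ = cz * a1); last by rewrite /a1; ring.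
  by rewrite ler_wpM2l.
- have sl0 : 0 < sr ^+ 2 + lr ^+ 2 by rewrite ltr_pwDl ?sqr_ge0 // exprn_gt0.
  have l20 : 0 <= lr ^+ 2 by exact: sqr_ge0.
  rewrite ler_pdivlMr //.
  suff h : (2 * mu * r + theta) * (sr ^+ 2 + lr ^+ 2) <= lr ^+ 2 * (ce * de).
    apply: (le_trans h); rewrite [leRHS]mulrC ler_wpM2l //.
    by rewrite ler_wpM2r ?(ltW d0) // addrAC lerDr addr_ge0.
  have [mg|mg] : m = Gaussian \/ m <> Gaussian.
    by case: (m) => [||||| kappa]; [left|right|right|right|right|right].
    rewrite /mu /theta /cubic_rate (gaussian mg) /quad_rate mg.
    by rewrite !(mul0r, mulr0, addr0) mulr_ge0 // mulr_ge0 // ltW.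
  have a20 : 0 <= a2.
    by rewrite /a2 divr_ge0 ?(ltW l0) // mulr_ge0 ?exprn_ge0 // ltW.
  have {h2}h2 : a2 <= de ^+ 2 := h2 mg.
  have r0 : 0 <= r by rewrite /r divr_ge0 ?(ltW d0) // mulr_ge0 // ltW.
  have hq := quadE sr lr br s0 l0 b0; have hc := cubicE sr lr br s0 l0 b0.
  have hmr := ler_wpM2r (ltW sl0) (ler_wpM2r r0 hc).
  have hth := ler_wpM2r (ltW sl0) hq.
  rewrite -/theta in hth; rewrite -/mu in hmr.
  rewrite (_ : c2 * _ * _ = lr ^+ 2 * (c2 * (x + a2 + cW * a1 ^+ 2 + cW * a3))) in hth;
    last by rewrite /x /a1 /a2 /a3; field; rewrite gt_eqF.
  rewrite (_ : c3 * _ * _ * _ = lr ^+ 2 * (c3 * (((1 + a1) * (x + a2)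
     + a1 * (cW * a1 ^+ 2 + cW * a3)) / de))) in hmr;
    last by rewrite /r /x /a1 /a2 /a3; field; rewrite !gt_eqF.
  have e1 : cW * a1 ^+ 2 <= cW * de ^+ 2 by rewrite ler_wpM2l.
  have t1 : c2 * (x + a2 + cW * a1 ^+ 2 + cW * a3) <= c2 * (2 + 2 * cW) * de.
    rewrite -mulrA ler_wpM2l //.
    apply: (@le_trans _ _ ((2 + 2 * cW) * de ^+ 2)).
      by move: (le_trans xa h1) h2 e1 a3W; clearbody x a2; lra.
    by rewrite ler_wpM2l // addr_ge0 // mulr_ge0.
  have t2 : c3 * (((1 + a1) * (x + a2) + a1 * (cW * a1 ^+ 2 + cW * a3)) / de)
      <= c3 * (4 + 2 * cW) * de.
    rewrite -mulrA ler_wpM2l // ler_pdivrMr // -[leRHS]mulrA -expr2.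
    rewrite [leRHS]mulrDl lerD //.
      rewrite (_ : 4 * _ = 2 * (2 * de ^+ 2)); last by ring.
      apply: ler_pM; rewrite ?addr_ge0 //; first by clearbody a1; lra.
      by move: (le_trans xa h1) h2; clearbody x a2; lra.
    apply: (@le_trans _ _ (1 * (cW * a1 ^+ 2 + cW * a3))).
      by rewrite ler_wpM2r // addr_ge0 // mulr_ge0 // sqr_ge0.
    by move: e1 a3W; lra.
  rewrite (_ : (2 * mu * r + theta) * _ = 2 * (mu * r * (sr ^+ 2 + lr ^+ 2))
    + theta * (sr ^+ 2 + lr ^+ 2)); last by ring.
  apply: (le_trans (lerD (ler_wpM2l (ler0n R 2) hmr) hth)).
  rewrite mulrCA -[leLHS]mulrDr ler_wpM2l //.
  apply: (le_trans (lerD (ler_wpM2l (ler0n R 2) t2) t1)).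
  by rewrite ceE [leRHS]mulrDl !mulrA.
apply: (bnd cs) => //; first by rewrite lerDr addr_ge0.
have hc := cubicE sr lr br s0 l0 b0; rewrite -/mu in hc.
have hs := ler_wpM2l (sqr_ge0 sr) hc; apply: (le_trans hs).
pose z := sr ^+ 3 * br; have z0 : 0 <= z by rewrite mulr_ge0 ?exprn_ge0 // ltW.
have sb : sr ^+ 2 * br <= a1.
  rewrite (_ : a1 = sr ^+ 2 * br * lr); last by rewrite /a1; ring.
  by rewrite ler_peMr // mulr_ge0 ?sqr_ge0 // ltW.
have sb0 : 0 <= sr ^+ 2 * br by rewrite mulr_ge0 ?sqr_ge0 // ltW.
rewrite [leLHS](_ : _ =
    c3 * (sr ^+ 2 * br * (1 + a1) + cW * z * a1 ^+ 2)); last by rewrite /z /a1; ring.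
rewrite csE -[leRHS]mulrA ler_wpM2l // [leRHS]mulrDl lerD //.
  rewrite mulrC; apply: ler_pM; rewrite ?addr_ge0 //.
  - by clearbody a1; lra.
  - exact: le_trans sb a1d.
have zW : cW * z <= cW.
  have [hm|lm] := boolP (heavy_info m); last by rewrite light // !mul0r.
  rewrite -[leRHS]mulr1 ler_wpM2l // -(@expr_le1 _ 2) //.
  rewrite (_ : z ^+ 2 = a3); last by rewrite /z /a3 exprMn -exprM.
  exact: le_trans (h3 hm) (le_trans dd d1).
apply: (ler_pM (mulr_ge0 cW0 z0) (sqr_ge0 a1) zW); exact: le_trans sq1 dd.
Qed.

End Rates.

(** * Asymptotics *)

Section Sequences.
Context {R : realType}.
Implicit Types (u de : nat -> R) (N : nat).

Lemma cvg0_dominated u de c N : (forall n, (N <= n)%N -> `|u n| <= c * de n) ->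
  de @ \oo --> (0 : R) -> u @ \oo --> (0 : R).
Proof.
move=> h de0; have c0 : (fun n => c * de n) @ \oo --> (0 : R).
  by rewrite -(mulr0 c); apply: cvgM => //; exact: cvg_cst.
apply/cvgr0Pnorm_le => e e0; have := c0.
move=> /cvgr0Pnorm_le/(_ _ e0) H; near=> n.
apply: (@le_trans _ _ `|c * de n|); last by near: n.
apply: (le_trans (h n _)); last exact: ler_norm.
by near: n; exact: nbhs_infty_ge.
Unshelve. all: by end_near. Qed.

Lemma cvgy_dominated u de c N : 0 < c ->
  (forall n, (N <= n)%N -> 0 < de n /\ c / de n <= u n) ->
  de @ \oo --> (0 : R) -> u @ \oo --> +oo.
Proof.
move=> c0 h de0; apply/cvgryPge => A.
pose e := c / (`|A| + 1); have A1 : 0 < `|A| + 1 by rewrite ltr_wpDl.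
have e0 : 0 < e by rewrite divr_gt0.
have := de0; move=> /cvgr0Pnorm_le/(_ _ e0) H; near=> n.
have [dn hn] : 0 < de n /\ c / de n <= u n.
  by apply: h; near: n; exact: nbhs_infty_ge.
apply: le_trans hn; rewrite ler_pdivlMr //.
have : `|de n| <= e by near: n.
rewrite gtr0_norm // ler_pdivlMr // => hd; apply: le_trans hd.
rewrite mulrC ler_wpM2l ?(ltW dn) //.
by rewrite (le_trans (ler_norm A)) // lerDl.
Unshelve. all: by end_near. Qed.

Lemma littleo_dominated (u v : nat -> R) de c N :
  (forall n, (N <= n)%N -> `|u n| <= c * de n * `|v n|) ->
  de @ \oo --> (0 : R) -> (u : nat -> R^o) =o_\oo (v : nat -> R^o).
Proof.
move=> h de0; have c0 : (fun n => c * de n) @ \oo --> (0 : R).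
  by rewrite -(mulr0 c); apply: cvgM => //; exact: cvg_cst.
apply/eqoP => e e0; have := c0.
move=> /cvgr0Pnorm_le/(_ _ e0) H; near=> n.
apply: (le_trans (h n _)).
  by near: n; exact: nbhs_infty_ge.
rewrite ler_wpM2r // (le_trans (ler_norm _)) //.
by near: n.
Unshelve. all: by end_near. Qed.

Lemma cvg0_sqrt u : u @ \oo --> (0 : R) -> (fun n => Num.sqrt (u n)) @ \oo --> (0 : R).
Proof.
move=> u0; rewrite -(@sqrtr0 R).
exact: (cvg_comp _ _ u0 (@sqrt_continuous R 0)).
Qed.

Lemma ln_nat_eventually_large (p : nat -> nat) :
  (fun n => ln (p n)%:R : R) @ \oo --> +oo -> forall a : R,
  exists N, forall n, (N <= n)%N -> a <= ln (p n)%:R.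
Proof.
by move=> /cvgryPge/(_ _)H a; have [N _ hN] := H a; exists N => n nN; exact: hN.
Qed.

Lemma cvg0_eventually u (a : R) : u @ \oo --> (0 : R) -> 0 < a ->
  exists N, forall n, (N <= n)%N -> u n <= a.
Proof.
move=> /cvgr0Pnorm_le H a0; have [N _ hN] := H a a0; exists N => n nN.
exact: le_trans (ler_norm _) (hN n nN).
Qed.

Lemma high_probability (d : nat -> measure_display)
    (T : forall n, measurableType (d n)) (P : forall n, probability (T n) R)
    (E : forall n, set (T n)) (p : nat -> nat) N :
  (fun n => ln (p n)%:R : R) @ \oo --> +oo ->
  (forall n, (N <= n)%N -> exists A : set (T n), [/\ measurable A,
     ((1 - 5 * (p n)%:R^-1)%:E <= P n A)%E & A `<=` E n]) ->
  with_high_probability P E.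
Proof.
move=> py h.
have ex n : exists A : set (T n), (measurable A /\ A `<=` E n) /\
    ((N <= n)%N -> ((1 - 5 * (p n)%:R^-1)%:E <= P n A)%E).
  have [nN|_] := leqP N n; last by exists set0; split=> //; split.
  by have [A [mA PA AE]] := h n nN; exists A.
exists (fun n => projT1 (cid (ex n))).
split=> [n|]; first by have [[]] := projT2 (cid (ex n)).
have ip : (fun n => (p n)%:R^-1 : R) @ \oo --> (0 : R).
  apply/cvgr0Pnorm_le => e e0; have [M hM] := ln_nat_eventually_large py (- ln e).
  have [M1 hM1] := ln_nat_eventually_large py 1; near=> n.
  have l1 : 1 <= ln (p n)%:R :> R by apply: hM1; near: n; exact: nbhs_infty_ge.
  have p0 : 0 < (p n)%:R :> R.
    by rewrite ltNge; apply/negP => /ln0 l0; move: l1; rewrite l0 ler10.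
  rewrite ger0_norm ?invr_ge0 ?(ltW p0) // -(lnK p0) -expRN -(lnK e0) ler_expR.
  by rewrite lerNl; apply: hM; near: n; exact: nbhs_infty_ge.
have lim1 : (fun n => (1 - 5 * (p n)%:R^-1)%:E) @ \oo --> (1 : \bar R)%E.
  apply: cvg_EFin; first by near=> n.
  have c5 : (fun n => 5 * (p n)%:R^-1 : R) @ \oo --> (0 : R).
    apply: (@cvg0_dominated _ _ 5 0%N _ ip) => n _.
    by rewrite ger0_norm // mulr_ge0.
  have := cvgB (@cvg_cst _ (1 : R) _ \oo _) c5; rewrite subr0; exact.
apply: (squeeze_cvge _ lim1 (cvg_cst _)); near=> n.
have [[mA _] PA] := projT2 (cid (ex n)); apply/andP; split.
  by apply: PA; near: n; exact: nbhs_infty_ge.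
exact: probability_le1.
Unshelve. all: by end_near. Qed.

(** The square root leaves room for a radius that exceeds the statistical error by
    a diverging factor. For Gamma and negative-binomial regression the cubic
    rate is assumed in the stronger form without the logarithm. *)
Lemma rate_sequence (m : glm R) (s p : nat -> nat) :
  (fun n => (s n)%:R ^+ 2 * ln (p n)%:R / n%:R : R) @ \oo --> (0 : R) ->
  rate_condition m s p ->
  exists2 de : nat -> R, de @ \oo --> (0 : R) & forall n, (0 < n)%N ->
    (0 < s n)%N -> 1 <= ln (p n)%:R :> R ->
    let sr := Num.sqrt (s n)%:R in let lr := Num.sqrt (ln (p n)%:R) in
    let br := (Num.sqrt n%:R)^-1 in
    [/\ 0 < de n, sr ^+ 2 * lr * br <= de n ^+ 2,
        m <> Gaussian -> sr ^+ 3 * br / lr <= de n ^+ 2 &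
        heavy_info m -> sr ^+ 6 * br ^+ 2 <= de n ^+ 2].
Proof.
move=> h1 h2; pose t1 n : R := Num.sqrt ((s n)%:R ^+ 2 * ln (p n)%:R / n%:R).
pose t2 n : R := if heavy_info m then
    Num.sqrt ((s n)%:R ^+ 3 / n%:R) + (s n)%:R ^+ 3 / n%:R
  else if m is Gaussian then 0 else
    Num.sqrt ((s n)%:R ^+ 3 / (n%:R * ln (p n)%:R)).
have t10 : t1 @ \oo --> (0 : R) by exact: cvg0_sqrt.
have t20 : t2 @ \oo --> (0 : R).
  have heavy : (fun n => (s n)%:R ^+ 3 / n%:R : R) @ \oo --> (0 : R) ->
      (fun n => Num.sqrt ((s n)%:R ^+ 3 / n%:R) + (s n)%:R ^+ 3 / n%:R : R)
        @ \oo --> (0 : R).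
    by move=> h; rewrite -[X in _ --> X](addr0 (0 : R)); apply: cvgD => //; exact: cvg0_sqrt.
  rewrite /t2; case: (m) h2 => /= [_|h|h|h|h|kappa h].
  - exact: cvg_cst.
  - exact: cvg0_sqrt.
  - exact: cvg0_sqrt.
  - exact: cvg0_sqrt.
  - exact: heavy.
  - exact: heavy.
exists (fun n => Num.sqrt (t1 n + t2 n)).
  apply: cvg0_sqrt; rewrite -(addr0 (0 : R)); exact: cvgD.
move=> n n0 s0 l1 sr lr br.
have sr0 : 0 < sr by rewrite sqrtr_gt0 ltr0n.
have l0 : 0 < ln (p n)%:R :> R by apply: lt_le_trans l1.
have lr0 : 0 < lr by rewrite sqrtr_gt0.
have br0 : 0 < br by rewrite invr_gt0 sqrtr_gt0 ltr0n.
have sE : (s n)%:R = sr ^+ 2 by rewrite sqr_sqrtr.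
have lE : ln (p n)%:R = lr ^+ 2 by rewrite sqr_sqrtr // ltW.
have nE : n%:R = (br ^+ 2)^-1 by rewrite exprVn invrK sqr_sqrtr.
have lr1 : 1 <= lr by rewrite -(@sqrtr1 R) ler_wsqrtr.
have sqrtE (x y : R) : 0 <= y -> x = y ^+ 2 -> Num.sqrt x = y.
  by move=> y0 ->; rewrite sqrtr_sqr ger0_norm.
have t1E : t1 n = sr ^+ 2 * lr * br.
  apply: sqrtE; first by rewrite mulr_ge0 ?(ltW br0) // mulr_ge0 ?sqr_ge0 ?(ltW lr0).
  by rewrite sE lE nE invrK; ring.
have a20 : 0 < sr ^+ 3 * br by rewrite mulr_gt0 // exprn_gt0.
have t2h : heavy_info m -> t2 n = sr ^+ 3 * br + sr ^+ 6 * br ^+ 2.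
  rewrite /t2 => ->; rewrite sE nE invrK.
  rewrite (sqrtE _ (sr ^+ 3 * br) (ltW a20)); last by ring.
  by rewrite -exprM.
have t2l : ~~ heavy_info m -> m <> Gaussian -> t2 n = sr ^+ 3 * br / lr.
  rewrite /t2 => /negPf -> mg.
  rewrite -(sqrtE ((s n)%:R ^+ 3 / (n%:R * ln (p n)%:R)) (sr ^+ 3 * br / lr)).
  - by case: (m) mg.
  - by rewrite divr_ge0 ?ltW.
  - by rewrite sE nE lE; field; rewrite !gt_eqF.
have t1p : 0 < t1 n by rewrite t1E mulr_gt0 // mulr_gt0 // exprn_gt0.
have a3p : 0 <= sr ^+ 6 * br ^+ 2 by rewrite mulr_ge0 ?sqr_ge0 // exprn_ge0 ?ltW.
have t2p : 0 <= t2 n.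
  rewrite /t2; case: ifP => _.
    by rewrite addr_ge0 ?sqrtr_ge0 // divr_ge0 // exprn_ge0.
  by case: (m) => *; rewrite ?sqrtr_ge0.
have t12 : 0 < t1 n + t2 n by rewrite ltr_pwDl.
rewrite (sqr_sqrtr (ltW t12)); split.
- by rewrite sqrtr_gt0.
- by rewrite -t1E lerDl.
- move=> mg; have [hm|lm] := boolP (heavy_info m); last by rewrite t2l // lerDr ltW.
  apply: (@le_trans _ _ (sr ^+ 3 * br)).
    by rewrite ler_pdivrMr // ler_peMr // ltW.
  by rewrite t2h // addrCA lerDl addr_ge0 // ltW.
- by move=> hm; rewrite t2h // addrA lerDr addr_ge0 // ltW.
Qed.

End Sequences.

(** * Local analysis along the triangular array *)

Theorem proposition3 (R : realType)
  (* the model, its dominating measure and the fixed constants *)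
  (m : glm R) (nu : {measure set R -> \bar R}) (k : R -> R -> R)
  (tmin tmax L : R) (K0 : nat) (cF CF KX KV C : R)
  (* the triangular array *)
  (p : nat -> nat) (X : forall n, 'M[R]_(n, p n)) (tau : forall n, 'I_n -> R)
  (beta0 : forall n, 'cV[R]_(p n))
  (d : nat -> measure_display) (T : forall n, measurableType (d n))
  (P : forall n, probability (T n) R)
  (Y : forall n, 'I_n -> {RV (P n) >-> R})
  (* all nonasymptotic assumptions hold from the sample size n0 on *)
  (n0 : nat) :
  let s0 n := #|supp (beta0 n)| in
  let ss n := sstar K0 (beta0 n) in
  let SS n := Splus K0 (beta0 n) in
  let w n := weight m (X n) (tau n) (beta0 n) in
  let F n := fisherS m (X n) (tau n) (beta0 n) in
  let z n := zvec m (X n) (tau n) (beta0 n) in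
  let logp n : R := ln (p n)%:R in
  let y n (omega : T n) (i : 'I_n) : R := Y n i omega in
  0 < tmin -> (1 < K0)%N -> 0 < cF -> cF < CF -> (0 < n0)%N ->
  (* model *)
  (forall n, (n0 <= n)%N ->
    [/\ forall i, 0 < tau n i,
        restriction m tmin tmax L (tau n) (linpred (X n) (beta0 n)),
        forall i, density_family m nu k (tau n i) &
        glm_law m nu k (X n) (tau n) (beta0 n) (Y n)]) ->
  (* standing asymptotics *)
  (forall n, (n0 <= n)%N -> (1 <= s0 n)%N) ->
  logp @ \oo --> +oo ->
  (fun n => ln n%:R : R^o) =O_\oo (logp : nat -> R^o) ->
  (* assumptions *)
  (fun n => (ss n)%:R : R^o) =o_\oo (fun n => (p n)%:R : R^o) ->
  (forall n, (n0 <= n)%N -> forall S, S \in SS n ->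
    [/\ cF <= rho_min (n%:R^-1 *: F n S),
        rho_min (n%:R^-1 *: F n S) <= rho_max (n%:R^-1 *: F n S) &
        rho_max (n%:R^-1 *: F n S) <= CF]) ->
  (forall n, (n0 <= n)%N -> forall i j, `|X n i j| <= KX) ->
  (forall n, (n0 <= n)%N -> forall i j, Num.sqrt (w n i) * `|X n i j| <= KV) ->
  (m <> Gaussian ->
    forall n, (n0 <= n)%N -> forall S, S \in SS n ->
    forall u : 'cV[R]_#|S|, enorm u = 1 ->
      \sum_i w n i * `|dotv (z n S i) u| ^+ 3 <= C / Num.sqrt n%:R /\
      \sum_i w n i ^+ 2 * dotv (z n S i) u ^+ 4 <= C / n%:R) ->
  (fun n => (s0 n)%:R ^+ 2 * logp n / n%:R) @ \oo --> (0 : R) ->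
  rate_condition m s0 p ->
  [/\ (* (a) *)
      exists dn : nat -> R,
      [/\ forall n, 0 <= dn n,
          (fun n => dn n * Num.sqrt ((ss n)%:R * logp n)) @ \oo --> (0 : R) &
          forall n, (n0 <= n)%N -> forall S, S \in SS n ->
          forall u : 'cV[R]_#|S|, enorm u = 1 ->
          forall lambda : R, `|lambda| * dn n < 1 ->
            (lne ('E_(P n) [fun omega => expR (lambda *
               dotv u (invsqrtmx (F n S) *m
                 subvec S (gradient
                   (loglik m k (X n) (tau n) (y n omega)) (beta0 n))))])
             <= (lambda ^+ 2 / (2 * (1 - `|lambda| * dn n)))%:E)%E],
      (* (b) *)
      (forall n, (n0 <= n)%N -> forall S, S \in SS n ->
        forall y' : 'I_n -> R, (forall i, sample_space m (y' i)) ->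
          concave (loglikS m k (X n) (tau n) y' : 'cV[R]_#|S| -> R)) /\
      (exists r eps : nat -> R,
        [/\ forall n, 0 < r n,
            forall n, 0 < eps n,
            eps @ \oo --> (0 : R),
            (fun n => r n / Num.sqrt ((ss n)%:R * logp n)) @ \oo --> +oo &
            (fun n => eps n * ((s0 n)%:R + logp n) : R^o)
              =o_\oo (logp : nat -> R^o) /\
            with_high_probability P (fun n => [set omega |
              forall S, S \in SS n ->
              forall h : 'cV[R]_#|S|, enorm (sqrtmx (F n S) *m h) <= r n ->
                opnorm (invsqrtmx (F n S)
                  *m (obs_info m k (X n) (tau n) (y n omega)
                        (subvec S (beta0 n) + h) - F n S)
                  *m invsqrtmx (F n S)) <= eps n])]) &
      (* (c) *)
      exists r kappabar : nat -> R,
      [/\ forall n, 0 < r n,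
          forall n, 0 <= kappabar n,
          (fun n => r n / Num.sqrt (s0 n)%:R) @ \oo --> +oo,
          (fun n => (s0 n)%:R * kappabar n) @ \oo --> (0 : R) &
          with_high_probability P (fun n => [set omega |
            let S0 := supp (beta0 n) in
            let bhat := mle m k (X n) (tau n) S0 (y n omega) in
            let J := mle_info m k (X n) (tau n) S0 (y n omega) in
            forall u : 'cV[R]_#|S0|,
              0 < enorm (sqrtmx J *m u) -> enorm (sqrtmx J *m u) <= r n ->
              opnorm (invsqrtmx J
                *m (obs_info m k (X n) (tau n) (y n omega) (bhat + u) - J)
                *m invsqrtmx J) / enorm (sqrtmx J *m u) <= kappabar n])]].
Proof.
move=> s0 ss SS w F z logp y tmin0 K01 cF0 cFCF n00 model s1 lpy _ sso spec XK _ mom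
  rate1 rate2.
have ok : model_ok m.
  have [_ restr _ _] := model n0 (leqnn n0).
  by case: (m) restr => //= kappa [].
have obs n i : (n0 <= n)%N ->
    obs_restriction m tmin tmax L (tau n i) (linpred (X n) (beta0 n) i).
  move=> nn; have [_ restr _ _] := model n nn.
  by case: (m) restr => //= kappa [k0 /(_ i)].
have ek n i : (n0 <= n)%N -> eta_ok m L (linpred (X n) (beta0 n) i).
  by move=> nn; have := obs n i nn; case: (m) => //= -[].
have [cl [K [cB [cW [[cl0 Kge0 cB0 cW0] cBl clG mb]]]]] := model_bounds tmax L ok tmin0.
pose cW' := if heavy_info m then cW else 0.
have cW'0 : 0 <= cW' by rewrite /cW'; case: ifP.
have light : ~~ heavy_info m -> cW' = 0 by rewrite /cW' => /negPf ->.
have reg n i : (n0 <= n)%N ->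
    info_regular m cl K cB cW' (tau n i) (linpred (X n) (beta0 n) i).
  move=> nn; have [tau0 _ _ _] := model n nn.
  have [[w0 cBw lip mgf] _] := mb _ _ (tau0 i) (obs n i nn).
  split=> //; rewrite /cW'; case: ifPn => // lm.
  by rewrite cBl // mul0r.
have gauss n : (n0 <= n)%N -> m = Gaussian -> cl = 0 /\ forall i y,
    info m (tau n i) (linpred (X n) (beta0 n) i) y = weight m (X n) (tau n) (beta0 n) i.
  move=> nn mg; split=> [|i y']; first exact: clG.
  have [tau0 _ _ _] := model n nn.
  by have [_ ->] := mb _ _ (tau0 i) (obs n i nn).
(* absolute values provide nonnegative constants even for an empty design *)
pose KX' := `|KX|; have KX'0 : 0 <= KX' by exact: normr_ge0.
have XK' n : (n0 <= n)%N -> forall i j, `|X n i j| <= KX'.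
  by move=> nn i j; apply: le_trans (XK n nn i j) (ler_norm _).
pose C' := `|C|; have C'0 : 0 <= C' by exact: normr_ge0.
have mom' n : (n0 <= n)%N -> m <> Gaussian -> forall S, S \in SS n ->
    forall u : 'cV[R]_#|S|, enorm u = 1 ->
    \sum_i w n i * `|dotv (z n S i) u| ^+ 3 <= C' / Num.sqrt n%:R /\
    \sum_i w n i ^+ 2 * dotv (z n S i) u ^+ 4 <= C' / n%:R.
  move=> nn mg S Sn u u1; have [h3 h4] := mom mg n nn S Sn u u1.
  split; [apply: (le_trans h3)|apply: (le_trans h4)].
    by rewrite ler_wpM2r ?invr_ge0 ?sqrtr_ge0 ?ler_norm.
  by rewrite ler_wpM2r ?invr_ge0 ?ler_norm.
pose kap : R := K0.+1%:R; have kap0 : 0 < kap by rewrite ltr0n.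
have ssE n : (ss n)%:R = kap * (s0 n)%:R by rewrite /ss /sstar -mulSnr natrM.
have logp0 n : 0 <= logp n.
  rewrite /logp; case: (p n) => [|a]; first by rewrite ln0.
  by rewrite ln_ge0 // ler1n.
have [de de0 hde] := rate_sequence rate1 rate2.
have [c c0 hc] := @local_rates R m K0 cl K cW' cF CF KX' C' cl0 Kge0 cW'0 cF0 KX'0 C'0
  light clG.
pose cc := curv_const m L; have cc0 : 0 <= cc by exact: curv_const_ge0.
(* once de is at most 1 / b, every smallness condition of finite_sample holds *)
pose b := 31 + 4 * c + 180 * (cl * c) + 2 * (cc * c).
have b1 : 1 <= b.
  by rewrite /b; move: c0 (mulr_ge0 cl0 c0) (mulr_ge0 cc0 c0); clear; lra.
have b0 : 0 < b by apply: lt_le_trans b1.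
have [N1 hN1] := ln_nat_eventually_large lpy 1.
have [N2 hN2] := cvg0_eventually de0 (divr_gt0 ltr01 b0).
have [N3 hN3] : exists N, forall n, (N <= n)%N -> (ss n)%:R <= 9^-1 * (p n)%:R :> R.
  have /eqoP/(_ (9^-1))[|N _ hN] := sso; first by rewrite invr_gt0.
  by exists N => n nN; have := hN n nN; rewrite !ger0_norm.
pose N := maxn n0 (maxn N1 (maxn N2 N3)).
have Ngood n : (N <= n)%N -> [/\ (n0 <= n)%N, 1 <= logp n, b * de n <= 1 &
    (8 * ss n < p n)%N].
  rewrite !geq_max => /andP[-> /andP[n1 /andP[n2 n3]]]; split=> //.
  - exact: hN1.
  - by rewrite mulrC -ler_pdivlMr //; exact: hN2.
  have l1 : 1 <= logp n by exact: hN1.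
  have p0 : 0 < (p n)%:R :> R.
    by rewrite ltNge; apply/negP => /ln0 l0; move: l1; rewrite /logp l0 ler10.
  have := hN3 n n3; rewrite -(ltr_nat R) natrM.
  by move: p0; clear; lra.
pose sr n := Num.sqrt (s0 n)%:R : R; pose lr n := Num.sqrt (logp n).
pose br n := (Num.sqrt n%:R)^-1 : R.
(* the statistical error is of order sr lr; de tends to zero *)
pose r n := sr n * lr n / de n.
pose theta n := quad_rate m K0 K cW' cF CF KX' C' (sr n) (lr n) (br n).
pose mu n := cubic_rate K0 cl K cW' cF CF KX' C' (sr n) (lr n) (br n).
have bounds n : (N <= n)%N -> [/\ 0 < sr n, 1 <= lr n, 0 < br n, 0 < de n &
   let zeta := KX' * Num.sqrt (kap / cF) * (sr n * br n) in
   [/\ zeta * r n <= c * de n, lr n * zeta <= c * de n,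
      zeta * (sr n * lr n) <= c * de n,
      2 * mu n * r n + theta n <= c * de n * lr n ^+ 2 / (sr n ^+ 2 + lr n ^+ 2) &
      sr n ^+ 2 * mu n <= c * de n]].
  move=> nN; have [nn l1 bd _] := Ngood n nN; have sn := s1 n nn.
  have npos : (0 < n)%N by exact: leq_trans nn.
  have [d0 e1 e2 e3] := hde n npos sn l1.
  have s1' : 1 <= sr n by rewrite -(@sqrtr1 R) ler_wsqrtr // ler1n.
  have l1' : 1 <= lr n by rewrite -(@sqrtr1 R) ler_wsqrtr.
  have b0' : 0 < br n by rewrite invr_gt0 sqrtr_gt0 ltr0n.
  have d1 : de n <= 1.
    by apply: le_trans bd; rewrite ler_peMl // ltW.
  split=> //; first by apply: lt_le_trans s1'.
  exact: hc.
have ev n : (N <= n)%N -> exists A : set (T n), [/\ measurable A,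
  ((1 - 5 * (p n)%:R^-1)%:E <= P n A)%E &
  forall omega, A omega ->
  (forall S, S \in SS n -> forall h : 'cV[R]_#|S|,
     enorm (sqrtmx (F n S) *m h) <= r n ->
     opnorm (invsqrtmx (F n S) *m
        (obs_info m k (X n) (tau n) (y n omega) (subvec S (beta0 n) + h) - F n S)
        *m invsqrtmx (F n S)) <= 2 * mu n * r n + theta n) /\
  let S0 := supp (beta0 n) in
  let J := mle_info m k (X n) (tau n) S0 (y n omega) in
  forall u : 'cV[R]_#|S0|,
    0 < enorm (sqrtmx J *m u) -> enorm (sqrtmx J *m u) <= r n / 4 ->
    opnorm (invsqrtmx J *m (obs_info m k (X n) (tau n) (y n omega)
        (mle m k (X n) (tau n) S0 (y n omega) + u) - J)
      *m invsqrtmx J) / enorm (sqrtmx J *m u) <= 8 * mu n].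
  move=> nN; have [nn l1 bd pbig] := Ngood n nN; have sn := s1 n nn.
  have npos : (0 < n)%N by exact: leq_trans nn.
  have [tau0 _ dens law] := model n nn.
  have [s0' l1' b0' d0 [z1 z2 z3 z4 z5]] := bounds n nN.
  have l0' : 0 < lr n by apply: lt_le_trans l1'.
  have cd0 : 0 <= c * de n by rewrite mulr_ge0 // ltW.
  have c1 : 0 <= cl * (c * de n) by rewrite mulr_ge0.
  have c2 : 0 <= cc * (c * de n) by rewrite mulr_ge0.
  have bE : b * de n = 31 * de n + 4 * (c * de n) + 180 * (cl * (c * de n))
      + 2 * (cc * (c * de n)) by rewrite /b; ring.
  rewrite bE in bd.
  apply: (@finite_sample R m nu k n (p n) (X n) (tau n) (beta0 n) (d n) (T n) (P n)
    (Y n) K0 cl K cB cW' cF CF KX' C' (sr n) (lr n) (br n) _ _ _ _ _ _ _ _ _ _ _ _ _ _ _ _ _ _ _ _ _ _ _ _ _ _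
    L (r n)) => //.
  - by move=> i; exact: reg.
  - exact: gauss.
  - exact: ltW.
  - by move=> S Sn; have [] := spec n nn S Sn.
  - exact: XK'.
  - exact: mom'.
  - by rewrite sqr_sqrtr.
  - by rewrite sqr_sqrtr.
  - by move=> i; exact: ek.
  - rewrite /r ler_pdivlMr // mulrAC ler_piMl ?(ltW (mulr_gt0 s0' l0')) //.
    by move: bd d0 cd0 c1 c2; clear; lra.
  - by apply: (le_trans z1); move: bd d0 cd0 c1 c2; clear; lra.
  - apply: (le_trans z4); apply: (@le_trans _ _ (c * de n)).
      rewrite ler_pdivrMr; last by rewrite ltr_pwDl ?sqr_ge0 // exprn_gt0.
      by rewrite ler_wpM2l // lerDr sqr_ge0.
    by move: bd d0 cd0 c1 c2; clear; lra.
  - rewrite (_ : _ * _ * _ = 45 * (cl * (KX' * Num.sqrt (kap / cF) * (sr n * br n)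
      * (sr n * lr n)))); last by ring.
    have := ler_wpM2l cl0 z3.
    by move: bd d0 cd0 c1 c2; clear; lra.
  apply: (le_trans (ler_wpM2l cc0 z2)).
  by move: bd d0 cd0 c1 c2; clear; lra.
have lrE n : lr n ^+ 2 = logp n by rewrite sqr_sqrtr.
have srE n : sr n ^+ 2 = (s0 n)%:R by rewrite sqr_sqrtr.
split.
- exists (fun n => cc * (KX' * Num.sqrt ((ss n)%:R / (cF * n%:R)))); split.
  + by move=> n; rewrite mulr_ge0 // mulr_ge0 // sqrtr_ge0.
  + apply: (@cvg0_dominated _ _ _ (cc * KX' * (kap / Num.sqrt cF)) 0%N _
      (cvg0_sqrt rate1)) => n _.
    have scF : 0 < Num.sqrt cF by rewrite sqrtr_gt0.
    rewrite ger0_norm; last first.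
      by rewrite mulr_ge0 ?sqrtr_ge0 // mulr_ge0 // mulr_ge0 // sqrtr_ge0.
    rewrite ssE -!mulrA ler_wpM2l // ler_wpM2l // !mulrA.
    rewrite -sqrtrM; last by rewrite divr_ge0 ?mulr_ge0 // ltW.
    rewrite (_ : _ / _ * _ = (kap / Num.sqrt cF) ^+ 2 *
      ((s0 n)%:R ^+ 2 * logp n / n%:R)); last first.
      rewrite expr_div_n sqr_sqrtr ?(ltW cF0) // invfM; ring.
    by rewrite sqrtrM ?sqr_ge0 // sqrtr_sqr ger0_norm // divr_ge0 ?ltW.
  move=> n nn S Sn u u1 lambda lam.
  have [tau0 _ dens law] := model n nn; have [smin _ _] := spec n nn S Sn.
  have npos : (0 < n)%N by exact: leq_trans nn.
  have /andP[sub Sq] : (supp (beta0 n) \subset S) && (#|S| <= ss n)%N.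
    by move: Sn; rewrite inE.
  have S0 : (0 < #|S|)%N by exact: leq_trans (s1 n nn) (subset_leq_card sub).
  by apply: (cgf_standardized_score ok tau0 dens law (fun i => ek n i nn) npos cF0 S0 Sq
    smin (XK' n nn)).
- split=> [n nn S Sn y' sy|].
    by have [tau0 _ _ _] := model n nn; exact: concave_loglikS.
  (* the values for n < N only have to be positive *)
  exists (fun n => if (N <= n)%N then r n else 1).
  exists (fun n => if (N <= n)%N then
    (c + 1) * de n * logp n / ((s0 n)%:R + logp n) else 1).
  have c1 : 0 < c + 1 by rewrite ltr_wpDl.
  split.
  + move=> n; case: ifP => // nN; have [s0' l1' _ d0 _] := bounds n nN.
    by rewrite /r divr_gt0 // mulr_gt0 // (lt_le_trans _ l1').
  + move=> n; case: ifP => // nN; have [s0' l1' _ d0 _] := bounds n nN.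
    have [_ l1 _ _] := Ngood n nN; have l0 : 0 < logp n by apply: lt_le_trans l1.
    by rewrite divr_gt0 ?mulr_gt0 // ltr_wpDl.
  + apply: (@cvg0_dominated _ _ _ (c + 1) N _ de0) => n nN; rewrite nN.
    have [s0' l1' _ d0 _] := bounds n nN.
    have [_ l1 _ _] := Ngood n nN; have l0 : 0 < logp n by apply: lt_le_trans l1.
    rewrite ger0_norm; last by rewrite divr_ge0 ?mulr_ge0 ?addr_ge0 // ltW.
    rewrite ler_pdivrMr ?ltr_wpDl // ler_wpM2l ?mulr_ge0 ?(ltW c1) ?(ltW d0) //.
    by rewrite lerDr.
  + apply: (@cvgy_dominated _ _ _ (Num.sqrt kap)^-1 N _ _ de0).
      by rewrite invr_gt0 sqrtr_gt0.
    move=> n nN; rewrite nN; have [s0' l1' _ d0 _] := bounds n nN; split=> //.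
    have l0' : 0 < lr n by apply: lt_le_trans l1'.
    rewrite ssE sqrtrM ?mulr_ge0 ?(ltW kap0) // sqrtrM ?(ltW kap0) //.
    rewrite -/(sr n) -/(lr n) le_eqVlt; apply/orP; left; apply/eqP.
    by rewrite /r; field; rewrite !gt_eqF // sqrtr_gt0.
  split.
    apply: (@littleo_dominated _ _ _ _ (c + 1) N _ de0) => n nN; rewrite nN.
    have [s0' l1' _ d0 _] := bounds n nN.
    have [_ l1 _ _] := Ngood n nN; have l0 : 0 < logp n by apply: lt_le_trans l1.
    rewrite divfK; last by rewrite gt_eqF // ltr_wpDl.
    by rewrite normrM (ger0_norm (mulr_ge0 (ltW c1) (ltW d0))).
  apply: (high_probability (N := N) lpy) => n nN.
  have [A [mA PA hA]] := ev n nN; exists A; split=> // omega Ao S Sn h.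
  rewrite nN => hr; have [hb _] := hA omega Ao; apply: (le_trans (hb S Sn h hr)).
  have [s0' l1' _ d0 [_ _ _ z4 _]] := bounds n nN; apply: (le_trans z4).
  rewrite srE lrE ler_wpM2r ?invr_ge0 ?addr_ge0 // ler_wpM2r //.
  by rewrite ler_wpM2r ?(ltW d0) // lerDl.
exists (fun n => if (N <= n)%N then r n / 4 else 1).
exists (fun n => if (N <= n)%N then 8 * mu n else 0).
split.
- move=> n; case: ifP => // nN; have [s0' l1' _ d0 _] := bounds n nN.
  by rewrite /r divr_gt0 // divr_gt0 // mulr_gt0 // (lt_le_trans _ l1').
- move=> n; case: ifP => // nN; have [s0' l1' b0' d0 _] := bounds n nN.
  have l0' : 0 < lr n by apply: lt_le_trans l1'.
  by rewrite mulr_ge0 // cubic_rate_ge0.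
- apply: (@cvgy_dominated _ _ _ 4^-1 N _ _ de0); first by rewrite invr_gt0.
  move=> n nN; rewrite nN; have [s0' l1' _ d0 _] := bounds n nN; split=> //.
  rewrite -/(sr n) (_ : r n / 4 / sr n = 4^-1 / de n * lr n); last first.
    by rewrite /r; field; rewrite !gt_eqF.
  by rewrite ler_peMr // divr_ge0 // ltW.
- apply: (@cvg0_dominated _ _ _ (8 * c) N _ de0) => n nN; rewrite nN.
  have [s0' l1' b0' d0 [_ _ _ _ z5]] := bounds n nN.
  have l0' : 0 < lr n by apply: lt_le_trans l1'.
  rewrite ger0_norm; last by rewrite mulr_ge0 // mulr_ge0 // cubic_rate_ge0.
  rewrite -srE mulrCA -mulrA ler_wpM2l //.
apply: (high_probability (N := N) lpy) => n nN.
have [A [mA PA hA]] := ev n nN; exists A; split=> // omega Ao.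
by rewrite /= nN => u N0' Nr; have [_ hcc] := hA omega Ao; exact: hcc.
Qed.
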